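(* Let $0<\alpha<1$, $T>0$, and let $I\subset(0,1)$ be an arbitrary nonempty open interval. Let $p\in L^\infty(0,1)$, $a\in L^2(0,1)$, and let $u\in L^2(0,T;H^1(0,1))$ satisfy $u-a\in H_\alpha(0,T;H^{-1}(0,1))$ and $$\partial_t^\alpha(u(x,t)-a(x))-u_{xx}(x,t)+p(x)u(x,t)=0\quad\text{in }(0,1)\times(0,T).$$ If $u=0$ in $I\times(0,T)$, then $u\equiv0$ in $(0,1)\times(0,T)$.
   Context: For $\beta>0$, the Riemann-Liouville integral operator is $J^\beta w(t):=\frac1{\Gamma(\beta)}\int_0^t(t-\tau)^{\beta-1}w(\tau)\,d\tau$, acting in the time variable. For $0<\alpha<1$, $H^\alpha(0,T)$ is the Sobolev-Slobodecki space with norm $\left(\|w\|_{L^2(0,T)}^2+\int_0^T\int_0^T\frac{|w(t)-w(\tau)|^2}{|t-\tau|^{1+2\alpha}}\,dt\,d\tau\right)^{1/2}$, and $H_\alpha(0,T)$ is the closure of $\{w\in C^1[0,T];\,w(0)=0\}$ in $H^\alpha(0,T)$. It is known that $H_\alpha(0,T)=J^\alpha L^2(0,T)$. The operator $\partial_t^\alpha:=(J^\alpha)^{-1}$ with domain $H_\alpha(0,T)$ is the minimum closed extension in $L^2(0,T)$ of the Caputo derivative $w\mapsto\frac1{\Gamma(1-\alpha)}\int_0^t(t-\tau)^{-\alpha}w'(\tau)\,d\tau$ defined on $\{w\in C^1[0,T];\,w(0)=0\}$. For a Hilbert space $X$, $H_\alpha(0,T;X)$ and $\partial_t^\alpha$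 on it are the $X$-valued analogues, i.e. $H_\alpha(0,T;X)=J^\alpha L^2(0,T;X)$ and $\partial_t^\alpha=(J^\alpha)^{-1}$. The equation is understood in $L^2(0,T;H^{-1}(0,1))$, where $H^{-1}(0,1)=(H^1_0(0,1))'$ and $u_{xx}$ is taken in the distribution sense; $a$ is regarded as a function constant in $t$. No boundary conditions are imposed at $x=0,1$. *)

(* Defs.v *)
From HB Require Import structures.
From mathcomp Require Import all_boot all_order all_algebra.
From mathcomp Require Import all_classical all_reals all_analysis.

Set Implicit Arguments.
Unset Strict Implicit.
Unset Printing Implicit Defensive.

Import Order.TTheory GRing.Theory Num.Theory.
Import numFieldNormedType.Exports.

Local Open Scope classical_set_scope.
Local Open Scope ring_scope.

(* All function spaces below consist of representatives rather than classes
   modulo a.e. equality: a normed space is a carrier in an ambient module,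
   with a (semi)norm, and two elements v, w of the carrier stand for the same
   element of the space when nnorm (v - w) = 0. The norm is only meaningful on
   the carrier. *)
Record nspace (R : realType) (V : lmodType R) := NSpace {
  ncar : set V;
  nnorm : V -> \bar R }.

Section Bochner.
Context {R : realType} {V : lmodType R}.
Variable X : nspace V.
Local Notation mu := (@lebesgue_measure R).

(* the finite sequence (A_i, v_i)_i encodes the simple function
   \sum_i \1_(A_i) *: v_i *)
Definition sfun_valid (s : seq (set R * V)) : Prop :=
  forall c, c \in s -> measurable c.1 /\ ncar X c.2.

Definition sfun_eval (s : seq (set R * V)) (t : R) : V :=
  \sum_(c <- s) \1_(c.1) t *: c.2.

(* meant for sets D of finite measure *)
Definition sfun_integral (D : set R) (s : seq (set R * V)) : V :=
  \sum_(c <- s) fine (mu (D `&` c.1)) *: c.2.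

Definition strongly_measurable (D : set R) (f : R -> V) : Prop :=
  (\forall t \ae mu, D t -> ncar X (f t)) /\
  exists s : nat -> seq (set R * V),
    (forall n, sfun_valid (s n)) /\
    \forall t \ae mu, D t ->
      nnorm X (f t - sfun_eval (s n) t) @[n --> \oo] --> 0%E.

Definition is_bochner_integral (D : set R) (f : R -> V) (v : V) : Prop :=
  ncar X v /\ strongly_measurable D f /\
  exists s : nat -> seq (set R * V),
    (forall n, sfun_valid (s n)) /\
    (\int[mu]_(t in D) nnorm X (f t - sfun_eval (s n) t))%E
      @[n --> \oo] --> 0%E /\
    nnorm X (v - sfun_integral D (s n)) @[n --> \oo] --> 0%E.

Definition bochner_integral (D : set R) (f : R -> V) : V :=
  xget 0 [set v | is_bochner_integral D f v].

(* L^2(0,T;X) *)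
Definition L2_bochner (T : R) : set (R -> V) := [set f |
  strongly_measurable `]0, T[ f /\
  (\int[mu]_(t in `]0%R, T[) (nnorm X (f t) ^+ 2) < +oo)%E].

Definition Gamma (b : R) : R :=
  \int[mu]_(x in `]0, +oo[) (x `^ (b - 1) * expR (- x)).

Definition RLint (b : R) (f : R -> V) (t : R) : V :=
  (Gamma b)^-1 *:
  bochner_integral `]0, t[ (fun tau => (t - tau) `^ (b - 1) *: f tau).

Definition is_RLint_preimage (T b : R) (w g : R -> V) : Prop :=
  L2_bochner T g /\
  \forall t \ae mu, t \in `]0, T[ -> nnorm X (w t - RLint b g t) = 0%E.

(* H_alpha(0,T;X) = J^alpha L^2(0,T;X) *)
Definition Halpha (T alpha : R) : set (R -> V) :=
  [set w | exists g, is_RLint_preimage T alpha w g].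

(* (J^alpha)^-1 on H_alpha(0,T;X); J^alpha is injective on L^2(0,T;X), so the
   value is determined up to a.e. equality in X *)
Definition dt_alpha (T alpha : R) (w : R -> V) : R -> V :=
  xget (fun=> 0) [set g | is_RLint_preimage T alpha w g].

End Bochner.

Section Sobolev.
Context {R : realType}.
Local Notation mu := (@lebesgue_measure R).

(* L^q(0,1); values outside ]0, 1[ are irrelevant *)
Definition Lq01 (q : \bar R) : set (R -> R) :=
  [set f | f \_ `]0, 1[ \in Lfun mu q].

Definition L2norm01 (f : R -> R) : \bar R :=
  ('N[mu]_2%:E [EFin \o (f \_ `]0%R, 1%R[)])%E.

(* C_c^oo(0,1) *)
Definition test_fun01 : set (R -> R) := [set phi |
  (forall n x, derivable (derive1n n phi) x 1) /\
  closure [set x | phi x != 0] `<=` `]0, 1[].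

Definition is_weak_deriv (f g : R -> R) : Prop :=
  Lq01 2%:E g /\
  forall phi, test_fun01 phi ->
    \int[mu]_(x in `]0, 1[) (f x * derive1 phi x) =
    - \int[mu]_(x in `]0, 1[) (g x * phi x).

Definition weak_deriv (f : R -> R) : R -> R :=
  xget 0 [set g | is_weak_deriv f g].

Definition H1norm (f : R -> R) : \bar R :=
  sqrte (L2norm01 f ^+ 2 + L2norm01 (weak_deriv f) ^+ 2)%E.

Definition H1 : nspace (R -> R) := NSpace
  [set f | Lq01 2%:E f /\ exists g, is_weak_deriv f g] H1norm.

(* closure of C_c^oo(0,1) in H^1(0,1) *)
Definition H10 : set (R -> R) := [set f | ncar H1 f /\
  forall e : R, 0 < e ->
    exists phi, test_fun01 phi /\ (H1norm (f - phi)%R < e%:E)%E].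

(* H^-1(0,1) = (H^1_0(0,1))', represented by functionals on all functions of
   which only the values on H10 matter *)
Definition Hm1norm (F : (R -> R) -> R) : \bar R :=
  ereal_sup [set (`|F phi|)%:E | phi in
    [set phi | H10 phi /\ (H1norm phi <= 1)%E]].

Definition Hm1 : nspace ((R -> R) -> R) := NSpace
  [set F | (forall (c : R) phi psi, H10 phi -> H10 psi ->
              F (c *: phi + psi) = c * F phi + F psi) /\
           (Hm1norm F < +oo)%E] Hm1norm.

(* the embedding L^2(0,1) -> H^-1(0,1) *)
Definition toHm1 (f : R -> R) : (R -> R) -> R :=
  fun phi => \int[mu]_(x in `]0, 1[) (f x * phi x).

(* the element of H^-1(0,1) that, as a distribution, is the second derivative
   of f; it exists and is unique for f in H^1(0,1) *)
Definition dxx (f : R -> R) : (R -> R) -> R :=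
  xget 0 [set F | ncar Hm1 F /\ forall phi, test_fun01 phi ->
    F phi = \int[mu]_(x in `]0, 1[) (f x * derive1n 2 phi x)].

End Sobolev.

(* Main.v *)
(* Fix [s > 0]. Integrating the equation against [e^(- s t)] on (0, T) and using
   that the adjoint of [J^alpha] maps a function [zeta_s] to [s^alpha zeta_s]
   up to an error of size [e^(- s T)], one obtains densities [w_s] and [rho_s] on
   (0, 1), with [rho_s = O(e^(- s T))], such that, in the sense of distributions,
     [w_s'' - s^alpha w_s = p w_s + rho_s - b_s a],  b_s = int_0^T e^(- s t) dt,
   and [w_s = 0] on [I]. Vanishing on [I] supplies Cauchy data, so with
   [k = s^(alpha/2)] and [x0] in [I]
     [w_s(x) = int_(x0)^x sinh (k |x - z|) / k * (p w_s + rho_s - b_s a)(z) dz].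

   First, [a = 0]. For [k] in [kap N] put [W_k = w_s / b_s], which grows
   at most polynomially in [k], and form
   [Z(x, tau) = sum_j c_j e^(- j kap tau) W_(j kap)(x)], where the [c_j] are the
   coefficients of [1 - (1 - e^(- kap sigma) / n)^n], a smooth cut-off at
   [sigma = 0]. The formula for [W_k] becomes d'Alembert's formula for [Z], which is
   therefore bounded, Lipschitz in [tau] and tends to 0 for [tau > 0]; in the limit
   [int_(x0)^x |x - z| a(z) dz = 0] for almost every [x].

   With [a = 0] the formula and Gronwall's argument give
   [w_s = O(e^(c s^(alpha/2)) e^(- s T))]; as [alpha < 2], the truncated Laplace
   transform of [t |-> int u(t) psi] is [O(e^(- s (T - e)))] for every [e > 0], and
   this forces the function to vanish (Mikusinski, Phragmen). *)

Require Import Defs.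
From HB Require Import structures.
From mathcomp Require Import all_boot all_order all_algebra.
From mathcomp Require Import all_classical all_reals all_analysis.
From mathcomp Require Import measurable_realfun measurable_fun_approximation ess_sup_inf.
From mathcomp Require Import ring lra.

Set Implicit Arguments.
Unset Strict Implicit.
Unset Printing Implicit Defensive.

Import Order.TTheory GRing.Theory Num.Theory.
Import numFieldNormedType.Exports.

Local Open Scope classical_set_scope.
Local Open Scope ring_scope.

(** Only real frequencies occur and nothing is continued analytically, so functions must be
    recovered from their transforms at integers. The tool is one family of exponential polynomials,
    1 - (1 - e^(- kap s) / n)^n, whose coefficients satisfy sum_j |c_j| y^j <= e^y - 1 uniformly in
    n; hence n may be chosen after kap. It serves twice: in [Z], and to show that an exponentially
    small truncated transform forces vanishing.

    The obstacle is the source b_s a. It does not decay exponentially in s, so Gronwall's argument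
    cannot remove it. Smallness of [Z] at positive times is cheap; negative times are reached by
    symmetry. The cut-off and its reflection add up to nearly 1, so Z(tau) + Z(- tau) - 2 Z(0)
    solves the d'Alembert formula almost without source and is small. At tau = 0 the formula then
    leaves only half the integral of |x - z| a(z).

    The choice s = k^(2 / alpha) makes s^(alpha / 2) the integer k, and s >= k^2 lets e^(- s T) beat
    the factor e^(2 k) that the cut-off produces on times |tau| <= 2. *)

Section le_integral_ae.
Import HBNNSimple.
(** Every simple function below [f] may be set to 0 on the null set without changing its integral,
    and is then below [g] everywhere. Measurability of [f] and [g] is not assumed because the lemma
    is applied to norms of functions with values in H^-1. *)
Lemma le_nnintegral_ae d (X : measurableType d) (R : realType)
    (m : {measure set X -> \bar R}) (D : set X) (f g : X -> \bar R) :
  measurable D ->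
  (forall x, D x -> (0 <= f x)%E) -> (forall x, D x -> (0 <= g x)%E) ->
  (\forall x \ae m, D x -> (f x <= g x)%E) ->
  (\int[m]_(x in D) f x <= \int[m]_(x in D) g x)%E.
Proof.
move=> mD f0 g0 [N [mN N0 sub]].
rewrite !ge0_integralE//.
apply: ge_ereal_sup => _ [h hf <-].
have mNC : measurable (~` N) by exact: measurableC.
have -> : sintegral m h = sintegral m (proj_nnsfun h mNC).
  rewrite -!integralT_nnsfun.
  apply: ge0_ae_eq_integral; [exact: measurableT|exact/measurable_EFinP|exact/measurable_EFinP| | | ].
  - by move=> x _; rewrite lee_fin.
  - by move=> x _; rewrite lee_fin.
  exists N; split => // x /= /not_implyP[_ hx]; apply: contrapT => Nx.
  by apply: hx; rewrite /= mindicE mem_set// mulr1.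
apply: ereal_sup_ubound; exists (proj_nnsfun h mNC) => // x /=.
rewrite mindicE; have [xN|xN] := pselect (N x).
  have -> : (x \in ~` N) = false by apply/memNset => /(_ xN).
  by rewrite mulr0; exact: erestrict_ge0.
rewrite mem_set// mulr1.
have := hf x; rewrite /patch; case: ifPn => // /set_mem Dx /le_trans; apply.
by apply: contrapT => fg; apply: xN; apply: sub => /= /(_ Dx).
Qed.
End le_integral_ae.

(** * Smooth functions and test functions *)

Section Derive1.
Context {R : realType}.
Implicit Types (f g : R -> R) (x : R).

Lemma is_deriveDf f g x a b : is_derive x 1 f a -> is_derive x 1 g b ->
  is_derive x 1 (fun y => f y + g y) (a + b).
Proof. by move=> fa gb; exact: is_deriveD. Qed.

Lemma is_deriveMf f g x a b : is_derive x 1 f a -> is_derive x 1 g b ->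
  is_derive x 1 (fun y => f y * g y) (a * g x + f x * b).
Proof.
move=> fa gb; apply: (is_derive_eq (is_deriveM fa gb)).
by rewrite /GRing.scale/= addrC (mulrC (g x)).
Qed.

Lemma is_deriveZf c f x a : is_derive x 1 f a ->
  is_derive x 1 (fun y => c * f y) (c * a).
Proof. by move=> fa; exact: is_deriveZ. Qed.

Lemma is_deriveNf f x a : is_derive x 1 f a ->
  is_derive x 1 (fun y => - f y) (- a).
Proof. by move=> fa; exact: is_deriveN. Qed.

Lemma is_deriveVf f x a : f x != 0 -> is_derive x 1 f a ->
  is_derive x 1 (fun y => (f y)^-1) (- a * (f x)^-1 ^+ 2).
Proof.
move=> f0 fa; apply: (is_derive_eq (is_deriveV f0 fa)).
by rewrite /GRing.scale/= -exprVn mulNr mulrC mulNr.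
Qed.

Lemma is_deriveXf n f x a : is_derive x 1 f a ->
  is_derive x 1 (fun y => f y ^+ n) (n%:R * f x ^+ n.-1 * a).
Proof.
move=> fa; rewrite (_ : (fun y => _) = f ^+ n); last first.
  by apply/funext => y; rewrite exprfctE.
exact: (is_deriveX n fa).
Qed.

Lemma is_derive_expRf f x a : is_derive x 1 f a ->
  is_derive x 1 (fun y => expR (f y)) (a * expR (f x)).
Proof.
move=> fa; rewrite mulrC.
exact: (@is_derive1_comp _ expR f x _ a (is_derive_expR (f x)) fa).
Qed.

(** The recursion differentiates first, so an induction hypothesis is applied to the derivative;
    closure under products, inverses and affine substitution becomes an induction on [n]. *)
Fixpoint nsmooth n f : Prop :=
  if n is m.+1 then (forall x, derivable f x 1) /\ nsmooth m (derive1 f) else True.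

Definition smooth f := forall n, nsmooth n f.

Lemma smoothP f : smooth f <-> forall n x, derivable (derive1n n f) x 1.
Proof.
split=> [fs n|fs n].
  elim: n f fs => [|n IH] f fs; first by have [] := fs 1%N.
  by rewrite derive1Sn; apply: IH => m; have [] := fs m.+1.
elim: n f fs => [//|n IH] f fs; split; first exact: (fs 0%N).
by apply: IH => m x; have := fs m.+1 x; rewrite derive1Sn.
Qed.

Lemma derive1_is_derive f g : (forall x, is_derive x 1 f (g x)) -> derive1 f = g.
Proof. by move=> fg; apply/funext => x; rewrite derive1E derive_val. Qed.

Lemma derive1_val f x a : is_derive x 1 f a -> derive1 f x = a.
Proof. by move=> fa; rewrite derive1E derive_val. Qed.

Lemma derivable_is_derive f x : derivable f x 1 -> is_derive x 1 f (derive1 f x).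
Proof. by move=> fx; rewrite derive1E; apply: DeriveDef. Qed.

Lemma nsmooth_is_derive n f g : (forall x, is_derive x 1 f (g x)) ->
  nsmooth n g -> nsmooth n.+1 f.
Proof. by move=> fg ng; split => //; rewrite (derive1_is_derive fg). Qed.

Lemma nsmoothW n f : nsmooth n.+1 f -> nsmooth n f.
Proof. by elim: n f => [//|n IH] f [df /IH]; split. Qed.

Lemma nsmoothD n f g : nsmooth n f -> nsmooth n g ->
  nsmooth n (fun x => f x + g x).
Proof.
elim: n f g => [//|n IH] f g [df nf] [dg ng].
apply: (@nsmooth_is_derive _ _ (fun x => derive1 f x + derive1 g x)); last exact: IH.
by move=> x; apply: is_deriveDf; exact: derivable_is_derive.
Qed.

Lemma nsmoothM n f g : nsmooth n f -> nsmooth n g ->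
  nsmooth n (fun x => f x * g x).
Proof.
elim: n f g => [//|n IH] f g nf ng; have [df nf'] := nf; have [dg ng'] := ng.
apply: (@nsmooth_is_derive n (fun x => f x * g x) (fun x => derive1 f x * g x + f x * derive1 g x)).
  by move=> x; apply: is_deriveMf; exact: derivable_is_derive.
by apply: nsmoothD; apply: IH => //; exact: nsmoothW.
Qed.

Lemma nsmooth_cst n c : nsmooth n (fun=> c).
Proof.
elim: n c => [//|n IH] c; exact: (@nsmooth_is_derive _ _ (fun=> 0)).
Qed.

Lemma nsmoothV n f : (forall x, f x != 0) -> nsmooth n f ->
  nsmooth n (fun x => (f x)^-1).
Proof.
move=> f0; elim: n => [//|n IH] nf; have [df nf'] := nf.
apply: (@nsmooth_is_derive n (fun x => (f x)^-1) (fun x => (-1 * derive1 f x) * ((f x)^-1 * (f x)^-1))).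
  move=> x; rewrite mulN1r -expr2; apply: is_deriveVf => //.
  exact: derivable_is_derive.
have /IH ns : nsmooth n f by exact: nsmoothW.
by do 2 apply: nsmoothM => //; exact: nsmooth_cst.
Qed.

Lemma smoothD f g : smooth f -> smooth g -> smooth (fun x => f x + g x).
Proof. by move=> fs gs n; exact: nsmoothD. Qed.

Lemma smoothM f g : smooth f -> smooth g -> smooth (fun x => f x * g x).
Proof. by move=> fs gs n; exact: nsmoothM. Qed.

Lemma smooth_cst c : smooth (fun=> c).
Proof. by move=> n; exact: nsmooth_cst. Qed.

Lemma smoothN f : smooth f -> smooth (fun x => - f x).
Proof.
move=> fs; have := smoothM (smooth_cst (-1)) fs.
by under eq_fun do rewrite mulN1r.
Qed.

Lemma smoothB f g : smooth f -> smooth g -> smooth (fun x => f x - g x).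
Proof. by move=> fs gs; apply: smoothD => //; exact: smoothN. Qed.

Lemma smooth_is_derive f g : (forall x, is_derive x 1 f (g x)) ->
  smooth g -> smooth f.
Proof. by move=> fg gs [//|n]; apply: (nsmooth_is_derive fg). Qed.

Lemma smooth_derive1 f : smooth f -> smooth (derive1 f).
Proof. by move=> fs n; have [] := fs n.+1. Qed.

Lemma smooth_derivable f x : smooth f -> is_derive x 1 f (derive1 f x).
Proof. by move=> fs; have [df _] := fs 1%N; exact: derivable_is_derive. Qed.

Lemma smooth_continuous f : smooth f -> continuous f.
Proof.
move=> fs x; apply: differentiable_continuous; apply/derivable1_diffP.
by have [] := fs 1%N.
Qed.

Lemma is_derive_affine (a b : R) x : is_derive x 1 (fun y => a * y + b) a.
Proof.
have h : is_derive x 1 (fun y : R => a * y + b) (a * 1 + 0).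
  exact: (is_deriveDf (is_deriveZf a (is_derive_id x 1)) (is_derive_cst b x 1)).
by apply: is_derive_eq; rewrite mulr1 addr0.
Qed.

Lemma nsmooth_affine n f a b : nsmooth n f -> nsmooth n (fun x => f (a * x + b)).
Proof.
elim: n f => [//|n IH] f [df nf].
apply: (@nsmooth_is_derive n (fun x => f (a * x + b)) (fun x => derive1 f (a * x + b) * a)).
  move=> x; apply: (@is_derive1_comp _ f (fun y => a * y + b)).
    exact: derivable_is_derive.
  exact: is_derive_affine.
by apply: nsmoothM; [exact: IH|exact: nsmooth_cst].
Qed.

Lemma smooth_affine f a b : smooth f -> smooth (fun x => f (a * x + b)).
Proof. by move=> fs n; exact: nsmooth_affine. Qed.

Lemma smooth_expR (a : R) : smooth (fun x => expR (a * x)).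
Proof.
have es : smooth (@expR R).
  elim=> [//|n IH]; apply: (@nsmooth_is_derive _ _ expR) => // x.
have := smooth_affine a 0 es; by under eq_fun do rewrite addr0.
Qed.

End Derive1.

(** * Flat functions, smooth steps and test functions *)

Section Bump.
Context {R : realType}.
Implicit Types (f g phi : R -> R) (x : R).

(** The difference quotient at 0 is bounded by C |z|. This settles the only delicate point of the
    flat functions, the junction at 0. *)
Lemma is_derive0_sqr f (C : R) : (forall x, `|f x| <= C * x ^+ 2) ->
  is_derive (0 : R) 1 f 0.
Proof.
move=> fC.
have f0 : f 0 = 0.
  by apply/eqP; rewrite -normr_le0; have := fC 0; rewrite expr0n/= mulr0.
apply/is_derive1_caratheodory; exists (fun z => f z / z); split.
- move=> z; rewrite f0 !subr0; have [->|z0] := eqVneq z 0.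
    by rewrite mulr0 f0.
  by rewrite divfK.
- rewrite /prop_for /continuous_at invr0 mulr0.
  apply/norm_cvg0P.
  apply: (@squeeze_cvgr _ _ _ _ (fun=> 0) (fun z => C * `|z|)).
  + near=> z; rewrite normr_ge0/=; have [->|z0] := eqVneq z 0.
      by rewrite f0 mul0r normr0 mulr0.
    rewrite normrM normfV ler_pdivrMr ?normr_gt0//.
    by rewrite -mulrA -expr2 real_normK ?num_real// fC.
  + exact: cvg_cst.
  + rewrite -[X in _ --> X](mulr0 C); apply: cvgMr.
    by have := @norm_continuous R R 0; rewrite /continuous_at normr0; apply.
- by rewrite f0 mul0r.
Unshelve. all: by end_near. Qed.

(** The family x^(-n) e^(-1/x), extended by 0, is closed under differentiation up to linear
    combinations, so smoothness of all its members is proved by one induction. *)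
Definition flatfun (n : nat) x : R :=
  if 0 < x then x^-1 ^+ n * expR (- x^-1) else 0.

(** With y = 1/x, the exponential series gives e^y >= y^(n+2) / (n+2)!, which absorbs y^n and leaves
    y^(-2). *)
Lemma flatfun_sqr n x : `|flatfun n x| <= (n.+2)`!%:R * x ^+ 2.
Proof.
rewrite /flatfun; case: ifPn => [x0|_]; last by rewrite normr0 mulr_ge0// sqr_ge0.
set y := x^-1; have y0 : 0 < y by rewrite invr_gt0.
rewrite ger0_norm; last by rewrite mulr_ge0 ?exprn_ge0 ?expR_ge0 ?ltW.
rewrite expRN ler_pdivrMr ?expR_gt0//.
have F0 : 0 < (n.+2)`!%:R :> R by rewrite ltr0n fact_gt0.
have F2 : 0 < (n.+2)`!%:R * x ^+ 2 by rewrite mulr_gt0// exprn_gt0.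
have h := @expR_ge1Dxn _ y n.+1 (ltW y0).
rewrite -(ler_pM2l F2) in h; apply: le_trans h.
rewrite mulrDr mulr1 ler_wpDl ?(ltW F2)//.
have -> : (n.+2)`!%:R * x ^+ 2 * (y ^+ n.+2 / (n.+2)`!%:R) = x ^+ 2 * y ^+ n.+2.
  by field; rewrite gt_eqF.
rewrite -(addn2 n) exprD mulrCA -exprMn /y mulfV ?gt_eqF//.
by rewrite expr1n mulr1.
Qed.

Lemma is_derive_flatfun n x :
  is_derive x 1 (flatfun n) (flatfun n.+2 x - n%:R * flatfun n.+1 x).
Proof.
have [x0|x0|->] := ltgtP x 0.
- rewrite /flatfun ltNge (ltW x0)/= mulr0 subr0.
  apply: (@near_eq_is_derive _ _ _ (fun=> 0)).
    near=> z; have z0 : z < 0 by near: z; exact: lt_nbhsl.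
    by rewrite ltNge (ltW z0).
- rewrite {2 3}/flatfun x0.
  apply: (@near_eq_is_derive _ _ _ (fun z : R => z^-1 ^+ n * expR (- z^-1))).
    near=> z; have z0 : 0 < z by near: z; exact: lt_nbhsr.
    by rewrite /flatfun z0.
  have dV : is_derive x 1 (fun z : R => z^-1) (- 1 * x^-1 ^+ 2).
    exact: (is_deriveVf (lt0r_neq0 x0) (is_derive_id x 1)).
  have dVn : is_derive x 1 (fun z : R => z^-1 ^+ n) (n%:R * x^-1 ^+ n.-1 * (- 1 * x^-1 ^+ 2)).
    exact: (is_deriveXf n dV).
  apply: (is_derive_eq (is_deriveMf dVn (is_derive_expRf (is_deriveNf dV)))).
  rewrite mulN1r opprK; case: n {dVn} => [|n]; rewrite ?mul0r ?add0r ?subr0 //=.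
    by rewrite expr0 mul1r.
  by rewrite !exprS; ring.
- have -> : flatfun n.+2 0 - n%:R * flatfun n.+1 0 = 0 by rewrite /flatfun ltxx mulr0 subr0.
  exact: is_derive0_sqr (flatfun_sqr n).
Unshelve. all: by end_near. Qed.

Lemma smooth_flatfun n : smooth (flatfun n).
Proof.
move=> m; elim: m n => [//|m IH] n.
apply: (nsmooth_is_derive (is_derive_flatfun n)).
apply: nsmoothD => //.
under eq_fun do rewrite -mulNr.
by apply: nsmoothM => //; exact: nsmooth_cst.
Qed.

Lemma flatfun_ge0 n x : 0 <= flatfun n x.
Proof.
by rewrite /flatfun; case: ifPn => // x0; rewrite mulr_ge0 ?expR_ge0 ?exprn_ge0 ?invr_ge0 ?ltW.
Qed.

Lemma flatfun_gt0 n x : 0 < x -> 0 < flatfun n x.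
Proof.
by move=> x0; rewrite /flatfun x0 mulr_gt0 ?expR_gt0 ?exprn_gt0 ?invr_gt0.
Qed.

Lemma flatfun_le0 n x : x <= 0 -> flatfun n x = 0.
Proof. by move=> x0; rewrite /flatfun ltNge x0. Qed.

Lemma flatfun_le1 x : flatfun 0 x <= 1.
Proof.
rewrite /flatfun; case: ifPn => // x0.
by rewrite expr0 mul1r expR_le1 oppr_le0 invr_ge0 ltW.
Qed.

Lemma flatfun_cvg1 x : 0 < x -> flatfun 0 (n.+1%:R * x) @[n --> \oo] --> (1 : R).
Proof.
move=> x0.
rewrite (_ : (fun n => _) = fun n : nat => expR (- (x^-1 * n.+1%:R^-1))); last first.
  apply/funext => n; rewrite /flatfun mulr_gt0 ?ltr0n// expr0 mul1r.
  by rewrite invfM mulrC.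
rewrite -[X in _ --> X]expR0; apply: continuous_cvg; first exact: continuous_expR.
rewrite -[X in _ --> X]oppr0; apply: cvgN; rewrite -[X in _ --> X](mulr0 x^-1).
by apply: cvgMr; exact: cvg_harmonic.
Qed.

Lemma smooth_step (c d : R) : c < d -> exists chi : R -> R,
  [/\ smooth chi, (forall x, 0 <= chi x <= 1),
      (forall x, x <= c -> chi x = 0) & (forall x, d <= x -> chi x = 1)].
Proof.
move=> cd; pose u x := flatfun 0 (1 * x + - c); pose v x := flatfun 0 (-1 * x + d).
have su : smooth u by apply: smooth_affine; exact: smooth_flatfun.
have sv : smooth v by apply: smooth_affine; exact: smooth_flatfun.
have uv0 x : 0 < u x + v x.
  have [xc|xc] := ltP c x.
    by rewrite ltr_pwDl ?flatfun_ge0// flatfun_gt0// mul1r subr_gt0.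
  by rewrite ltr_wpDl ?flatfun_ge0// flatfun_gt0// mulN1r addrC subr_gt0 (le_lt_trans xc).
exists (fun x => u x * (u x + v x)^-1); split.
- apply: smoothM => // n; apply: nsmoothV; last exact: (smoothD su sv).
  by move=> x; rewrite gt_eqF.
- move=> x; rewrite divr_ge0 ?flatfun_ge0 ?(ltW (uv0 x))//=.
  by rewrite ler_pdivrMr// mul1r lerDl flatfun_ge0.
- by move=> x xc; rewrite {1}/u flatfun_le0 ?mul0r// mul1r subr_le0.
- move=> x xd; rewrite /v flatfun_le0 ?addr0 ?mulfV//; last first.
    by rewrite mulN1r addrC subr_le0.
  by rewrite gt_eqF// flatfun_gt0// mul1r subr_gt0 (lt_le_trans cd).
Qed.

(** A closed set inside ]0, 1[ keeps a positive distance from both end points. The right-hand form,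
    with an explicit compact interval, is the one used in all later arguments. *)
Lemma test_fun01P phi : test_fun01 phi <->
  smooth phi /\ exists l r, [/\ 0 < l, l < r, r < 1 &
                                forall x, phi x != 0 -> l <= x <= r].
Proof.
split=> [[sm cl]|[sm [l [r [l0 lr r1 lrP]]]]]; last first.
  split; first exact/smoothP.
  have cI : closed (`[l, r]%classic : set R) by exact: interval_closed.
  move=> x xcl; have : `[l, r]%classic x.
    rewrite ((closure_id _).1 cI).
    by apply: closure_subset xcl => z /= /lrP; rewrite in_itv.
  rewrite /= !in_itv/= => /andP[lx xr].
  by rewrite (lt_le_trans l0 lx) (le_lt_trans xr r1).
split; first exact/smoothP.
set K := [set x | phi x != 0] in cl.
have K01 x : K x -> 0 < x < 1.
  by move=> Kx; have := cl _ (subset_closure Kx); rewrite /= in_itv.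
have away y : ~ `]0, 1[%classic y -> exists2 e : R, 0 < e & forall x, K x -> e <= `|y - x|.
  move=> y01; have : ~ closure K y by move=> /cl.
  rewrite /closure/= -existsNE => -[B /not_implyP[/nbhs_ballP[e /= e0 eB] KB]].
  exists e => // x Kx; rewrite leNgt; apply/negP => xe; apply: KB.
  by exists x; split => //; apply: eB.
have [|e e0 eP] := away 0; first by rewrite /= in_itv/= ltxx.
have [|e' e'0 e'P] := away 1; first by rewrite /= in_itv/= ltxx andbF.
(* The values 1/4 and 3/4 only secure l < r and 0 < l, r < 1, including the case of an empty
   support. *)
exists (Num.min e (1 / 4)), (Num.max (1 - e') (3 / 4)); split.
- by rewrite lt_min e0/=; lra.
- by rewrite lt_max !gt_min; apply/orP; right; apply/orP; right; lra.
- by rewrite gt_max; apply/andP; split; lra.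
- move=> x Kx; have /andP[x0 x1] := K01 _ Kx; rewrite ge_min le_max.
  have := eP _ Kx; rewrite sub0r normrN gtr0_norm// => ->.
  have := e'P _ Kx; rewrite gtr0_norm ?subr_gt0// => h.
  by apply/orP; left; lra.
Qed.

End Bump.

(** * Real-valued integrals *)

Lemma mu_itv_oo {R : realType} (a b : R) : a <= b ->
  @lebesgue_measure R `]a, b[%classic = (b - a)%:E.
Proof.
move=> ab; have := @lebesgue_measure_itv R `]a, b[; rewrite /= lte_fin => ->.
have [ab2|ba|->] := ltgtP a b; [by rewrite EFinB| |by rewrite subrr].
by move: ab; rewrite leNgt ba.
Qed.

Section AlmostEverywhere.
Context d (X : measurableType d) (R : realType).
Variable m : {measure set X -> \bar R}.
Implicit Types P Q : X -> Prop.

Lemma aeS P Q : (forall x, P x -> Q x) -> (\forall x \ae m, P x) ->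
  \forall x \ae m, Q x.
Proof. by move=> PQ; apply: filterS. Qed.

Lemma aeI P Q : (\forall x \ae m, P x) -> (\forall x \ae m, Q x) ->
  \forall x \ae m, P x /\ Q x.
Proof. by move=> p q; apply: filterI. Qed.

Lemma ae_forall (P : nat -> X -> Prop) : (forall n, \forall x \ae m, P n x) ->
  \forall x \ae m, forall n, P n x.
Proof. by move=> Pn; apply: ae_foralln. Qed.

End AlmostEverywhere.

Section RealIntegral.
Context d (X : measurableType d) (R : realType).
Variable m : {measure set X -> \bar R}.
Variables (D : set X) (mD : measurable D).
Implicit Types f g h : X -> R.
Local Notation itg := (fun f => m.-integrable D (EFin \o f)).

Lemma itg_meas f : itg f -> measurable_fun D f.
Proof. by move=> /measurable_int/measurable_EFinP. Qed.

Lemma itg_le f g : measurable_fun D f -> (forall x, D x -> `|f x| <= g x) ->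
  itg g -> itg f.
Proof.
move=> mf fg; apply: le_integrable => //; first exact/measurable_EFinP.
by move=> x Dx /=; rewrite lee_fin (le_trans (fg _ Dx))// ler_norm.
Qed.

Lemma itg_norm f : itg f -> itg (fun x => `|f x|).
Proof. by move=> fi; have := integrable_norm fi. Qed.

Lemma eq_itg f g : (forall x, D x -> f x = g x) -> itg f -> itg g.
Proof.
by move=> fg; apply: eq_integrable => // x /set_mem Dx /=; rewrite fg.
Qed.

Lemma itgM_bdd f h (M : R) : itg f -> measurable_fun D h ->
  (forall x, D x -> `|h x| <= M) -> itg (fun x => f x * h x).
Proof.
move=> fi mh hM; apply: (@itg_le _ (fun x => M * `|f x|)).
- by apply: measurable_funM => //; exact: itg_meas.
- by move=> x Dx; rewrite normrM mulrC ler_wpM2r ?hM.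
- have := integrableZl mD M (itg_norm fi).
  by apply: eq_integrable.
Qed.

Lemma itgD f g : itg f -> itg g -> itg (fun x => f x + g x).
Proof. by move=> fi gi; have := integrableD mD fi gi; apply: eq_integrable. Qed.

Lemma itgZ c f : itg f -> itg (fun x => c * f x).
Proof. by move=> fi; have := integrableZl mD c fi; apply: eq_integrable. Qed.

Lemma itgN f : itg f -> itg (fun x => - f x).
Proof. by move=> fi; have := integrableN fi; apply: eq_integrable. Qed.

Lemma itgB f g : itg f -> itg g -> itg (fun x => f x - g x).
Proof. by move=> fi gi; apply: itgD => //; exact: itgN. Qed.

Lemma itg0 : itg (fun=> 0).
Proof. by apply: eq_integrable (integrable0 m D) => //. Qed.

Lemma itg_sum I (s : seq I) (P : pred I) (F : I -> X -> R) :
  (forall i, P i -> itg (F i)) -> itg (fun x => \sum_(i <- s | P i) F i x).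
Proof.
move=> Fi; elim: s => [|i s IH].
  by under eq_fun do rewrite big_nil; exact: itg0.
case Pi : (P i); under eq_fun do rewrite big_cons Pi; last exact: IH.
by apply: itgD => //; exact: Fi.
Qed.

Lemma Rint_ae_eq f g : measurable_fun D f -> measurable_fun D g ->
  (\forall x \ae m, D x -> f x = g x) ->
  \int[m]_(x in D) f x = \int[m]_(x in D) g x.
Proof.
move=> mf mg fg; congr fine; apply: ae_eq_integral => //; try exact/measurable_EFinP.
by apply: filterS fg => x fg Dx; rewrite fg.
Qed.

Lemma Rint_sum I (s : seq I) (P : pred I) (F : I -> X -> R) :
  (forall i, P i -> itg (F i)) ->
  \int[m]_(x in D) (\sum_(i <- s | P i) F i x) =
  \sum_(i <- s | P i) \int[m]_(x in D) F i x.
Proof.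
move=> Fi; elim: s => [|i s IH].
  under eq_Rintegral do rewrite big_nil.
  by rewrite big_nil Rintegral_cst// mul0r.
rewrite big_cons; case Pi : (P i); under eq_Rintegral do rewrite big_cons Pi; last exact: IH.
by rewrite RintegralD ?IH//; [exact: Fi|exact: itg_sum].
Qed.

Lemma RintN f : itg f -> \int[m]_(x in D) (- f x) = - \int[m]_(x in D) f x.
Proof.
move=> fi; rewrite -mulN1r -RintegralZl//.
by apply: eq_Rintegral => x _; rewrite mulN1r.
Qed.

Lemma le_Rint_norm f g : itg f -> itg g -> (forall x, D x -> `|f x| <= g x) ->
  `|\int[m]_(x in D) f x| <= \int[m]_(x in D) g x.
Proof.
move=> fi gi fg; apply: le_trans (le_normr_Rintegral mD fi) _.
by apply: le_Rintegral => //; exact: itg_norm.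
Qed.

Lemma le_Rint_norm_ae f g : itg f -> itg g ->
  (\forall x \ae m, D x -> `|f x| <= g x) ->
  `|\int[m]_(x in D) f x| <= \int[m]_(x in D) g x.
Proof.
move=> fi gi fg; apply: le_trans (le_normr_Rintegral mD fi) _.
rewrite -lee_fin /Rintegral !fineK; last 2 first.
  exact: integrable_fin_num.
  by apply: integrable_fin_num => //; exact: itg_norm.
(* On a null set [g] may be negative; its positive part has the same integral and is nonnegative
   everywhere, as [le_nnintegral_ae] requires. *)
pose g' x := Num.max (g x) 0.
have -> : (\int[m]_(x in D) (g x)%:E = \int[m]_(x in D) (g' x)%:E)%E.
  apply: ae_eq_integral => //; try exact: measurable_int gi.
    apply/measurable_EFinP; apply: measurable_maxr => //; exact: itg_meas.
  apply: filterS fg => x fg Dx; congr EFin; rewrite /g' max_l//.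
  by rewrite (le_trans _ (fg Dx)).
apply: le_nnintegral_ae => //.
  by move=> x _; rewrite lee_fin le_max lexx orbT.
apply: filterS fg => x fg Dx; rewrite lee_fin le_max.
by rewrite fg.
Qed.

Lemma Rint_dominated (f_ : nat -> X -> R) f g :
  (forall n, measurable_fun D (f_ n)) -> measurable_fun D f ->
  (\forall x \ae m, D x -> f_ n x @[n --> \oo] --> f x) ->
  itg g -> (forall n x, D x -> `|f_ n x| <= g x) ->
  itg f /\ (\int[m]_(x in D) f_ n x) @[n --> \oo] --> \int[m]_(x in D) f x.
Proof.
move=> mf_ mf ff gi fg.
have [||||fi _ ff'] := @dominated_convergence _ _ _ m D mD (fun n => EFin \o f_ n)
  (EFin \o f) (EFin \o g) _ _ _ gi _.
- by move=> n; apply/measurable_EFinP.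
- exact/measurable_EFinP.
- apply: filterS ff => x fx Dx; apply: cvg_EFin; first exact: nearW.
  exact: fx.
- by apply: aeW => x n Dx /=; rewrite lee_fin fg.
split => //; apply: fine_cvg.
by rewrite fineK ?integrable_fin_num.
Qed.

Lemma fin_meas_itg f (M : R) : (m D < +oo)%E -> measurable_fun D f ->
  (forall x, D x -> `|f x| <= M) -> itg f.
Proof.
move=> mDoo mf fM; apply: measurable_bounded_integrable => //.
exists M; split; first exact: num_real.
by move=> y My x /fM /le_trans; apply; exact: ltW.
Qed.

End RealIntegral.

(** * The fundamental lemma of the calculus of variations *)

Section FundamentalLemma.
Context {R : realType}.
Local Notation mu := (@lebesgue_measure R).
Implicit Types (f g phi : R -> R) (x : R).

Definition csupp (A B : R) phi := exists l r, [/\ A < l, l < r, r < B &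
  forall x, phi x != 0 -> l <= x <= r].

(** The primitive of [f] is constant on ]A, B[, while by Lebesgue differentiation its derivative is
    [f] almost everywhere. *)
Lemma ae_eq0_intervals (A B : R) f :
  mu.-integrable `]A, B[ (EFin \o f) ->
  (forall l r, A < l -> l < r -> r < B -> \int[mu]_(x in `]l, r[) f x = 0) ->
  \forall x \ae mu, x \in `]A, B[ -> f x = 0.
Proof.
move=> fi f0; pose g := f \_ `]A, B[.
have mAB : measurable (`]A, B[%classic : set R) by exact: measurable_itv.
have gi : mu.-integrable setT (EFin \o g).
  by move/integrable_mkcond : fi => /(_ mAB); rewrite -restrict_EFin.
have giy (y : R) : mu.-integrable `]-oo, y] (EFin \o g).
  by apply: integrableS gi => //; exact: measurable_itv.
have gl : locally_integrable setT g by exact: integrable_locally.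
pose F x := \int[mu]_(t in `]-oo, x]) g t.
have FP : \forall x \ae mu, derivable F x 1 /\ derive1 F x = g x := FTC1Ny giy gl.
have Fc x y : A < x -> x <= y -> y < B -> F y = F x.
  move=> Ax xy yB; apply/eqP; rewrite -subr_eq0; apply/eqP.
  rewrite /F Rintegral_itvB//; [|by rewrite bnd_simp..].
  have [xy'|xy'] := eqVneq x y.
    by rewrite xy' set_itvoc0 ?Rintegral_set0//.
  have {xy xy'} xy : x < y by rewrite lt_neqAle xy'.
  rewrite -Rintegral_itv_bndo_bndc; last first.
    by apply: integrableS gi => //; exact: measurable_itv.
  rewrite -[RHS](f0 _ _ Ax xy yB); apply: eq_Rintegral => z; rewrite inE/= in_itv/= => /andP[xz zy].
  by rewrite /g patchE mem_set//= in_itv/= (lt_trans Ax xz) (lt_trans zy yB).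
apply: aeS FP => x [dF Fx] xAB.
have := Fx; rewrite /g patchE mem_set// => <-; move: xAB; rewrite in_itv/= => /andP[Ax xB].
apply: derive1_val; apply: (@near_eq_is_derive _ _ _ (fun=> F x)).
near=> z; have Az : A < z by near: z; exact: lt_nbhsr.
have zB : z < B by near: z; exact: lt_nbhsl.
have [xz|/ltW zx] := leP x z; [by rewrite (Fc x z)|by rewrite (Fc z x)].
Unshelve. all: by end_near. Qed.

(** Products of two flat functions, steepened by the factor n + 1, are smooth, supported in [l, r],
    bounded by 1 and converge to the indicator of ]l, r[; dominated convergence reduces the claim to
    integrals over intervals. *)
Lemma fundamental_lemma (A B : R) f :
  mu.-integrable `]A, B[ (EFin \o f) ->
  (forall phi, smooth phi -> csupp A B phi ->
     \int[mu]_(x in `]A, B[) (f x * phi x) = 0) ->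
  \forall x \ae mu, x \in `]A, B[ -> f x = 0.
Proof.
move=> fi f0; apply: ae_eq0_intervals => // l r Al lr rB.
have mAB : measurable (`]A, B[%classic : set R) by exact: measurable_itv.
pose p n x := flatfun 0 (n.+1%:R * x + - (n.+1%:R * l)) *
              flatfun 0 (- n.+1%:R * x + n.+1%:R * r).
have sp n : smooth (p n).
  by apply: smoothM; apply: smooth_affine; exact: smooth_flatfun.
have pE n x : p n x = flatfun 0 (n.+1%:R * (x - l)) * flatfun 0 (n.+1%:R * (r - x)).
  by rewrite /p; congr (flatfun 0 _ * flatfun 0 _); ring.
have p01 n x : `|p n x| <= 1.
  by rewrite ger0_norm ?mulr_ge0 ?flatfun_ge0// mulr_ile1 ?flatfun_ge0 ?flatfun_le1.
have p0 n x : ~ (l < x < r) -> p n x = 0.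
  move=> /negP; rewrite negb_and -!leNgt pE => /orP[xl|rx].
    by rewrite flatfun_le0 ?mul0r// mulr_ge0_le0// subr_le0.
  by rewrite mulrC flatfun_le0 ?mul0r// mulr_ge0_le0// subr_le0.
have mf : measurable_fun `]A, B[ f by exact: itg_meas fi.
have mp n : measurable_fun `]A, B[ (p n).
  apply: measurable_funTS; apply: continuous_measurable_fun.
  exact: smooth_continuous.
have [|||||_] := @Rint_dominated _ _ _ mu `]A, B[ mAB (fun n x => f x * p n x)
  (f \_ `]l, r[) (fun x => `|f x|).
- by move=> n; apply: measurable_funM; [exact: mf|exact: mp].
- apply: (measurable_restrict f (measurable_itv `]l, r[) mAB).1.
  by apply: measurable_funS mf => //; exact: subIsetl.
- apply: aeW => x xAB; rewrite patchE; case: ifPn => [|xlr].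
    rewrite inE/= in_itv/= => /andP[lx xr].
    rewrite -[X in _ --> X]mulr1; apply: cvgMr.
    rewrite (_ : p ^~ x = fun n : nat => flatfun 0 (n.+1%:R * (x - l)) * flatfun 0 (n.+1%:R * (r - x))); last first.
      by apply/funext => n; exact: pE.
    rewrite -[X in _ --> X]mulr1.
    by apply: cvgM; apply: flatfun_cvg1; rewrite subr_gt0.
  rewrite (_ : (fun n => _) = fun=> 0); first exact: cvg_cst.
  apply/funext => n; rewrite p0 ?mulr0// => xlr'; move: xlr.
  by rewrite notin_setE/= in_itv/= xlr'.
- exact: itg_norm.
- by move=> n x _; rewrite normrM ler_piMr.
rewrite (_ : (fun n => _) = fun=> 0); last first.
  apply/funext => n; apply: f0 => //; exists l, r; split => // x.
  by apply: contraNT => /negP xlr; rewrite p0// => /andP[/ltW lx /ltW xr]; apply: xlr; rewrite lx.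
rewrite -Rintegral_mkcondr => h.
have {}h := cvg_unique (@norm_hausdorff _ _) h (cvg_cst 0).
rewrite -[RHS]h; congr Rintegral.
rewrite setIidr// => x /=; rewrite !in_itv/= => /andP[lx xr].
by rewrite (lt_trans Al lx) (lt_trans xr rB).
Qed.

End FundamentalLemma.

(** * Fubini's theorem for real-valued integrals *)

Section RealFubini.
Context {R : realType}.
Local Notation mu := (@lebesgue_measure R).

(** Partial integrals in Fubini's theorem are finite only almost everywhere; passing to [fine] makes
    them real functions at no cost. *)
Lemma itg_fine (F : R -> \bar R) : mu.-integrable setT F ->
  mu.-integrable setT (EFin \o (fine \o F)) /\
  \int[mu]_x (fine (F x)) = fine (\int[mu]_x F x).
Proof.
move=> Fi; have mF := measurable_int _ Fi.
have mf : measurable_fun setT (EFin \o (fine \o F)).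
  by apply/measurable_EFinP; apply: measurableT_comp.
split.
  apply: le_integrable Fi => // x _ /=.
  by case: (F x) => [r| |] //=; rewrite ?normr0 ?lee0y ?abse0 ?leey.
congr fine; apply: ae_eq_integral => //.
have := integrable_ae measurableT Fi; apply: aeS => x /(_ I) Fx _.
by rewrite fineK.
Qed.

Lemma Rfubini (H : R * R -> R) : measurable_fun setT H ->
  (\int[mu]_x \int[mu]_y `|H (x, y)|%:E < +oo)%E ->
  [/\ mu.-integrable setT (EFin \o (fun x => \int[mu]_y H (x, y))),
      mu.-integrable setT (EFin \o (fun y => \int[mu]_x H (x, y))) &
      \int[mu]_x \int[mu]_y H (x, y) = \int[mu]_y \int[mu]_x H (x, y)].
Proof.
move=> mH Hoo.
have Hi : (mu \x mu)%E.-integrable setT (EFin \o H).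
  by apply/integrable12ltyP => //; exact/measurable_EFinP.
have [F1 F2] := itg_fine (integrable_fubini_F Hi).
pose H' (z : R * R) := H (z.2, z.1).
have mH' : measurable_fun setT H'.
  by apply: (measurableT_comp mH); exact: measurable_swap.
have H'i : (mu \x mu)%E.-integrable setT (EFin \o H').
  apply/integrable12ltyP; first exact/measurable_EFinP.
  by apply: (integrable21ltyP _ _ _).1 Hi; exact/measurable_EFinP.
have [G1 G2] := itg_fine (integrable_fubini_F H'i).
split => //.
by rewrite [LHS]F2 [RHS]G2; congr fine; exact: (Fubini Hi).
Qed.

(** After extension by 0 the integrand is dominated by M |f(x)| |g(y)|, a product of integrable
    functions. This is the exchange used for the sinh kernel and for the kernel |x - z|. *)
Lemma Rfubini_bdd (D1 D2 : set R) (f g : R -> R) (K : R * R -> R) (M : R) :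
  measurable D1 -> measurable D2 ->
  mu.-integrable D1 (EFin \o f) -> mu.-integrable D2 (EFin \o g) ->
  measurable_fun setT K ->
  (forall x y, D1 x -> D2 y -> `|K (x, y)| <= M) ->
  [/\ mu.-integrable D1 (EFin \o (fun x => f x * \int[mu]_(y in D2) (K (x, y) * g y))),
      mu.-integrable D2 (EFin \o (fun y => g y * \int[mu]_(x in D1) (K (x, y) * f x))) &
      \int[mu]_(x in D1) (f x * \int[mu]_(y in D2) (K (x, y) * g y)) =
      \int[mu]_(y in D2) (g y * \int[mu]_(x in D1) (K (x, y) * f x))].
Proof.
move=> mD1 mD2 fi gi mK KM.
pose f1 := f \_ D1; pose g2 := g \_ D2.
have f1i : mu.-integrable setT (EFin \o f1).
  by move/integrable_mkcond : fi => /(_ mD1); rewrite -restrict_EFin.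
have g2i : mu.-integrable setT (EFin \o g2).
  by move/integrable_mkcond : gi => /(_ mD2); rewrite -restrict_EFin.
pose H (z : R * R) := f1 z.1 * K z * g2 z.2.
have mf1 := itg_meas f1i; have mg2 := itg_meas g2i.
have mH : measurable_fun setT H.
  apply: measurable_funM; [apply: measurable_funM => //|].
    exact: (measurableT_comp mf1 measurable_fst).
  exact: (measurableT_comp mg2 measurable_snd).
have HM x y : `|H (x, y)| <= `|f1 x| * (M * `|g2 y|).
  rewrite /H /f1 /g2/= !patchE; case: ifPn => [/set_mem xD|_]; last first.
    by rewrite !mul0r normr0 mul0r.
  case: ifPn => [/set_mem yD|_]; last by rewrite !mulr0 normr0 !mulr0.
  by rewrite !normrM -mulrA ler_wpM2l// ler_wpM2r// KM.
have IM x : (\int[mu]_y `|H (x, y)|%:E <= (`|f1 x| * (M * \int[mu]_y `|g2 y|))%:E)%E.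
  have gi' := itgZ measurableT (`|f1 x| * M) (itg_norm g2i).
  apply: (@le_trans _ _ (\int[mu]_y (`|f1 x| * M * `|g2 y|)%:E)%E).
    apply: ge0_le_integral => //.
    - apply/measurable_EFinP; apply: measurableT_comp => //.
      by apply: (measurableT_comp mH); exact: measurable_pair1.
    - exact: measurable_int gi'.
    - by move=> y _; rewrite lee_fin -mulrA.
  rewrite -(fineK (integrable_fin_num measurableT gi')) lee_fin.
  rewrite [leLHS](@RintegralZl _ _ _ mu)//; last exact: itg_norm.
  by rewrite mulrA.
have Hoo : (\int[mu]_x \int[mu]_y `|H (x, y)|%:E < +oo)%E.
  pose c := M * \int[mu]_y `|g2 y|.
  have fi' := itgZ measurableT c (itg_norm f1i).
  apply: (@le_lt_trans _ _ (\int[mu]_x (c * `|f1 x|)%:E)%E).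
    apply: ge0_le_integral => //.
    - by move=> x _; apply: integral_ge0.
    - apply: (@measurable_fun_fubini_tonelli_F _ _ _ _ _ mu (fun z => `|H z|%:E)) => //.
      by apply/measurable_EFinP; exact: measurableT_comp.
    - exact: measurable_int fi'.
    - by move=> x _; rewrite mulrC; exact: IM.
  by rewrite -(fineK (integrable_fin_num measurableT fi')) ltry.
have [F1 F2 F3] := Rfubini mH Hoo.
have E1 x : \int[mu]_y H (x, y) =
    ((fun x => f x * \int[mu]_(y in D2) (K (x, y) * g y)) \_ D1) x.
  rewrite patchE; case: ifPn => [xD|xD]; last first.
    under eq_Rintegral do rewrite /H /f1/= patchE ifN// !mul0r.
    by rewrite Rintegral_cst// mul0r.
  have Ki : mu.-integrable D2 (EFin \o (fun y => K (x, y) * g y)).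
    apply: (@eq_itg _ _ _ mu D2 mD2 (fun y => g y * K (x, y))); first by move=> y _; rewrite mulrC.
    apply: (@itgM_bdd _ _ _ mu D2 mD2 g _ M gi).
      by apply: measurable_funTS; apply: (measurableT_comp mK); exact: measurable_pair1.
    by move=> y; apply: KM; exact: set_mem.
  rewrite -RintegralZl// [RHS]Rintegral_mkcond; apply: eq_Rintegral => y _.
  rewrite /H /f1 /g2/= !patchE xD; case: ifPn => _; last by rewrite mulr0.
  by rewrite mulrA.
have E2 y : \int[mu]_x H (x, y) =
    ((fun y => g y * \int[mu]_(x in D1) (K (x, y) * f x)) \_ D2) y.
  rewrite patchE; case: ifPn => [yD|yD]; last first.
    under eq_Rintegral do rewrite /H /g2/= [X in _ * X]patchE ifN// mulr0.
    by rewrite Rintegral_cst// mul0r.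
  have Ki : mu.-integrable D1 (EFin \o (fun x => K (x, y) * f x)).
    apply: (@eq_itg _ _ _ mu D1 mD1 (fun x => f x * K (x, y))); first by move=> x _; rewrite mulrC.
    apply: (@itgM_bdd _ _ _ mu D1 mD1 f _ M fi).
      by apply: measurable_funTS; apply: (measurableT_comp mK); exact: measurable_pair2.
    by move=> x Dx; apply: KM => //; exact: set_mem.
  rewrite -RintegralZl// [RHS]Rintegral_mkcond; apply: eq_Rintegral => x _.
  rewrite /H /f1 /g2/= !patchE yD; case: ifPn => _; last by rewrite !mul0r.
  by ring.
split.
- apply/integrable_mkcond => //; rewrite restrict_EFin.
  by rewrite -(funext E1).
- apply/integrable_mkcond => //; rewrite restrict_EFin.
  by rewrite -(funext E2).
- rewrite Rintegral_mkcond [RHS]Rintegral_mkcond.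
  by rewrite -(funext E1) -(funext E2).
Qed.

End RealFubini.

(** * The representation formula *)

Section CompactSupport.
Context {R : realType}.
Local Notation mu := (@lebesgue_measure R).
Implicit Types (f g phi psi : R -> R) (x z : R).

Lemma csuppS (A B A' B' : R) phi : A' <= A -> B <= B' ->
  csupp A B phi -> csupp A' B' phi.
Proof.
move=> AA BB [l [r [Al lr rB h]]]; exists l, r; split => //.
  exact: le_lt_trans Al.
exact: lt_le_trans rB _.
Qed.

Lemma csuppMl (A B : R) f phi : csupp A B phi -> csupp A B (fun x => f x * phi x).
Proof.
move=> [l [r [Al lr rB h]]]; exists l, r; split => // x fx.
by apply: h; apply: contra_neq fx => ->; rewrite mulr0.
Qed.

Lemma derive1_eq0 phi (S : set R) x : open S -> S x ->
  (forall y, S y -> phi y = 0) -> derive1 phi x = 0.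
Proof.
move=> oS Sx S0; apply: derive1_val.
apply: (@near_eq_is_derive _ _ _ (fun=> 0)).
by apply: filterS (open_nbhs_nbhs (conj oS Sx)) => y Sy; rewrite S0.
Qed.

Lemma csupp_derive1 (A B : R) phi : csupp A B phi -> csupp A B (derive1 phi).
Proof.
move=> [l [r [Al lr rB h]]]; exists l, r; split => // x; apply: contraNT => xlr.
apply/eqP; apply: (@derive1_eq0 _ (~` `[l, r]%classic)).
- by apply: closed_openC; exact: interval_closed.
- by rewrite /= in_itv/=; apply/negP.
- move=> y; rewrite /= in_itv/= => /negP ylr; apply/eqP; apply: contraNT ylr; exact: h.
Qed.

Lemma csupp_eq0 (A B : R) phi x : csupp A B phi -> ~~ (A < x < B) -> phi x = 0.
Proof.
move=> [l [r [Al lr rB h]]]; apply: contraNeq => /h /andP[lx xr].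
by rewrite (lt_le_trans Al lx) (le_lt_trans xr rB).
Qed.

Lemma smooth_measurable f (D : set R) : smooth f -> measurable_fun D f.
Proof.
move=> fs; apply: measurable_funTS; apply: continuous_measurable_fun.
exact: smooth_continuous.
Qed.

Lemma csupp_itg (A B : R) psi : smooth psi -> csupp A B psi ->
  mu.-integrable setT (EFin \o psi).
Proof.
move=> ps [l [r [Al lr rB h]]].
have mlr : measurable (`[l, r]%classic : set R) by exact: measurable_itv.
have : mu.-integrable `[l, r] (EFin \o psi).
  apply: continuous_compact_integrable; first exact: segment_compact.
  by apply: continuous_subspaceT; exact: smooth_continuous.
move=> /integrable_mkcond => /(_ mlr); apply: eq_integrable => // x _.
rewrite patchE; case: ifPn => //; rewrite notin_setE/= in_itv/= => /negP xlr.
by congr EFin; apply/esym/eqP; apply: contraNT xlr; exact: h.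
Qed.

Lemma csupp_bounded (A B : R) psi : smooth psi -> csupp A B psi ->
  exists M, forall x, `|psi x| <= M.
Proof.
move=> ps [l [r [Al lr rB h]]].
have cps : {within `[l, r], continuous psi}.
  by apply: continuous_subspaceT; exact: smooth_continuous.
have [c1 _ h1] := @EVT_max _ psi l r (ltW lr) cps.
have [c2 _ h2] := @EVT_min _ psi l r (ltW lr) cps.
exists (`|psi c1| + `|psi c2|) => x.
have [/h xlr|] := boolP (psi x != 0); last first.
  by move=> /negPn/eqP ->; rewrite normr0 addr_ge0.
have := h1 x; rewrite in_itv/= xlr => /(_ isT) u1.
have := h2 x; rewrite in_itv/= xlr => /(_ isT) u2.
have := ler_norm (- psi c2); have := ler_norm (psi c1); rewrite normrN => n1 n2.
have := normr_ge0 (psi c1); have := normr_ge0 (psi c2) => n3 n4.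
by rewrite ler_norml; apply/andP; split; lra.
Qed.

Definition prim psi z : R := \int[mu]_(y in `]-oo, z]) psi y.

Lemma is_derive_prim (A B : R) psi z : smooth psi -> csupp A B psi ->
  is_derive z 1 (prim psi) (psi z).
Proof.
move=> ps pc; have pi := csupp_itg ps pc.
have [||||dp pE] := @continuous_FTC1 R psi -oo%O z (z + 1) _ _ _ _.
- by rewrite ltrDl.
- by apply: integrableS pi => //; exact: measurable_itv.
- exact: ltNyr.
- exact: smooth_continuous.
by rewrite -pE; exact: derivable_is_derive.
Qed.

Lemma prim_restrict psi z : prim psi z = \int[mu]_y ((psi \_ `]-oo, z]) y).
Proof. by rewrite /prim Rintegral_mkcond. Qed.

Lemma itg_prim psi z : mu.-integrable setT (EFin \o psi) ->
  mu.-integrable setT (EFin \o (psi \_ `]-oo, z])).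
Proof.
move=> ps; have mz : measurable (`]-oo, z]%classic : set R) by exact: measurable_itv.
have pz : mu.-integrable `]-oo, z] (EFin \o psi) by exact: integrableS ps.
by move/integrable_mkcond : pz => /(_ mz); rewrite -restrict_EFin.
Qed.

End CompactSupport.

Section Representation.
Context {R : realType}.
Local Notation mu := (@lebesgue_measure R).
Implicit Types (f g phi psi w G : R -> R) (x y z : R).

Definition between (x0 y z : R) : bool := (x0 < z < y) || (y < z < x0).

(** This is sinh (k r) / k, written with exponentials so that it can be merged with exponential sums
    in time. *)
Definition shk (k r : R) : R := (expR (k * r) - expR (- k * r)) / (2 * k).

(** The absolute value absorbs the orientation of the integral from [x0] to [x]: to the left of [x0]
    both the integral and the odd function sinh change sign. One positive kernel on ]0, 1[ thus
    covers both sides. *)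
Definition Ker (k x0 : R) (p : R * R) : R :=
  if between x0 p.1 p.2 then shk k `|p.1 - p.2| else 0.

Lemma measurable_between x0 : measurable_fun setT (fun p : R * R => between x0 p.1 p.2).
Proof.
apply: measurable_or; apply: measurable_and; apply: measurable_fun_ltr => //.
Qed.

Lemma measurable_shk k : measurable_fun setT (shk k).
Proof.
apply: smooth_measurable; apply: smoothM; last exact: smooth_cst.
by apply: smoothB; exact: smooth_expR.
Qed.

Lemma measurable_Ker k x0 : measurable_fun setT (Ker k x0).
Proof.
apply: measurable_fun_ifT => //; first exact: measurable_between.
apply: (measurableT_comp (measurable_shk k)).
apply: measurableT_comp => //.
by apply: measurable_funB => //.
Qed.

Lemma shk0 k : shk k 0 = 0.
Proof. by rewrite /shk !mulr0 subrr mul0r. Qed.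

Lemma shk_ge0 k r : 0 < k -> 0 <= r -> 0 <= shk k r.
Proof.
move=> k0 r0; rewrite /shk divr_ge0 ?mulr_ge0 ?(ltW k0)// subr_ge0 ler_expR.
by rewrite mulNr -subr_ge0 opprK addr_ge0// mulr_ge0// ltW.
Qed.

Lemma shk_le k r : 0 < k -> 0 <= r -> shk k r <= r * expR (k * r).
Proof.
move=> k0 r0; rewrite /shk ler_pdivrMr ?mulr_gt0//.
have h := expR_ge1Dx (- (2 * (k * r))).
have e : expR (k * r) * expR (- (2 * (k * r))) = expR (- k * r).
  by rewrite -expRD; congr expR; ring.
have := ler_wpM2l (expR_ge0 (k * r)) h; rewrite e => h2.
by have := expR_gt0 (k * r); nra.
Qed.

Lemma shk1_bound k r : 0 < k -> 0 <= r <= 1 -> `|shk k r| <= expR k.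
Proof.
move=> k0 /andP[r0 r1]; rewrite ger0_norm ?shk_ge0//.
apply: le_trans (shk_le k0 r0) _; rewrite -[leRHS]mul1r.
by apply: ler_pM => //; rewrite ?expR_ge0// ler_expR ler_piMr// ltW.
Qed.

Lemma Ker_bound k x0 y z : 0 < k -> 0 <= y <= 1 -> 0 <= z <= 1 ->
  `|Ker k x0 (y, z)| <= expR k.
Proof.
move=> k0 /andP[y0 y1] /andP[z0 z1]; rewrite /Ker/=; case: ifPn => _.
  apply: shk1_bound => //; rewrite normr_ge0/= ler_norml.
  by apply/andP; split; lra.
by rewrite normr0 expR_ge0.
Qed.

End Representation.

Section RepresentationLemma.
Context {R : realType}.
Local Notation mu := (@lebesgue_measure R).
Implicit Types (f g phi psi w G : R -> R) (x y z : R).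

Let I01 : set R := `]0, 1[%classic.

Lemma I01P x : I01 x <-> 0 < x < 1.
Proof. by rewrite /I01/= in_itv. Qed.

(* Variation of constants from both ends; the two solutions differ by
   h, which solves the homogeneous equation, and are glued where w = 0. *)
Lemma glued_solution (k c d x0 : R) psi : 0 < k -> 0 <= c -> c < x0 -> x0 < d ->
  d <= 1 -> smooth psi -> csupp 0 1 psi ->
  exists phi, [/\ smooth phi, csupp 0 1 phi,
    (forall z, ~~ (c < z < d) ->
       derive1 (derive1 phi) z - k ^+ 2 * phi z = psi z) &
    forall z, ~~ (c < z < d) -> phi z = \int[mu]_(y in I01) (Ker k x0 (y, z) * psi y)].
Proof.
move=> k0 c0 cx0 x0d d1 ps pc.
have k20 : 2 * k != 0 by rewrite mulf_neq0 ?gt_eqF.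
pose ea x := expR (k * x); pose eb x := expR (- k * x).
have eab x : ea x * eb x = 1 by rewrite -expRD mulNr subrr expR0.
pose a1 x := ea x * psi x; pose b1 x := eb x * psi x.
have sa1 : smooth a1 by apply: smoothM => //; exact: smooth_expR.
have sb1 : smooth b1 by apply: smoothM => //; exact: smooth_expR.
have ca1 : csupp 0 1 a1 by exact: csuppMl.
have cb1 : csupp 0 1 b1 by exact: csuppMl.
have ia1 := csupp_itg sa1 ca1; have ib1 := csupp_itg sb1 cb1.
pose A := prim a1; pose B := prim b1.
pose Ai := \int[mu]_y a1 y; pose Bi := \int[mu]_y b1 y.
have dA z : is_derive z 1 A (a1 z) by exact: is_derive_prim ca1.
have dB z : is_derive z 1 B (b1 z) by exact: is_derive_prim cb1.
have sA : smooth A by exact: smooth_is_derive sa1.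
have sB : smooth B by exact: smooth_is_derive sb1.
have sea : smooth ea by exact: smooth_expR.
have seb : smooth eb by exact: smooth_expR.
have dea z : is_derive z 1 ea (k * ea z).
  apply: is_derive_expRf; rewrite -[X in is_derive _ _ _ X]mulr1.
  exact: is_deriveZf.
have deb z : is_derive z 1 eb (- k * eb z).
  apply: is_derive_expRf; rewrite -[X in is_derive _ _ _ X]mulr1.
  exact: is_deriveZf.
(* [P2] is the solution that vanishes to the left of the support of [psi], [P2 + h] the one that
   vanishes to its right; [P2'] and [h'] are their derivatives. *)
pose P2 z := (2 * k)^-1 * (ea z * B z - eb z * A z).
pose h z := (2 * k)^-1 * (eb z * Ai - ea z * Bi).
pose P2' z := 2^-1 * (ea z * B z + eb z * A z).
pose h' z := 2^-1 * (- (eb z * Ai) - ea z * Bi).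
have dP2 z : is_derive z 1 P2 (P2' z).
  apply: (is_derive_eq (is_deriveZf (2 * k)^-1 (is_deriveDf (is_deriveMf (dea z) (dB z))
    (is_deriveNf (is_deriveMf (deb z) (dA z)))))).
  have := eab z; rewrite /P2' /a1 /b1 => e.
  by field: e; rewrite gt_eqF.
have dP2' z : is_derive z 1 P2' (k ^+ 2 * P2 z + psi z).
  apply: (is_derive_eq (is_deriveZf 2^-1 (is_deriveDf (is_deriveMf (dea z) (dB z))
    (is_deriveMf (deb z) (dA z))))).
  have := eab z; rewrite /P2 /a1 /b1 => e.
  by field: e; rewrite gt_eqF.
have dh z : is_derive z 1 h (h' z).
  apply: (is_derive_eq (is_deriveZf (2 * k)^-1 (is_deriveDf
    (is_deriveMf (deb z) (is_derive_cst Ai z 1))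
    (is_deriveNf (is_deriveMf (dea z) (is_derive_cst Bi z 1)))))).
  by rewrite /h' /= !mulr0 !addr0; field; rewrite gt_eqF.
have dh' z : is_derive z 1 h' (k ^+ 2 * h z).
  apply: (is_derive_eq (is_deriveZf 2^-1 (is_deriveDf
    (is_deriveNf (is_deriveMf (deb z) (is_derive_cst Ai z 1)))
    (is_deriveNf (is_deriveMf (dea z) (is_derive_cst Bi z 1)))))).
  by rewrite /h /= !mulr0 !addr0; field; rewrite gt_eqF.
have sP2 : smooth P2.
  apply: smoothM; first exact: smooth_cst.
  by apply: smoothB; apply: smoothM.
have sh : smooth h.
  apply: smoothM; first exact: smooth_cst.
  by apply: smoothB; apply: smoothM => //; exact: smooth_cst.
(* The cut-off varies only strictly inside ]c, d[, so it is constant near every point outside, end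
   points included, and does not enter the derivatives there. *)
pose c' := (c + x0) / 2; pose d' := (x0 + d) / 2.
have [chi [schi chi01 chi0 chi1]] : exists chi, [/\ smooth chi,
    (forall x, 0 <= chi x <= 1), (forall x, x <= c' -> chi x = 0) &
    (forall x, d' <= x -> chi x = 1)].
  by apply: smooth_step; rewrite /c' /d'; lra.
pose phi z := P2 z + chi z * h z.
have sphi : smooth phi by apply: smoothD => //; exact: smoothM.
have prim0 (e : R -> R) z : (forall y, y <= z -> psi y = 0) ->
    prim (fun x => e x * psi x) z = 0.
  move=> yz; rewrite prim_restrict (_ : _ \_ _ = cst 0) ?Rintegral_cst ?mul0r//.
  apply/funext => y; rewrite patchE; case: ifPn => //; rewrite inE/= in_itv/= => /yz ->.
  by rewrite mulr0.
have primi (e : R -> R) z : (forall y, z < y -> psi y = 0) ->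
    prim (fun x => e x * psi x) z = \int[mu]_y (e y * psi y).
  move=> yz; rewrite prim_restrict; apply: eq_Rintegral => y _.
  rewrite patchE; case: ifPn => //; rewrite notin_setE/= in_itv/= => /negP.
  by rewrite -ltNge => /yz ->; rewrite mulr0.
have [l [r [l0 lr r1 psilr]]] := pc.
exists phi; split => //.
- exists (Num.min l c'), (Num.max r d'); split.
  + by rewrite lt_min l0/= /c'; lra.
  + by rewrite lt_max !gt_min lr.
  + by rewrite gt_max r1/= /d'; lra.
  + move=> z; apply: contraNT; rewrite negb_and -!ltNge lt_min gt_max => /orP[/andP[zl zc]|/andP[rz dz]].
      have yz y : y <= z -> psi y = 0.
        move=> yz; apply/eqP; apply: contraT => /psilr /andP[ly _].
        by have := le_lt_trans yz (lt_le_trans zl ly); rewrite ltxx.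
      by rewrite /phi /P2 chi0 ?(ltW zc)// /A /B !prim0// !mulr0 subrr mulr0 mul0r addr0.
    have yz y : z < y -> psi y = 0.
      move=> yz; apply/eqP; apply: contraT => /psilr /andP[_ yr].
      by have := lt_le_trans (lt_trans rz yz) yr; rewrite ltxx.
    rewrite /phi /P2 /h chi1 ?(ltW dz)// /A /B !primi// -/Ai -/Bi.
    by apply/eqP; ring.
- move=> z zcd.
  (* Near such a point [phi] is [P2 + b * h] with a constant [b] equal to 0 or 1, and the
     homogeneous part drops out of the equation. *)
  have [b zb] : exists b, \forall y \near z, phi y = P2 y + b * h y.
    move: zcd; rewrite negb_and -!leNgt => /orP[zc|dz].
      exists 0; near=> y; rewrite /phi chi0//.
      by near: y; apply: lt_le_nbhsl; rewrite /c'; lra.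
    exists 1; near=> y; rewrite /phi chi1//.
    by near: y; apply: lt_le_nbhsr; rewrite /d'; lra.
  have dphi : \forall y \near z, derive1 phi y = P2' y + b * h' y.
    near=> y; apply: derive1_val.
    apply: (@near_eq_is_derive _ _ _ (fun y => P2 y + b * h y)).
      suff : \forall t \near y, phi t = P2 t + b * h t by apply: filterS => t ->.
      by near: y; exact: near_join zb.
  have -> : derive1 (derive1 phi) z = k ^+ 2 * P2 z + psi z + b * (k ^+ 2 * h z).
    apply: derive1_val; apply: (@near_eq_is_derive _ _ _ (fun y => P2' y + b * h' y)).
      by apply: filterS dphi => t ->.

  by rewrite (nbhs_singleton zb); ring.
- move=> z zcd.
  have Kpsi : \int[mu]_(y in I01) (Ker k x0 (y, z) * psi y) =
              \int[mu]_y (Ker k x0 (y, z) * psi y).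
    rewrite Rintegral_mkcond; apply: eq_Rintegral => y _; rewrite patchE; case: ifPn => //.
    rewrite notin_setE => /I01P/negP y01.
    by rewrite (csupp_eq0 pc y01) mulr0.
  rewrite Kpsi; move: zcd; rewrite negb_and -!leNgt => /orP[zc|dz].
    rewrite /phi chi0; last by rewrite /c'; lra.
    rewrite mul0r addr0 /P2 /A /B !prim_restrict.
    have iA := itg_prim z ia1; have iB := itg_prim z ib1.
    rewrite -(@RintegralZl _ _ _ mu setT _ (ea z))// -(@RintegralZl _ _ _ mu setT _ (eb z))//.
    have iA' := @itgZ _ _ _ mu setT measurableT (eb z) _ iA.
    have iB' := @itgZ _ _ _ mu setT measurableT (ea z) _ iB.
    rewrite -RintegralB// -RintegralZl//; last exact: (@itgB _ _ _ mu setT measurableT).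
    apply: eq_Rintegral => y _; rewrite !patchE.
    have zx0 : z < x0 by lra.
    rewrite /Ker /between/= zx0 andbT (ltNge x0 z) (ltW zx0)/=.
    have [yz|yz] := leP y z; last first.
      rewrite ifN; last by rewrite notin_setE/= in_itv/= leNgt yz.
      rewrite ifN; last by rewrite notin_setE/= in_itv/= leNgt yz.
      by rewrite ltNge (ltW yz)/= /point/=; ring.
    rewrite mem_set; last by rewrite /= in_itv/=.
    have -> : (if y < z then shk k `|y - z| else 0) = shk k (z - y).
      case: ifPn => [yz'|]; first by rewrite distrC gtr0_norm ?subr_gt0.
      by rewrite -leNgt => zy; rewrite (_ : y = z) ?subrr ?shk0//; apply/eqP; rewrite eq_le yz.
    have E1 : expR (k * (z - y)) = ea z * eb y by rewrite -expRD; congr expR; ring.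
have E2 : expR (- k * (z - y)) = eb z * ea y by rewrite -expRD; congr expR; ring.
rewrite /shk E1 E2 /a1 /b1; field; rewrite gt_eqF//.
  rewrite /phi chi1; last by rewrite /d'; lra.
  have iA := itg_prim z ia1; have iB := itg_prim z ib1.
  rewrite (_ : _ + _ = (2 * k)^-1 * (eb z * (Ai - A z) - ea z * (Bi - B z))); last first.
    by rewrite /P2 /h; ring.
  rewrite /Ai /Bi /A /B !prim_restrict -!RintegralB//.
  have iA1 := @itgB _ _ _ mu setT measurableT _ _ ia1 iA.
  have iB1 := @itgB _ _ _ mu setT measurableT _ _ ib1 iB.
  rewrite -(@RintegralZl _ _ _ mu setT _ (ea z))// -(@RintegralZl _ _ _ mu setT _ (eb z))//.
  have iA' := @itgZ _ _ _ mu setT measurableT (eb z) _ iA1.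
  have iB' := @itgZ _ _ _ mu setT measurableT (ea z) _ iB1.
  rewrite -RintegralB// -RintegralZl//; last exact: (@itgB _ _ _ mu setT measurableT).
  apply: eq_Rintegral => y _; rewrite !patchE.
  have zx0 : x0 < z by lra.
  rewrite /Ker /between/= zx0 (ltNge z x0) (ltW zx0)/= andbF orbF.
  have [yz|yz] := leP y z.
    rewrite mem_set; last by rewrite /= in_itv/=.
    by rewrite !subrr; ring.
  rewrite ifN; last by rewrite notin_setE/= in_itv/= leNgt yz.
  rewrite ifN; last by rewrite notin_setE/= in_itv/= leNgt yz.
  rewrite !subr0 gtr0_norm ?subr_gt0//.
  have E1 : expR (k * (y - z)) = ea y * eb z by rewrite -expRD; congr expR; ring.
have E2 : expR (- k * (y - z)) = eb y * ea z by rewrite -expRD; congr expR; ring.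
rewrite /shk E1 E2 /a1 /b1; field; rewrite gt_eqF//.
Unshelve. all: by end_near. Qed.

End RepresentationLemma.

(** * Distributional solutions that vanish on an interval *)

Section WeakSolutionRepresentation.
Context {R : realType}.
Local Notation mu := (@lebesgue_measure R).
Implicit Types (f g phi psi w G : R -> R) (x y z : R).

Let I01 : set R := `]0, 1[%classic.

Let mI01 : measurable I01. Proof. exact: measurable_itv. Qed.

Definition weak_sol (k : R) w G := forall phi, smooth phi -> csupp 0 1 phi ->
  \int[mu]_(x in I01) (w x * (derive1 (derive1 phi) x - k ^+ 2 * phi x)) =
  \int[mu]_(x in I01) (G x * phi x).

Lemma csupp_restrict (A B : R) f phi : 0 <= A -> B <= 1 -> csupp A B phi ->
  \int[mu]_(x in I01) (f x * phi x) = \int[mu]_(x in `]A, B[) (f x * phi x).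
Proof.
move=> A0 B1 pc; rewrite Rintegral_mkcond [RHS]Rintegral_mkcond; apply: eq_Rintegral => x _.
rewrite !patchE; have [xAB|xAB] := boolP (A < x < B); last first.
  rewrite (csupp_eq0 pc xAB) mulr0; case: ifPn => _; case: ifPn => //.
rewrite mem_set ?mem_set// /I01/= in_itv//=.
by move: xAB => /andP[Ax xB]; rewrite (le_lt_trans A0 Ax) (lt_le_trans xB B1).
Qed.

(** Test functions supported in ]c, d[ do not see [w], so they are orthogonal to [G]. *)
Lemma weak_sol_source (k c d : R) w G : 0 <= c -> c < d -> d <= 1 ->
  mu.-integrable I01 (EFin \o w) -> mu.-integrable I01 (EFin \o G) ->
  weak_sol k w G ->
  (\forall x \ae mu, x \in `]c, d[ -> w x = 0) ->
  \forall x \ae mu, x \in `]c, d[ -> G x = 0.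
Proof.
move=> c0 cd d1 iw iG wG w0.
have mcd : measurable (`]c, d[%classic : set R) by exact: measurable_itv.
have sub : `]c, d[ `<=` I01.
  by move=> x; rewrite /I01/= !in_itv/= => /andP[cx xd]; rewrite (le_lt_trans c0 cx) (lt_le_trans xd d1).
apply: fundamental_lemma; first exact: integrableS iG.
move=> phi ps pc; rewrite -csupp_restrict//.
have pc1 : csupp 0 1 phi by exact: csuppS pc.
rewrite -(wG _ ps pc1).
have pc2 : csupp c d (derive1 (derive1 phi)) by do 2 apply: csupp_derive1.
have sp2 : smooth (derive1 (derive1 phi)) by do 2 apply: smooth_derive1.
have mw := itg_meas iw.
rewrite (@Rint_ae_eq _ _ _ mu I01 mI01 _ (cst 0)).
- by rewrite Rintegral_cst// mul0r.
- apply: measurable_funM => //; apply: measurable_funB; first exact: smooth_measurable.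
  by apply: measurable_funM => //; exact: smooth_measurable.
- exact: measurable_cst.
apply: aeS w0 => x w0 xI; have [/w0 ->|xcd] := boolP (x \in `]c, d[); first by rewrite mul0r.
rewrite in_itv/= in xcd.
by rewrite (csupp_eq0 pc xcd) (csupp_eq0 pc2 xcd) mulr0 subr0 mulr0.
Qed.

(** Duality: for given [psi], the weak equation is tested with the glued solution [phi]. Inside ]c,
    d[ that function is wrong, but there both [w] and [G] vanish; outside, [phi] is the transposed
    kernel applied to [psi], and Fubini moves the kernel onto [G]. *)
Lemma representation (k c d x0 : R) w G : 0 < k -> 0 <= c -> c < x0 -> x0 < d ->
  d <= 1 -> mu.-integrable I01 (EFin \o w) -> mu.-integrable I01 (EFin \o G) ->
  weak_sol k w G ->
  (\forall x \ae mu, x \in `]c, d[ -> w x = 0) ->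
  \forall x \ae mu, x \in `]0, 1[ ->
    w x = \int[mu]_(z in I01) (Ker k x0 (x, z) * G z).
Proof.
move=> k0 c0 cx0 x0d d1 iw iG wG w0.
have G0 : \forall x \ae mu, x \in `]c, d[ -> G x = 0.
  by apply: (weak_sol_source c0 _ d1 iw iG wG w0); exact: lt_trans x0d.
have KM (x y : R) : I01 x -> I01 y -> `|Ker k x0 (x, y)| <= expR k.
  rewrite /I01/= !in_itv/= => /andP[x0' x1] /andP[y0 y1].
  by apply: Ker_bound => //; rewrite ?(ltW x0') ?(ltW y0) ?ltW.
pose F x := \int[mu]_(z in I01) (Ker k x0 (x, z) * G z).
have i1 : mu.-integrable I01 (EFin \o (cst 1 : R -> R)).
  apply: (@fin_meas_itg _ _ _ mu I01 mI01 _ 1) => //.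
    by have := ltry (1 - 0 : R); rewrite -(mu_itv_oo ler01).
  by move=> x _; rewrite normr1.
have iF : mu.-integrable I01 (EFin \o F).
  have [h _ _] := Rfubini_bdd mI01 mI01 i1 iG (@measurable_Ker R k x0) KM.
  by apply: (@eq_itg _ _ _ mu I01 mI01 _ _ _ h) => x _; rewrite mul1r.
have iwF : mu.-integrable I01 (EFin \o (fun x => w x - F x)).
  exact: (@itgB _ _ _ mu I01 mI01).
suff : \forall x \ae mu, x \in `]0, 1[ -> w x - F x = 0.
  by apply: aeS => x h /h /eqP; rewrite subr_eq0 => /eqP.
apply: fundamental_lemma => // psi ps pc.
have [phi [sphi cphi phi1 phi2]] := glued_solution k0 c0 cx0 x0d d1 ps pc.
have ipsi : mu.-integrable I01 (EFin \o psi).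
  by apply: integrableS (csupp_itg ps pc).
have [Mp pM] := csupp_bounded ps pc.
have mpsi : measurable_fun I01 psi by exact: smooth_measurable.
have mphi : measurable_fun I01 phi by exact: smooth_measurable.
have [Fi Gi FG] := Rfubini_bdd mI01 mI01 ipsi iG (@measurable_Ker R k x0) KM.
transitivity (\int[mu]_(x in I01) (w x * psi x) - \int[mu]_(x in I01) (psi x * F x)).
  rewrite -RintegralB//; last exact: (@itgM_bdd _ _ _ mu I01 mI01 w psi Mp).
  by apply: eq_Rintegral => x _; ring.
rewrite FG; apply/eqP; rewrite subr_eq0; apply/eqP.
have mw := itg_meas iw; have mG := itg_meas iG.
transitivity (\int[mu]_(x in I01) (w x * (derive1 (derive1 phi) x - k ^+ 2 * phi x))).
  apply: (@Rint_ae_eq _ _ _ mu I01 mI01); first exact: measurable_funM.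
    apply: measurable_funM => //; apply: measurable_funB.
      by apply: smooth_measurable; do 2 apply: smooth_derive1.
    exact: measurable_funM.
  apply: aeS w0 => x w0 xI; have [/w0 ->|xcd] := boolP (x \in `]c, d[); first by rewrite !mul0r.
  by rewrite phi1.
rewrite wG//; apply: (@Rint_ae_eq _ _ _ mu I01 mI01).
- exact: measurable_funM.
- exact: itg_meas Gi.
apply: aeS G0 => x G0 xI; have [/G0 ->|xcd] := boolP (x \in `]c, d[); first by rewrite !mul0r.
by rewrite phi2.
Qed.

End WeakSolutionRepresentation.

(** * Exponential sums and the vanishing of the source *)

Section ExponentialSums.
Context {R : realType}.
Implicit Types (n kap j : nat) (s y : R).

Lemma mvt_bound (F f : R -> R) (a b M : R) : (forall x : R, is_derive x 1 F (f x)) ->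
  (forall x : R, Num.min a b <= x <= Num.max a b -> `|f x| <= M) ->
  `|F b - F a| <= M * `|b - a|.
Proof.
move=> dF; wlog ab : a b / a <= b.
  move=> H h; have [ab|/ltW ba] := leP a b; first exact: H.
  by rewrite distrC (distrC b); apply: H => // x xx; apply: h; rewrite minC maxC.
move=> fM; move: ab; rewrite le_eqVlt => /orP[/eqP ->|ab].
  by rewrite !subrr normr0 mulr0.
have cF : {within `[a, b], continuous F}.
  apply: continuous_subspaceT => x; apply: differentiable_continuous.
  by apply/derivable1_diffP; have [] := dF x.
have [c cab ->] := MVT ab (fun x _ => dF x) cF.
rewrite normrM ler_wpM2r// fM//; move: cab; rewrite in_itv/= => /andP[ac cb].
by rewrite min_l ?max_r ?(ltW ab)// !ltW.
Qed.

Definition cf n j : R := (-1) ^+ j.+1 * 'C(n, j)%:R / n%:R ^+ j.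

(** A smoothed indicator of s < 0 using only the frequencies kap, 2 kap, ..., n kap: as [kap] grows
    it tends to 1 for s < 0 and to 0 for s > 0, provided that n >= e^(- kap s). *)
Definition hsum n kap s : R :=
  \sum_(i < n) cf n i.+1 * expR (- ((i.+1 * kap)%:R * s)).

Lemma expR_natM n kap s : expR (- ((n * kap)%:R * s)) = expR (- (kap%:R * s)) ^+ n.
Proof. by rewrite -expRM_natl natrM; congr expR; ring. Qed.

Lemma hsumE n kap s : (0 < n)%N ->
  hsum n kap s = 1 - (1 - expR (- (kap%:R * s)) / n%:R) ^+ n.
Proof.
move=> n0; set y := expR _; rewrite exprBn big_ord_recl/=.
rewrite subn0 expr0 bin0 !expr1n !mul1r mulr1n opprD addrA subrr add0r -sumrN.
apply: eq_bigr => i _; rewrite expR_natM -/y expr1n mulr1 /cf.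
rewrite expr_div_n -mulr_natr /bump/= add1n (exprS _ i.+1).
by field; rewrite expf_neq0// pnatr_eq0 -lt0n.
Qed.

(** Taking absolute values turns (1 - y/n)^n into (1 + y/n)^n <= e^y. The bound is uniform in [n],
    so the alternating coefficients cause no loss. *)
Lemma cf_abs_sum n y : 0 <= y ->
  \sum_(i < n) `|cf n i.+1| * y ^+ i.+1 <= expR y - 1.
Proof.
move=> y0; case: n => [|n]; first by rewrite big_ord0 subr_ge0 -expR0 ler_expR.
have -> : \sum_(i < n.+1) `|cf n.+1 i.+1| * y ^+ i.+1 = (1 + y / n.+1%:R) ^+ n.+1 - 1.
  rewrite exprDn [in RHS]big_ord_recl subn0 expr0 bin0 !expr1n mul1r mulr1n addrC addKr.
  apply: eq_bigr => i _; rewrite /cf -mulrA normrMsign ger0_norm ?divr_ge0 ?exprn_ge0//.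
  by rewrite lift0 expr_div_n -mulr_natr expr1n; ring.
rewrite lerB// -[y in leRHS](@divfK _ n.+1%:R) ?pnatr_eq0// expRM_natr.
by apply: lerXn2r; rewrite ?nnegrE ?expR_ge0 ?expR_ge1Dx// addr_ge0// divr_ge0.
Qed.

(** Sampling an exponentially small sequence at multiples of [kap] gives a sum that tends to 0 as
    [kap] grows, uniformly in [n]. All error terms of the exponential sums are controlled in this
    way. *)
Lemma cf_sum_bound n kap (b : nat -> R) (C e : R) : (0 < kap)%N -> 0 <= C ->
  (forall k, (0 < k)%N -> b k <= C * expR (- (k%:R * e))) ->
  \sum_(i < n) `|cf n i.+1| * b (i.+1 * kap)%N <= C * (expR (expR (- (kap%:R * e))) - 1).
Proof.
move=> kap0 C0 bC.

apply: (@le_trans _ _ (\sum_(i < n) `|cf n i.+1| * (C * expR (- (kap%:R * e)) ^+ i.+1))).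
  by apply: ler_sum => i _; rewrite ler_wpM2l// -expR_natM bC// muln_gt0.
under eq_bigr do rewrite mulrCA.
by rewrite -mulr_sumr ler_wpM2l// cf_abs_sum// expR_ge0.
Qed.

(** With y = e^(- kap s): Bernoulli's inequality gives the second bound, useful for s > 0 where y is
    small; 1 - y/n <= e^(- y/n) gives the third, useful for s < 0 where y is large. The condition y
    <= n keeps the base in [0, 1]. *)
Lemma hsum_bound n kap s : (0 < n)%N -> expR (- (kap%:R * s)) <= n%:R ->
  [/\ 0 <= hsum n kap s <= 1, hsum n kap s <= expR (- (kap%:R * s)) &
      1 - hsum n kap s <= expR (- expR (- (kap%:R * s)))].
Proof.
move=> n0; set y := expR _ => yn; rewrite hsumE// -/y.
have n0' : 0 < n%:R :> R by rewrite ltr0n.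
have y1 : 0 <= 1 - y / n%:R by rewrite subr_ge0 ler_pdivrMr// mul1r.
have y2 : 1 - y / n%:R <= 1 by rewrite gerBl divr_ge0// expR_ge0.
have p01 : 0 <= (1 - y / n%:R) ^+ n <= 1.
  by rewrite exprn_ge0//= exprn_ile1.
split; first by move: p01 => /andP[??]; apply/andP; split; lra.
- suff : 1 - y <= (1 - y / n%:R) ^+ n by lra.
  have [y1'|y1'] := leP 1 y; first by move: p01 => /andP[? _]; lra.
  have h m : (m <= n)%N -> 1 - m%:R * (y / n%:R) <= (1 - y / n%:R) ^+ m.
    elim: m => [|m IH] mn; first by rewrite mul0r subr0 expr0.
    rewrite exprS; apply: le_trans (ler_wpM2l y1 (IH (ltnW mn))).
    rewrite -natr1; have : 0 <= m%:R * (y / n%:R) ^+ 2 by rewrite mulr_ge0 ?sqr_ge0.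
    by lra.
  by have := h n (leqnn n); rewrite mulrCA mulfV ?mulr1// gt_eqF.
- rewrite opprB addrCA subrr addr0.
  have -> : expR (- y) = expR (- (y / n%:R)) ^+ n.
    by rewrite -expRM_natr; congr expR; field; rewrite gt_eqF.
  by apply: lerXn2r; rewrite ?nnegrE ?expR_ge0// expR_ge1Dx.
Qed.

(** A primitive in [s] of the exponential sum [esumv] below. *)
Definition eprim n kap (v : nat -> R) s : R :=
  \sum_(i < n) v i * (- ((i.+1 * kap)%:R^-1 * expR (- ((i.+1 * kap)%:R * s)))).

Definition esumv n kap (v : nat -> R) s : R :=
  \sum_(i < n) v i * expR (- ((i.+1 * kap)%:R * s)).

Lemma is_derive_eprim n kap v s : (0 < kap)%N ->
  is_derive s 1 (eprim n kap v) (esumv n kap v s).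
Proof.
move=> kap0; rewrite /eprim /esumv.
elim: n => [|n IH].
  rewrite big_ord0 (_ : (fun s => _) = cst 0); first exact: is_derive_cst.
  by apply/funext => t; rewrite big_ord0.
rewrite big_ord_recr/= (_ : (fun s => _) = fun t => \sum_(i < n) v i *
   (- ((i.+1 * kap)%:R^-1 * expR (- ((i.+1 * kap)%:R * t)))) +
   v n * (- ((n.+1 * kap)%:R^-1 * expR (- ((n.+1 * kap)%:R * t))))); last first.
  by apply/funext => t; rewrite big_ord_recr.
set k : R := (n.+1 * kap)%:R.
have k0 : k != 0 by rewrite pnatr_eq0 muln_eq0/= -lt0n.
have dk : is_derive s 1 (fun t => v n * (- (k^-1 * expR (- (k * t)))))
    (v n * (- (k^-1 * (- (k * 1) * expR (- (k * s)))))).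
  exact: (is_deriveZf (v n) (is_deriveNf (is_deriveZf k^-1 (is_derive_expRf
    (is_deriveNf (is_deriveZf k (is_derive_id s 1))))))).
refine (is_derive_eq (is_deriveDf IH dk) _).
by rewrite mulr1 mulNr !mulrN opprK (mulrA k^-1) mulVf// mul1r.
Qed.

(** Its derivative is h(s) + h(- s) - 1 with h the cut-off, which would be 0 for a true indicator of
    s < 0; [Hdef] therefore measures the failure of this symmetry in integrated form. *)
Definition Hdef n kap s : R := eprim n kap (fun i => cf n i.+1) s -
  eprim n kap (fun i => cf n i.+1) (- s) - s.

Lemma is_derive_Hdef n kap s : (0 < kap)%N ->
  is_derive s 1 (Hdef n kap) (hsum n kap s + hsum n kap (- s) - 1).
Proof.
move=> kap0; have dN : is_derive s 1 (fun t : R => - t) (- 1).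
  exact: (is_deriveNf (is_derive_id s 1)).
have d1 := is_derive_eprim n (fun i => cf n i.+1) s kap0.
have d2 : is_derive s 1 (fun t => eprim n kap (fun i => cf n i.+1) (- t))
    (hsum n kap (- s) * - 1).
  apply: (@is_derive1_comp _ _ (fun t : R => - t)) => //; exact: is_derive_eprim.
apply: (is_derive_eq (is_deriveDf (is_deriveDf d1 (is_deriveNf d2))
  (is_deriveNf (is_derive_id s 1)))).
by rewrite mulrN1 opprK.
Qed.

(** [Hdef] is odd, its derivative is at most 1 near 0, and beyond [dl] it is bounded by the two
    tails of the cut-off. The condition on [n] admits all times in [- 2, 2]. *)
Lemma Hdef_bound n kap (dl b : R) : (0 < kap)%N -> expR (2 * kap%:R : R) <= n%:R ->
  0 < dl -> dl <= 2 -> `|b| <= 2 ->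
  `|Hdef n kap b| <= dl + 2 * (expR (- (kap%:R * dl) : R) + expR (- expR (kap%:R * dl))).
Proof.
move=> kap0 nk dl0 dl2.
have n0 : (0 < n)%N.
  by rewrite -(ltr_nat R); apply: lt_le_trans nk; exact: expR_gt0.
have Hodd t : Hdef n kap (- t) = - Hdef n kap t by rewrite /Hdef opprK; ring.
have H00 : Hdef n kap 0 = 0 by rewrite /Hdef oppr0 addr0 subrr.
set e := expR _ + expR _.
have e0 : 0 <= e by rewrite addr_ge0 ?expR_ge0.
have nk2 (t : R) : `|t| <= 2 -> expR (- (kap%:R * t)) <= n%:R.
  move=> t2; apply: le_trans nk; rewrite ler_expR mulrC -mulNr ler_wpM2r//.
  by apply: le_trans t2; rewrite -normrN ler_norm.
suff main : forall t : R, 0 <= t <= 2 -> `|Hdef n kap t| <= dl + 2 * e.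
  move=> b2; have [b0|/ltW b0] := leP 0 b.
    by apply: main; rewrite b0/= (le_trans (ler_norm _) b2).
  by rewrite -normrN -Hodd main// oppr_ge0 b0/= (le_trans _ b2)// -normrN ler_norm.
have d1 (t : R) : `|t| <= 2 -> `|hsum n kap t + hsum n kap (- t) - 1| <= 1.
  move=> t2; have [/andP[a1 a2] _ _] := hsum_bound n0 (nk2 t t2).
  have [|/andP[b1 b2] _ _] := hsum_bound n0 (nk2 (- t) _); first by rewrite normrN.
  by rewrite ler_norml; apply/andP; split; lra.
have d2 (t : R) : dl <= t <= 2 -> `|hsum n kap t + hsum n kap (- t) - 1| <= e.
  move=> /andP[t1 t2]; have t0 : 0 <= t by rewrite (le_trans _ t1)// ltW.
  have at2 : `|t| <= 2 by rewrite ger0_norm.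
  have [/andP[a1 a2] a3 _] := hsum_bound n0 (nk2 t at2).
  have [|/andP[b1 b2] _ b3] := hsum_bound n0 (nk2 (- t) _); first by rewrite normrN.
  have u1 : expR (- (kap%:R * t)) <= expR (- (kap%:R * dl)).
    by rewrite ler_expR lerN2 ler_wpM2l.
  have u2 : expR (- expR (- (kap%:R * - t))) <= expR (- expR (kap%:R * dl)).
    by rewrite ler_expR lerN2 ler_expR mulrN opprK ler_wpM2l.
  have := expR_ge0 (- (kap%:R * dl)); have := expR_ge0 (- expR (kap%:R * dl)) => ? ?.
  by rewrite ler_norml /e; apply/andP; split; lra.
have small (t : R) : 0 <= t <= dl -> `|Hdef n kap t| <= dl.
  move=> /andP[t0 td]; rewrite -[Hdef _ _ _]subr0 -H00.
  apply: (@le_trans _ _ (1 * `|t - 0|)).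
    apply: mvt_bound; first by move=> x; exact: is_derive_Hdef.
    move=> x; rewrite min_l// max_r// => /andP[x0 xt]; apply: d1.
    by rewrite ger0_norm//; lra.
  by rewrite mul1r subr0 ger0_norm.
move=> t /andP[t0 t2]; have [td|/ltW td] := leP t dl.
  by apply: le_trans (small _ _) _; rewrite ?t0// lerDl mulr_ge0.
rewrite -[Hdef n kap t](subrK (Hdef n kap dl)) addrC.
apply: le_trans (ler_normD _ _) _; apply: lerD; first by apply: small; rewrite ltW/=.
apply: (@le_trans _ _ (e * `|t - dl|)).
  apply: mvt_bound; first by move=> x; exact: is_derive_Hdef.
  by move=> x; rewrite min_l// max_r// => /andP[xd xt]; apply: d2; lra.
by rewrite mulrC ler_wpM2r// ger0_norm ?subr_ge0//; lra.
Qed.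

End ExponentialSums.

(** * Gronwall's argument by iterated halving *)

Section ExponentialBounds.
Context {R : realType}.
Local Notation mu := (@lebesgue_measure R).

Lemma Rint_FTC (F f : R -> R) (a b : R) : a < b ->
  (forall x : R, is_derive x 1 F (f x)) -> continuous f ->
  \int[mu]_(x in `]a, b[) f x = F b - F a.
Proof.
move=> ab dF cf.
have cF : continuous F.
  move=> x; apply: differentiable_continuous.
  by apply/derivable1_diffP; have [] := dF x.
have icf : mu.-integrable `[a, b] (EFin \o f).
  apply: continuous_compact_integrable; first exact: segment_compact.
  exact: continuous_subspaceT.
have -> : \int[mu]_(x in `]a, b[) f x = \int[mu]_(x in `[a, b]) f x.
  rewrite -Rintegral_itv_obnd_cbnd; last first.
    by apply: integrableS icf => //; apply: subset_itvr; rewrite bnd_simp.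
  rewrite Rintegral_itv_bndo_bndc//.
  by apply: integrableS icf => //; apply: subset_itv; rewrite bnd_simp.
rewrite /Rintegral (@continuous_FTC2 _ f F a b)//.
- exact: continuous_subspaceT.
- split.
  + by move=> x _; have [] := dF x.
  + exact/cvg_at_right_filter/cF.
  + exact/cvg_at_left_filter/cF.
- by move=> x _; exact: derive1_val.
Qed.

(** The iterates of M -> M / 2 + A converge to the fixed point 2 A from any start. This replaces
    Gronwall's inequality: some initial bound must exist, but its size leaves no trace. *)
Lemma halving (Q : R -> Prop) (M0 A : R) :
  (forall M, Q M -> Q (M / 2 + A)) -> Q M0 ->
  (forall M, (forall e, 0 < e -> exists2 M', Q M' & M' <= M + e) -> Q M) ->
  Q (2 * A).
Proof.
move=> step Q0 cl; apply: cl => e e0.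
have Qn n : Q (2 * A + (M0 - 2 * A) * (2^-1) ^+ n).
  elim: n => [|n IH]; first by rewrite expr0 mulr1 addrC subrK.
  suff -> : 2 * A + (M0 - 2 * A) * 2^-1 ^+ n.+1 =
    (2 * A + (M0 - 2 * A) * 2^-1 ^+ n) / 2 + A by exact: step.
  by rewrite exprS; lra.
have h : (M0 - 2 * A) * (2^-1) ^+ n @[n --> \oo] --> (M0 - 2 * A) * 0.
  apply: cvgMr; apply: cvg_expr.
  by rewrite ger0_norm ?invr_ge0// invf_lt1// ltr1n.
rewrite mulr0 in h.
move/cvgrPdist_lt : h => /(_ e e0)[N _ hN].
exists (2 * A + (M0 - 2 * A) * (2^-1) ^+ N) => //.
have := hN N (leqnn N); rewrite sub0r normrN => /(le_lt_trans (ler_norm _)) hh.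
by rewrite lerD2l ltW.
Qed.

Let I01 : set R := `]0, 1[%classic.

Let mI01 : measurable I01. Proof. exact: measurable_itv. Qed.

Lemma itg_I01_bdd (f : R -> R) (M : R) : measurable_fun I01 f ->
  (forall x, I01 x -> `|f x| <= M) -> mu.-integrable I01 (EFin \o f).
Proof.
move=> mf fM; apply: (@fin_meas_itg _ _ _ mu I01 mI01 _ M) => //.
by have := ltry (1 - 0 : R); rewrite -(mu_itv_oo ler01).
Qed.

Lemma measurable_between1 (x0 x : R) (D : set R) : measurable_fun D (between x0 x).
Proof.
apply: measurable_funTS.
have m1 : measurable_fun setT (fun z : R => (x, z)) by exact: measurable_pair1.
exact: (measurableT_comp (measurable_between x0) m1).
Qed.

(** In the weighted norm with weight e^(lam |x - x0|), integration from [x0] to [x] has norm at most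
    1 / lam, hence is a contraction for large [lam]. *)
Lemma between_exp (x0 x lam : R) : 0 < lam -> I01 x0 -> I01 x ->
  \int[mu]_(z in I01) (if between x0 x z then expR (lam * `|z - x0|) else 0) <=
  expR (lam * `|x - x0|) / lam.
Proof.
move=> lam0 /I01P/andP[x00 x01] /I01P/andP[x1 x2].
have dexp (c b z : R) : is_derive z 1 (fun z => c^-1 * expR (c * (z - b))) (expR (c * (z - b))) \/ c = 0.
  have [->|c0] := eqVneq c 0; [by right|left].
  have h : is_derive z 1 (fun z => z - b) 1.
    have := is_deriveDf (is_derive_id z 1) (is_derive_cst (- b) z 1).
    by rewrite addr0.
  apply: (is_derive_eq (is_deriveZf c^-1 (is_derive_expRf (is_deriveZf c h)))).
  by rewrite mulr1 mulrA mulVf// mul1r.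
have cexp (c b : R) : continuous (fun z : R => expR (c * (z - b))).
  have := smooth_continuous (smooth_affine 1 (- b) (@smooth_expR R c)).
  by under eq_fun do rewrite mul1r.
have [xx|xx|xx] := ltgtP x0 x.
- have -> : \int[mu]_(z in I01) (if between x0 x z then expR (lam * `|z - x0|) else 0) =
      \int[mu]_(z in `]x0, x[) expR (lam * (z - x0)).
    rewrite Rintegral_mkcond [RHS]Rintegral_mkcond; apply: eq_Rintegral => z _.
    rewrite !patchE /between; have [/andP[z1 z2]|zz] := boolP (x0 < z < x).
      rewrite mem_set; last by apply/I01P; rewrite (lt_trans x00 z1) (lt_trans z2 x2).
      by rewrite mem_set ?gtr0_norm ?subr_gt0//= in_itv/= z1.
    have -> : (x < z < x0) = false.
      by apply/negbTE/negP => /andP[z1 z2]; have := lt_trans (lt_trans z1 z2) xx; rewrite ltxx.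
    rewrite [in RHS]ifN; last by rewrite notin_setE/= in_itv/=; exact/negP.
    by case: ifP.
  have dF (z : R) : is_derive z 1 (fun z => lam^-1 * expR (lam * (z - x0))) (expR (lam * (z - x0))).
    by have [//|l0] := dexp lam x0 z; rewrite l0 ltxx in lam0.
  rewrite (Rint_FTC xx dF (cexp _ _)).
  by rewrite subrr mulr0 expR0 mulr1 gtr0_norm ?subr_gt0// mulrC gerBl invr_ge0 ltW.
- have -> : \int[mu]_(z in I01) (if between x0 x z then expR (lam * `|z - x0|) else 0) =
      \int[mu]_(z in `]x, x0[) expR (- lam * (z - x0)).
    rewrite Rintegral_mkcond [RHS]Rintegral_mkcond; apply: eq_Rintegral => z _.
    rewrite !patchE /between; have [/andP[z1 z2]|zz] := boolP (x < z < x0).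
      rewrite mem_set; last by apply/I01P; rewrite (lt_trans x1 z1) (lt_trans z2 x01).
      rewrite mem_set/= ?in_itv/= ?z1// orbT.
      by rewrite ltr0_norm ?subr_lt0// mulrN mulNr.
    have -> : (x0 < z < x) = false.
      by apply/negbTE/negP => /andP[z1 z2]; have := lt_trans (lt_trans z1 z2) xx; rewrite ltxx.
    rewrite [in RHS]ifN; last by rewrite notin_setE/= in_itv/=; exact/negP.
    by case: ifP.
  have l0 : - lam != 0 by rewrite oppr_eq0 gt_eqF.
  have dF (z : R) : is_derive z 1 (fun z => (- lam)^-1 * expR (- lam * (z - x0))) (expR (- lam * (z - x0))).
    by have [//|/eqP] := dexp (- lam) x0 z; rewrite (negbTE l0).
  rewrite (Rint_FTC xx dF (cexp _ _)).
  rewrite subrr mulr0 expR0 mulr1 ltr0_norm ?subr_lt0// invrN mulrN mulNr mulNr opprK.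
  by rewrite addrC mulrC gerBl invr_ge0 ltW.
- rewrite (_ : (fun z => _) = cst 0); last first.
    apply/funext => z; rewrite /between xx.
    by rewrite (_ : (x < z < x) = false)//; apply/negbTE/negP => /andP[z1 z2]; have := lt_trans z1 z2; rewrite ltxx.
  by rewrite Rintegral_cst// mul0r divr_ge0 ?expR_ge0// ltW.
Qed.

End ExponentialBounds.

(** * The d'Alembert formula and the size of the exponential sum [Z] *)

Section WaveEstimate.
Context {R : realType}.
Local Notation mu := (@lebesgue_measure R).

Let I01 : set R := `]0, 1[%classic.

Let mI01 : measurable I01. Proof. exact: measurable_itv. Qed.

Variables (x0 P : R) (p a : R -> R) (W rho : nat -> R -> R) (good : R -> Prop).
Hypotheses (x0I : I01 x0) (P0 : 0 <= P) (pP : forall x, I01 x -> `|p x| <= P).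
Hypotheses (mp : measurable_fun I01 p) (ia : mu.-integrable I01 (EFin \o a)).
Hypotheses (iW : forall k, (0 < k)%N -> mu.-integrable I01 (EFin \o W k)).
Hypotheses (irho : forall k, (0 < k)%N -> mu.-integrable I01 (EFin \o rho k)).
Hypotheses (good_ae : \forall x \ae mu, I01 x -> good x).
Hypothesis Wrep : forall k x, (0 < k)%N -> I01 x -> good x ->
  W k x = \int[mu]_(z in I01) (Ker k%:R x0 (x, z) * (p z * W k z + rho k z - a z)).
Variable q : nat -> R.
Hypothesis Wq : forall k x, (0 < k)%N -> I01 x -> good x -> `|W k x| <= q k.
Variables n kap : nat.
Hypotheses (kap0 : (0 < kap)%N) (nkap : expR (2 * kap%:R) <= n%:R :> R).

Let fr (i : nat) : nat := (i.+1 * kap)%N.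

Let fr0 i : (0 < fr i)%N. Proof. by rewrite muln_gt0. Qed.

Let Z (x s : R) := esumv n kap (fun i => cf n i.+1 * W (fr i) x) s.
(** The d'Alembert formula contains [Z] and the cut-off only through their integrals over
    [s - r, s + r]; the primitives [Zp] and [hp] express these as differences. *)
Let Zp (x s : R) := eprim n kap (fun i => cf n i.+1 * W (fr i) x) s.
Let hp (s : R) := eprim n kap (fun i => cf n i.+1) s.
Let rr (x s z : R) := \sum_(i < n) cf n i.+1 * expR (- ((fr i)%:R * s)) *
  (shk (fr i)%:R `|x - z| * rho (fr i) z).
(** The factor e^(2 k) bounds e^(- k s) sinh (k r) / k on the region |s| + r <= 2 with r <= 1. *)
Let rhob (z : R) := \sum_(i < n) `|cf n i.+1| * expR (2 * (fr i)%:R) * `|rho (fr i) z|.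

Let T (x s z : R) := if between x0 x z then
  2^-1 * (p z * (Zp z (s + `|x - z|) - Zp z (s - `|x - z|))
          - a z * (hp (s + `|x - z|) - hp (s - `|x - z|))) + rr x s z else 0.

(** Large enough for P / lam <= 1/4, so that the potential term consumes at most half of a bound
    even when it is doubled. *)
Let lam : R := 4 * P + 1.
Let lam0 : 0 < lam. Proof. by rewrite /lam; have := P0; lra. Qed.
Let E := \int[mu]_(z in I01) rhob z.
Let A := \int[mu]_(z in I01) `|a z|.

Let shk_expR (k r s : R) : k != 0 -> expR (- (k * s)) * shk k r =
  2^-1 * (- (k^-1 * expR (- (k * (s + r)))) - - (k^-1 * expR (- (k * (s - r))))).
Proof.
move=> k0.
have -> : expR (- (k * (s + r))) = expR (- (k * s)) * expR (- k * r).
  by rewrite -expRD; congr expR; ring.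
have -> : expR (- (k * (s - r))) = expR (- (k * s)) * expR (k * r).
  by rewrite -expRD; congr expR; ring.
by rewrite /shk; field.
Qed.

Let itg_term k x : (0 < k)%N -> I01 x ->
  mu.-integrable I01 (EFin \o (fun z => Ker k%:R x0 (x, z) * (p z * W k z + rho k z - a z))).
Proof.
move=> k0 x01.
have i1 : mu.-integrable I01 (EFin \o (fun z => p z * W k z + rho k z - a z)).
  apply: (@itgB _ _ _ mu I01 mI01) => //; apply: (@itgD _ _ _ mu I01 mI01); last exact: irho.
  apply: (@eq_itg _ _ _ mu I01 mI01 (fun z => W k z * p z)); first by move=> z _; rewrite mulrC.
  exact: (@itgM_bdd _ _ _ mu I01 mI01 _ _ P (iW k0)).
apply: (@eq_itg _ _ _ mu I01 mI01 (fun z => (p z * W k z + rho k z - a z) * Ker k%:R x0 (x, z))).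
  by move=> z _; rewrite mulrC.
apply: (@itgM_bdd _ _ _ mu I01 mI01 _ _ (expR k%:R) i1).
  have m1 : measurable_fun setT (fun z : R => (x, z)) by exact: measurable_pair1.
  apply: measurable_funTS; exact: (measurableT_comp (@measurable_Ker R k%:R x0) m1).
move=> z /I01P/andP[z0 z1]; move/I01P : x01 => /andP[x00 x1].
by apply: Ker_bound; rewrite ?ltr0n// !ltW.
Qed.

Let T_sum x s z : T x s z = \sum_(i < n) (cf n i.+1 * expR (- ((fr i)%:R * s))) *
  (Ker (fr i)%:R x0 (x, z) * (p z * W (fr i) z + rho (fr i) z - a z)).
Proof.
rewrite /T /Ker/=; case: ifPn => _; last first.
  by rewrite big1// => i _; rewrite mul0r mulr0.
rewrite /Zp /hp /eprim /rr -!sumrB !mulr_sumr -sumrB mulr_sumr -big_split/=.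
apply: eq_bigr => i _.
have k0 : (fr i)%:R != 0 :> R by rewrite pnatr_eq0 -lt0n.
rewrite -/(fr i).
set c := cf _ _; set e := expR (- (_ * s)); set S := shk _ _.
have := shk_expR `|x - z| s k0; rewrite -/e -/S.
set u := - (_ * expR (- (_ * (s + _)))); set v := - (_ * expR (- (_ * (s - _)))) => eS.
transitivity (c * (2^-1 * (u - v)) * (p z * W (fr i) z - a z) + c * e * S * rho (fr i) z).
  by ring.
by rewrite -eS; ring.
Qed.

Let itg_T x s : I01 x -> mu.-integrable I01 (EFin \o T x s).
Proof.
move=> x01; rewrite (_ : T x s = fun z => \sum_(i < n) (cf n i.+1 * expR (- ((fr i)%:R * s))) *
  (Ker (fr i)%:R x0 (x, z) * (p z * W (fr i) z + rho (fr i) z - a z))); last first.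
  by apply/funext => z; exact: T_sum.
apply: (@itg_sum _ _ _ mu I01 mI01) => i _; apply: (@itgZ _ _ _ mu I01 mI01).
exact: itg_term.
Qed.

Let Z_rep x s : I01 x -> good x -> Z x s = \int[mu]_(z in I01) T x s z.
Proof.
move=> x01 gx; under eq_Rintegral do rewrite T_sum.
rewrite (@Rint_sum _ _ _ mu I01 mI01); last first.
  by move=> i _; apply: (@itgZ _ _ _ mu I01 mI01); exact: itg_term.
apply: eq_bigr => i _; rewrite RintegralZl//; last exact: itg_term.
by rewrite -Wrep// /fr; ring.
Qed.

Let rr_le x s z : `|s| + `|x - z| <= 2 -> `|x - z| <= 1 -> `|rr x s z| <= rhob z.
Proof.
move=> sr r1; rewrite /rr /rhob; apply: le_trans (ler_norm_sum _ _ _) _.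
apply: ler_sum => i _; rewrite normrM (normrM (cf _ _)) (normrM (shk _ _)) mulrA ler_wpM2r//.
have k0 : 0 < (fr i)%:R :> R by rewrite ltr0n.
rewrite -mulrA ler_wpM2l// ger0_norm ?expR_ge0// ger0_norm ?shk_ge0//.
apply: (@le_trans _ _ (expR ((fr i)%:R * `|s|) * expR ((fr i)%:R * `|x - z|))).
  apply: ler_pM; rewrite ?expR_ge0 ?shk_ge0//.
    by rewrite ler_expR -mulrN ler_wpM2l ?(ltW k0)// -normrN ler_norm.
  apply: (le_trans (shk_le k0 (normr_ge0 (x - z)))).
  by rewrite ler_piMl ?expR_ge0.
by rewrite -expRD -mulrDr ler_expR mulrC ler_wpM2r// ltW.
Qed.

Let irhob : mu.-integrable I01 (EFin \o rhob).
Proof.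
apply: (@itg_sum _ _ _ mu I01 mI01) => i _; apply: (@itgZ _ _ _ mu I01 mI01).
by apply: (@itg_norm _ _ _ mu I01); exact: irho.
Qed.

Let E0 : 0 <= E.
Proof.
apply: Rintegral_ge0 => z _; apply: sumr_ge0 => i _.
by rewrite !mulr_ge0 ?expR_ge0.
Qed.

Let A0 : 0 <= A. Proof. by apply: Rintegral_ge0 => z _. Qed.

Let between_le x z : between x0 x z -> `|x - z| + `|z - x0| <= `|x - x0|.
Proof.
rewrite /between => /orP[/andP[h1 h2]|/andP[h1 h2]].
  by rewrite !gtr0_norm ?subr_gt0//; [lra|exact: lt_trans h2].
by rewrite !ltr0_norm ?subr_lt0//; [lra|exact: lt_trans h2].
Qed.

Let dist1 x : I01 x -> `|x - x0| < 1.
Proof.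
move=> /I01P/andP[a1 a2]; move/I01P : x0I => /andP[b1 b2].
by rewrite ltr_norml; apply/andP; split; lra.
Qed.

Let ibar x : mu.-integrable I01 (EFin \o
  (fun z => if between x0 x z then a z * `|x - z| else 0)).
Proof.
apply: (@eq_itg _ _ _ mu I01 mI01 (fun z => a z * (if between x0 x z then `|x - z| else 0))).
  by move=> z _; case: ifP => _ //; rewrite mulr0.
apply: (@itgM_bdd _ _ _ mu I01 mI01 _ _ (`|x - x0|) ia).
  apply: measurable_fun_if => //.
  - exact: measurable_between1.
  - apply: measurable_funTS; apply: measurableT_comp => //.
    exact: measurable_funB.
move=> z _; case: ifPn => [/between_le|_]; last by rewrite normr0.
by rewrite normr_id; apply: le_trans; rewrite lerDl.
Qed.

(* [sinh (k r) e^(- k tau) / k] is half the integral of [e^(- k sigma)] over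
   [tau - r, tau + r], so the representation of the [W k] becomes a
   d'Alembert formula for [Z] with time variable [tau]. *)
Let key x (s : seq (R * R)) (m eta t : R) : I01 x -> good x -> 0 <= m -> 0 <= eta ->
  (forall c, c \in s -> `|c.2| <= 2 - `|x - x0|) ->
  (forall z, I01 z -> good z -> between x0 x z ->
    `|\sum_(c <- s) c.1 * (Zp z (c.2 + `|x - z|) - Zp z (c.2 - `|x - z|))|
      <= 2 * m * expR (lam * `|z - x0|)) ->
  (forall z, I01 z -> between x0 x z ->
    `|2^-1 * \sum_(c <- s) c.1 * (hp (c.2 + `|x - z|) - hp (c.2 - `|x - z|)) - t * `|x - z| |
      <= eta) ->
  `|\sum_(c <- s) c.1 * Z x c.2 +
      t * \int[mu]_(z in I01) (if between x0 x z then a z * `|x - z| else 0)| <=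
  P * m * (expR (lam * `|x - x0|) / lam) + (\sum_(c <- s) `|c.1|) * E + eta * A.
Proof.
move=> x01 gx m0 eta0 sx hZ hh.
have -> : \sum_(c <- s) c.1 * Z x c.2 = \int[mu]_(z in I01) \sum_(c <- s) c.1 * T x c.2 z.
  rewrite (@Rint_sum _ _ _ mu I01 mI01); last first.
    by move=> c _; apply: (@itgZ _ _ _ mu I01 mI01); exact: itg_T.
  by apply: eq_bigr => c _; rewrite Z_rep// RintegralZl//; exact: itg_T.
have i1 : mu.-integrable I01 (EFin \o (fun z => \sum_(c <- s) c.1 * T x c.2 z)).
  apply: (@itg_sum _ _ _ mu I01 mI01) => c _; apply: (@itgZ _ _ _ mu I01 mI01).
  exact: itg_T.
have i2 := @itgZ _ _ _ mu I01 mI01 t _ (ibar x).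
rewrite -RintegralZl// -RintegralD//.
pose eB z : R := if between x0 x z then expR (lam * `|z - x0|) else 0.
have ieB : mu.-integrable I01 (EFin \o eB).
  apply: (@itg_I01_bdd _ _ (expR lam)).
    apply: measurable_fun_if => //; first exact: measurable_between1.
    apply: measurable_funTS; apply: measurableT_comp => //.
    apply: measurable_funM => //; apply: measurableT_comp => //.
    exact: measurable_funB.
  move=> z zI; rewrite /eB; case: ifP => _; last by rewrite normr0 expR_ge0.
  by rewrite ger0_norm ?expR_ge0// ler_expR ler_piMr ?(ltW lam0)// ltW// dist1.
have i3 := @itgZ _ _ _ mu I01 mI01 (P * m) _ ieB.
have i4 := @itgZ _ _ _ mu I01 mI01 (\sum_(c <- s) `|c.1|) _ irhob.
have i5 := @itgZ _ _ _ mu I01 mI01 eta _ (@itg_norm _ _ _ mu I01 _ ia).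
have i34 := @itgD _ _ _ mu I01 mI01 _ _ i3 i4.
have i345 := @itgD _ _ _ mu I01 mI01 _ _ i34 i5.
(* The three summands bound the terms in [p], [rho] and [a]. In the last one the increment of [hp]
   is compared with [t * |x - z|], the multiple that appears on the left-hand side. *)
apply: (@le_trans _ _ (\int[mu]_(z in I01) (P * m * eB z + (\sum_(c <- s) `|c.1|) * rhob z + eta * `|a z|))).
  apply: (@le_Rint_norm_ae _ _ _ mu I01 mI01) => //.
    exact: (@itgD _ _ _ mu I01 mI01).
  apply: aeS good_ae => z gz zI; have {}gz := gz zI.
  have rb0 : 0 <= rhob z.
    by apply: sumr_ge0 => i _; rewrite !mulr_ge0 ?expR_ge0.
  have Nc : 0 <= \sum_(c <- s) `|c.1| by apply: sumr_ge0.
  rewrite /eB /T; have [bz|bz] := boolP (between x0 x z); last first.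
    rewrite big1; last by move=> c _; rewrite mulr0.
    by rewrite mulr0 addr0 normr0 mulr0 add0r addr_ge0 ?mulr_ge0.
  have rx : `|x - z| <= `|x - x0| by apply: le_trans (between_le bz); rewrite lerDl.
  have r1 : `|x - z| <= 1 by apply: (le_trans rx); exact: ltW (dist1 x01).
  have -> : \sum_(c <- s) c.1 * (2^-1 * (p z * (Zp z (c.2 + `|x - z|) - Zp z (c.2 - `|x - z|)) -
        a z * (hp (c.2 + `|x - z|) - hp (c.2 - `|x - z|))) + rr x c.2 z) + t * (a z * `|x - z|) =
      2^-1 * p z * (\sum_(c <- s) c.1 * (Zp z (c.2 + `|x - z|) - Zp z (c.2 - `|x - z|))) -
      a z * (2^-1 * (\sum_(c <- s) c.1 * (hp (c.2 + `|x - z|) - hp (c.2 - `|x - z|))) - t * `|x - z|) +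
      \sum_(c <- s) c.1 * rr x c.2 z.
    have e : forall c, c.1 * (2^-1 * (p z * (Zp z (c.2 + `|x - z|) - Zp z (c.2 - `|x - z|)) -
        a z * (hp (c.2 + `|x - z|) - hp (c.2 - `|x - z|))) + rr x c.2 z) =
        2^-1 * p z * (c.1 * (Zp z (c.2 + `|x - z|) - Zp z (c.2 - `|x - z|))) +
        (- (a z * 2^-1) * (c.1 * (hp (c.2 + `|x - z|) - hp (c.2 - `|x - z|))) + c.1 * rr x c.2 z).
      by move=> c; ring.
    under eq_bigr do rewrite e.
    by rewrite !big_split/= -!mulr_sumr; ring.
  have h1 := hZ z zI gz bz; have h2 := hh z zI bz.
  have h3 : `|\sum_(c <- s) c.1 * rr x c.2 z| <= (\sum_(c <- s) `|c.1|) * rhob z.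
    apply: le_trans (ler_norm_sum _ _ _) _; rewrite mulr_suml.
    rewrite big_seq [leRHS]big_seq; apply: ler_sum => c cs; rewrite normrM ler_wpM2l//.
    by apply: rr_le => //; have := sx c cs; lra.
  apply: le_trans (ler_normD _ _) _; apply: (@le_trans _ _ (P * m * expR (lam * `|z - x0|) +
    eta * `|a z| + (\sum_(c <- s) `|c.1|) * rhob z)); last by rewrite addrAC.
  apply: lerD => //; apply: le_trans (ler_normB _ _) _; apply: lerD.
    rewrite !normrM ger0_norm ?invr_ge0//.
    apply: (@le_trans _ _ (2^-1 * P * (2 * m * expR (lam * `|z - x0|)))).
      by apply: ler_pM => //; rewrite ?mulr_ge0// ler_wpM2l ?pP.
    by rewrite le_eqVlt; apply/orP; left; apply/eqP; field.
  by rewrite normrM mulrC ler_wpM2r.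
rewrite (@RintegralD _ _ _ mu I01)// (@RintegralD _ _ _ mu I01)//.
have e3 : \int[mu]_(z in I01) (P * m * eB z) = P * m * \int[mu]_(z in I01) eB z.
  by rewrite RintegralZl.
have e4 : \int[mu]_(z in I01) ((\sum_(c <- s) `|c.1|) * rhob z) = (\sum_(c <- s) `|c.1|) * E.
  by rewrite RintegralZl.
have e5 : \int[mu]_(z in I01) (eta * `|a z|) = eta * A.
  by rewrite RintegralZl//; exact: (@itg_norm _ _ _ mu I01).
rewrite e3 e4 e5 lerD2r lerD2r ler_wpM2l ?mulr_ge0//.
exact: between_exp.
Qed.

Let Lm := expR lam.

Let exp_le x : I01 x -> expR (lam * `|x - x0|) <= Lm.
Proof. by move=> xI; rewrite ler_expR ler_piMr ?(ltW lam0)// ltW// dist1. Qed.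

Let exp_ge1 x : 1 <= expR (lam * `|x - x0|).
Proof. by rewrite -expR0 ler_expR mulr_ge0// ltW. Qed.

Let Zmvt z (b c M : R) : (forall s : R, Num.min b c <= s <= Num.max b c -> `|Z z s| <= M) ->
  `|Zp z c - Zp z b| <= M * `|c - b|.
Proof.
by apply: mvt_bound => s; exact: is_derive_eprim.
Qed.

Let sub_between x z (s : R) : between x0 x z -> `|s| <= 2 - `|x - x0| ->
  `|s| + `|x - z| <= 2 - `|z - x0|.
Proof. by move=> /between_le ? ?; lra. Qed.

Let minmax_abs (b c s M : R) : `|b| <= M -> `|c| <= M ->
  Num.min b c <= s <= Num.max b c -> `|s| <= M.
Proof.
rewrite !ler_norml => /andP[b1 b2] /andP[c1 c2].
by rewrite ge_min le_max => /andP[/orP[]u /orP[]v]; apply/andP; split; lra.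
Qed.

(** The domain |s| <= 2 - |x - x0| is a domain of dependence: for [z] between [x0] and [x], the
    times s + |x - z| and s - |x - z| satisfy the same condition at [z]. The height 2 leaves all
    times in [- 1, 1] available at every [x]. *)
Let Q (M : R) := forall x s, I01 x -> good x -> `|s| <= 2 - `|x - x0| ->
  `|Z x s| <= M * expR (lam * `|x - x0|).

Let PL (m : R) : 0 <= m -> P * m / lam <= m / 4.
Proof.
move=> m0; rewrite ler_pdivrMr// /lam.
have : 0 <= P * m by rewrite mulr_ge0.
by have := m0; lra.
Qed.

Let habs (s : R) : `|s| <= 2 -> `|hsum n kap s| <= 1.
Proof.
move=> s2; have n0 : (0 < n)%N.
  by rewrite -(ltr_nat R); apply: lt_le_trans nkap; exact: expR_gt0.
have [|/andP[h1 h2] _ _] := @hsum_bound R n kap s n0; last by rewrite ger0_norm.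
apply: le_trans nkap; rewrite ler_expR mulrC -mulNr ler_wpM2r//.
by apply: le_trans s2; rewrite -normrN ler_norm.
Qed.

Let hmvt (b c : R) : `|b| <= 2 -> `|c| <= 2 -> `|hp c - hp b| <= `|c - b|.
Proof.
move=> b2 c2; rewrite -[leRHS]mul1r; apply: mvt_bound.
  by move=> s; exact: is_derive_eprim.
by move=> s /(minmax_abs b2 c2) /habs.
Qed.

Let shift_abs x z (s : R) : between x0 x z -> `|s| <= 2 - `|x - x0| ->
  `|s + `|x - z| | <= 2 - `|z - x0| /\ `|s - `|x - z| | <= 2 - `|z - x0|.
Proof.
move=> bz s2; have := sub_between bz s2; split.
  by apply: le_trans (ler_normD _ _) _; rewrite normr_id.
by apply: le_trans (ler_normB _ _) _; rewrite normr_id.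
Qed.

Let le2 z (s : R) : `|s| <= 2 - `|z - x0| -> `|s| <= 2.
Proof. by move=> h; apply: (le_trans h); rewrite gerBl. Qed.

Let int_bar x := \int[mu]_(z in I01) (if between x0 x z then a z * `|x - z| else 0).

Let key1 x (s m eta t : R) : I01 x -> good x -> 0 <= m -> 0 <= eta ->
  `|s| <= 2 - `|x - x0| ->
  (forall z, I01 z -> good z -> between x0 x z ->
    `|Zp z (s + `|x - z|) - Zp z (s - `|x - z|)| <= 2 * m * expR (lam * `|z - x0|)) ->
  (forall z, I01 z -> between x0 x z ->
    `|2^-1 * (hp (s + `|x - z|) - hp (s - `|x - z|)) - t * `|x - z| | <= eta) ->
  `|Z x s + t * int_bar x| <= (m / 4) * expR (lam * `|x - x0|) + E + eta * A.
Proof.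
move=> xI gx m0 eta0 s2 h1 h2.
have := @key x [:: (1, s)] m eta t xI gx m0 eta0; rewrite !big_seq1/= normr1 !mul1r => h.
apply: le_trans (h _ _ _) _.
- by move=> c; rewrite inE => /eqP ->.
- by move=> z zI gz bz; rewrite big_seq1/= mul1r; exact: h1.
- by move=> z zI bz; rewrite big_seq1/= mul1r; exact: h2.
by rewrite lerD2r lerD2r mulrA mulrAC ler_wpM2r ?expR_ge0 ?PL.
Qed.

Let dist2 (s r : R) : `|(s + r) - (s - r)| = 2 * `|r|.
Proof.
have -> : s + r - (s - r) = 2 * r by ring.
by rewrite normrM ger0_norm.
Qed.

Let between_r1 x z : I01 x -> between x0 x z -> `|x - z| <= 1.
Proof.
move=> xI bz; apply: le_trans (ltW (dist1 xI)).
by apply: le_trans (between_le bz); rewrite lerDl.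
Qed.

(** The cut-off is bounded by 1, so the source contributes at most [A], while the potential
    reproduces at most a quarter of the current bound. Halving gives an estimate that depends on [n]
    and [kap] only through [E]. *)
Let Zbound : Q (2 * (E + A)).
Proof.
have [M0 QM0] : exists M0, Q M0.
  (* A crude starting bound from the growth of the [W k]; it depends badly on [n] and [kap], which
     halving forgives. *)
  exists (\sum_(i < n) `|cf n i.+1| * expR ((fr i)%:R * 2) * q (fr i)) => x s x01 gx s2.
  apply: le_trans (ler_norm_sum _ _ _) _.
  rewrite mulr_suml; apply: ler_sum => i _.
  rewrite -[leLHS]mulr1; apply: ler_pM => //.
  rewrite !normrM mulrAC -mulrA -[leRHS]mulrA ler_wpM2l//; apply: ler_pM => //; last exact: Wq.
  rewrite ger0_norm ?expR_ge0// ler_expR -mulrN ler_wpM2l// (le_trans (ler_norm _))//.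
  by rewrite normrN (le_trans s2)// gerBl.
apply: (halving (M0 := M0)) => //; last first.
  move=> M QM x s x01 gx s2; apply/ler_addgt0Pr => e e0.
  have [|M' QM' M'e] := QM (e / expR (lam * `|x - x0|)); first by rewrite divr_gt0 ?expR_gt0.
  apply: le_trans (QM' x s x01 gx s2) _.
  apply: le_trans (ler_wpM2r (expR_ge0 _) M'e) _.
  by rewrite mulrDl divfK// gt_eqF ?expR_gt0.
move=> M QM x s x01 gx s2.
have M0' : 0 <= M.
  have := QM x s x01 gx s2; have := expR_gt0 (lam * `|x - x0|) => e0 h.
  by rewrite -(pmulr_lge0 _ e0); exact: le_trans h.
have := @key1 x s M 1 0 x01 gx M0' ler01 s2; rewrite mul0r addr0 => h.
apply: le_trans (h _ _) _.
- move=> z zI gz bz; have [u v] := shift_abs bz s2.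
  apply: le_trans (Zmvt (M := M * expR (lam * `|z - x0|)) _) _.
    by move=> s' /(minmax_abs v u) ss'; exact: QM.
  rewrite dist2 normr_id -[leRHS]mulrA [leRHS]mulrC ler_wpM2l ?mulr_ge0 ?expR_ge0//.
  by have := between_r1 x01 bz; lra.
- move=> z zI bz; have [u v] := shift_abs bz s2; rewrite mul0r subr0.
  rewrite normrM ger0_norm// ler_pdivrMl// mulr1.
  apply: le_trans (hmvt (le2 v) (le2 u)) _; rewrite dist2 normr_id.
  by have := between_r1 x01 bz; lra.
have := ler_wpM2l (addr_ge0 E0 A0) (exp_ge1 x).
have := mulr_ge0 M0' (expR_ge0 (lam * `|x - x0|)).
by rewrite mul1r mulrDl => ? ?; lra.
Qed.

Variables (dl ee : R).
Hypotheses (dl0 : 0 < dl) (dl1 : dl <= 1) (ee0 : 0 <= ee) (Eee : E <= ee) (dlee : dl <= ee)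
  (ee1 : ee <= 1).
Hypothesis Zdl : forall x, I01 x -> good x -> `|Z x dl| <= ee.
Hypothesis Hee : forall s : R, `|s| <= 2 -> `|Hdef n kap s| <= ee.

Let C1 := 2 * (1 + A).

Let Zbound' : Q C1.
Proof.
move=> x s xI gx s2; apply: le_trans (Zbound xI gx s2) _.
by rewrite ler_wpM2r ?expR_ge0// /C1 ler_wpM2l// lerD2r (le_trans Eee ee1).
Qed.

Let C10 : 0 <= C1. Proof. by rewrite /C1 mulr_ge0// addr_ge0// ler01. Qed.

Let K4 := 3 + C1 * Lm + A.

(** Lipschitz continuity in time: subtracting the formula at time 0 from that at time [dl] leaves
    integrals of bounded functions over intervals of length [dl]. Smallness is then transported from
    [dl], where it is assumed, to 0. *)
Let Z0small x : I01 x -> good x -> `|Z x 0| <= ee * K4.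
Proof.
move=> xI gx; have x1 := dist1 xI.
have d2 : `|dl| <= 2 - `|x - x0| by rewrite ger0_norm ?(ltW dl0)//; have := dl1; move: x1; lra.
have z2 : `|0 : R| <= 2 - `|x - x0| by rewrite normr0; move: x1; lra.
have m0 : 0 <= dl * C1 by rewrite mulr_ge0// ltW.
have := @key x [:: (1, dl); (-1, 0)] (dl * C1) dl 0 xI gx m0 (ltW dl0).
rewrite !big_cons !big_nil/= mul1r !mulN1r mul0r !addr0 normrN1 normr1 => h.
have {}h : `|Z x dl - Z x 0| <= P * (dl * C1) * (expR (lam * `|x - x0|) / lam) + (1 + 1) * E + dl * A.
  apply: h.
  - by move=> c; rewrite !inE => /orP[/eqP ->|/eqP ->].
  - move=> z zI gz bz; rewrite !big_cons !big_nil/= mul1r !mulN1r addr0 add0r sub0r.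
    have [u v] := shift_abs bz d2; have [u' v'] := shift_abs bz z2.
    rewrite add0r in u'; rewrite sub0r in v'.
    (* Regrouped so that each difference runs over a time interval of length [dl] instead of 2 |x -
       z|. *)
    rewrite (_ : _ - _ = (Zp z (dl + `|x - z|) - Zp z `|x - z|) - (Zp z (dl - `|x - z|) - Zp z (- `|x - z|))); last by ring.
    apply: le_trans (ler_normB _ _) _.
    have b1 : `|Zp z (dl + `|x - z|) - Zp z `|x - z| | <= C1 * expR (lam * `|z - x0|) * dl.
      apply: le_trans (Zmvt (M := C1 * expR (lam * `|z - x0|)) _) _.
        by move=> s' /(minmax_abs u' u) ss'; exact: Zbound'.
      by rewrite addrK (gtr0_norm dl0).
    have b2 : `|Zp z (dl - `|x - z|) - Zp z (- `|x - z|)| <= C1 * expR (lam * `|z - x0|) * dl.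
      apply: le_trans (Zmvt (M := C1 * expR (lam * `|z - x0|)) _) _.
        by move=> s' /(minmax_abs v' v) ss'; exact: Zbound'.
      by rewrite opprK subrK (gtr0_norm dl0).
    apply: le_trans (lerD b1 b2) _; rewrite le_eqVlt; apply/orP; left; apply/eqP; ring.
  - move=> z zI bz; rewrite !big_cons !big_nil/= mul1r !mulN1r mul0r !addr0 subr0 add0r sub0r.
    have [u v] := shift_abs bz d2; have [u' v'] := shift_abs bz z2.
    rewrite add0r in u'; rewrite sub0r in v'.
    rewrite (_ : _ - _ = (hp (dl + `|x - z|) - hp `|x - z|) - (hp (dl - `|x - z|) - hp (- `|x - z|))); last by ring.
    have b1 := hmvt (le2 u') (le2 u); rewrite addrK in b1.
    have b2 := hmvt (le2 v') (le2 v); rewrite opprK subrK in b2.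
    rewrite normrM ger0_norm// ler_pdivrMl//.
    apply: le_trans (ler_normB _ _) _; rewrite (ger0_norm (ltW dl0)) in b1 b2; lra.
have e1 : P * (dl * C1) * (expR (lam * `|x - x0|) / lam) <= ee * (C1 * Lm).
  rewrite [leLHS]mulrA mulrAC.
  apply: (@le_trans _ _ ((dl * C1) / 4 * Lm)).
    apply: ler_pM; [|exact: expR_ge0|exact: PL|exact: exp_le].
    by rewrite divr_ge0 ?(ltW lam0)// mulr_ge0.
  rewrite [leRHS]mulrA ler_wpM2r ?expR_ge0//.
  by have := ler_wpM2r C10 dlee; move: m0; lra.
have e2 : dl * A <= ee * A by rewrite ler_wpM2r.
have := Zdl xI gx => h3.
rewrite -[Z x 0](subKr (Z x dl)); apply: le_trans (ler_normB _ _) _.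
by have := Eee; rewrite /K4; move: h e1 e2 h3; lra.
Qed.

(** The linear parts in [Hdef] cancel, as (b + r) - (b - r) = 2 r. The source term of the
    symmetrised formula is thus made of defects alone. *)
Let hpodd (b r : R) : hp (b + r) - hp (b - r) + (hp (- b + r) - hp (- b - r)) - 2 * (hp r - hp (- r)) =
  Hdef n kap (b + r) - Hdef n kap (b - r) - 2 * Hdef n kap r.
Proof.
have e1 : - (b + r) = - b - r by rewrite opprD.
have e2 : - (b - r) = - b + r by rewrite opprB addrC.
rewrite /hp /Hdef e1 e2; set f := eprim n kap _.
by move: (f (b + r)) (f (b - r)) (f (- b + r)) (f (- b - r)) (f r) (f (- r)) => *; ring.
Qed.

Let Dn x (s : R) := Z x s + Z x (- s) - 2 * Z x 0.

Let Q2 (M : R) := forall x s, I01 x -> good x -> `|s| <= 2 - `|x - x0| ->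
  `|Dn x s| <= M * expR (lam * `|x - x0|).

(** The second difference [Dn] obeys a d'Alembert formula whose source is [a] times the small
    defects of [hpodd]; halving makes [Dn] itself small, which carries the smallness of [Z] to
    negative times. *)
Let Dsmall : Q2 (2 * (4 * E + 2 * ee * A)).
Proof.
have QM0 : Q2 (4 * C1).
  move=> x s xI gx s2; have s2' : `|- s| <= 2 - `|x - x0| by rewrite normrN.
  have z2 : `|0 : R| <= 2 - `|x - x0| by rewrite normr0; have := dist1 xI; lra.
  have := Zbound' xI gx s2; have := Zbound' xI gx s2'; have := Zbound' xI gx z2 => q1 q2 q3.
  apply: le_trans (ler_normB _ _) _; rewrite normrM (ger0_norm (_ : 0 <= 2))//.
  have := ler_normD (Z x s) (Z x (- s)); lra.
apply: (halving (M0 := 4 * C1)) => //; last first.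
  move=> M QM x s x01 gx s2; apply/ler_addgt0Pr => e e0.
  have [|M' QM' M'e] := QM (e / expR (lam * `|x - x0|)); first by rewrite divr_gt0 ?expR_gt0.
  apply: le_trans (QM' x s x01 gx s2) _.
  apply: le_trans (ler_wpM2r (expR_ge0 _) M'e) _.
  by rewrite mulrDl divfK// gt_eqF ?expR_gt0.
move=> M QM x s xI gx s2.
have M0' : 0 <= M.
  have := QM x s xI gx s2; have := expR_gt0 (lam * `|x - x0|) => e0 h.
  by rewrite -(pmulr_lge0 _ e0); exact: le_trans h.
have m0 : 0 <= 2 * M by rewrite mulr_ge0.
have eta0 : 0 <= 2 * ee by rewrite mulr_ge0.
(* The weights 1, 1, - 2 produce [Dn]. The level [2 * M] comes from the derivative of [G] below, a
   combination of values of [Dn] with total weight 4, and [key] carries a factor 2 already. *)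
have := @key x [:: (1, s); (1, - s); (-2, 0)] (2 * M) (2 * ee) 0 xI gx m0 eta0.
rewrite !big_cons !big_nil/= !mul1r mul0r !addr0 normrN normr1 (ger0_norm (_ : 0 <= 2))// mulNr addrA => h.
have s2' : `|- s| <= 2 - `|x - x0| by rewrite normrN.
have z2 : `|0 : R| <= 2 - `|x - x0| by rewrite normr0; have := dist1 xI; lra.
apply: le_trans (h _ _ _) _.
- by move=> c; rewrite !inE => /or3P[/eqP ->|/eqP ->|/eqP ->].
- move=> z zI gz bz; rewrite !big_cons !big_nil/= !mul1r addr0 add0r sub0r.
  have [u v] := shift_abs bz s2; have [u' v'] := shift_abs bz s2'; have [u0 v0] := shift_abs bz z2.
  rewrite add0r in u0; rewrite sub0r in v0.
  (* As a function of t = |x - z| the combination of primitives has the derivative Dn(s + t) + Dn(s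
     - t) - 2 Dn(t), which is what closes the estimate on [Dn]. *)
  pose G (t : R) := Zp z (s + t) + Zp z (- s + t) - 2 * Zp z t -
    (Zp z (s - t) + Zp z (- s - t) - 2 * Zp z (- t)).
  have G0 : G 0 = 0 by rewrite /G !oppr0 !addr0; ring.
  rewrite [X in `|X|](_ : _ = G `|x - z| - G 0); last first.
    rewrite G0 subr0 /G; move: `|x - z| => r.
    move: (Zp z (s + r)) (Zp z (s - r)) (Zp z (- s + r)) (Zp z (- s - r)) (Zp z r) (Zp z (- r)).
    by move=> u1 u2 u3 u4 u5 u6; ring.
  have dG (t : R) : is_derive t 1 G (Dn z (s + t) + Dn z (s - t) - 2 * Dn z t).
    have dsh (b : R) : is_derive t 1 (fun t => Zp z (b + t)) (Z z (b + t)).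
      have h1 : is_derive t 1 (fun t : R => b + t) 1.
        by have := is_deriveDf (is_derive_cst b t 1) (is_derive_id t 1); rewrite add0r.
      rewrite -[X in is_derive _ _ _ X]mulr1.
      by apply: (@is_derive1_comp _ (Zp z) (fun t : R => b + t)) => //; exact: is_derive_eprim.
    have dsN (b : R) : is_derive t 1 (fun t => Zp z (b - t)) (- Z z (b - t)).
      have h1 : is_derive t 1 (fun t : R => b - t) (- 1).
        by have := is_deriveDf (is_derive_cst b t 1) (is_deriveNf (is_derive_id t 1)); rewrite add0r.
      rewrite -[X in is_derive _ _ _ X]mulrN1.
      by apply: (@is_derive1_comp _ (Zp z) (fun t : R => b - t)) => //; exact: is_derive_eprim.
    have dN0 : is_derive t 1 (fun t => Zp z (- t)) (- Z z (- t)).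
      by have := dsN 0; rewrite sub0r; under [X in is_derive _ _ X _ -> _]eq_fun do rewrite sub0r.
    have d0 : is_derive t 1 (Zp z) (Z z t) by exact: is_derive_eprim.
    apply: (is_derive_eq (is_deriveDf
      (is_deriveDf (is_deriveDf (dsh s) (dsh (- s))) (is_deriveNf (is_deriveZf 2 d0)))
      (is_deriveNf (is_deriveDf (is_deriveDf (dsN s) (dsN (- s))) (is_deriveNf (is_deriveZf 2 dN0)))))).
    have e1 : - (s + t) = - s - t by rewrite opprD.
    have e2 : - (s - t) = - s + t by rewrite opprB addrC.
    rewrite /Dn e1 e2.
    by move: (Z z (s + t)) (Z z (s - t)) (Z z (- s + t)) (Z z (- s - t)) (Z z t) (Z z (- t)) (Z z 0) => *; ring.
  apply: le_trans (mvt_bound (M := 4 * M * expR (lam * `|z - x0|)) dG _) _.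
    move=> t; rewrite min_l// max_r// => /andP[t0 tr].
    have b1 : `|s + t| <= 2 - `|z - x0|.
      by have := sub_between bz s2; have := ler_normD s t; rewrite (ger0_norm t0); move: tr; lra.
    have b2 : `|s - t| <= 2 - `|z - x0|.
      by have := sub_between bz s2; have := ler_normB s t; rewrite (ger0_norm t0); move: tr; lra.
    have b3 : `|t| <= 2 - `|z - x0|.
      by have := sub_between bz s2; rewrite (ger0_norm t0); have := normr_ge0 s; move: tr; lra.
    have q1 := QM z _ zI gz b1; have q2 := QM z _ zI gz b2; have q3 := QM z _ zI gz b3.
    apply: le_trans (ler_normB _ _) _; rewrite normrM (ger0_norm (_ : 0 <= 2))//.
    by have := ler_normD (Dn z (s + t)) (Dn z (s - t)); move: q1 q2 q3; lra.
  rewrite subr0 normr_id.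
  have := ler_wpM2l (mulr_ge0 M0' (expR_ge0 (lam * `|z - x0|))) (between_r1 xI bz).
  by lra.
- move=> z zI bz; rewrite !big_cons !big_nil/= !mul1r mul0r addr0 add0r sub0r subr0.
  have [u v] := shift_abs bz s2; have [u0 v0] := shift_abs bz z2.
  rewrite add0r in u0; rewrite addrA mulNr hpodd.
  rewrite normrM ger0_norm// ler_pdivrMl//.
  have := Hee (le2 u); have := Hee (le2 v); have := Hee (le2 u0) => e1 e2 e3.
  apply: le_trans (ler_normB _ _) _; rewrite normrM (ger0_norm (_ : 0 <= 2))//.
  by have := ler_normB (Hdef n kap (s + `|x - z|)) (Hdef n kap (s - `|x - z|)); move: e1 e2 e3; lra.
set e := expR _.
have e1 : P * (2 * M) * (e / lam) <= M / 2 * e.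
  rewrite mulrA (mulrAC _ e) ler_wpM2r ?expR_ge0//.
  by apply: le_trans (PL m0) _; lra.
have c0 : 0 <= 4 * E + 2 * ee * A by rewrite addr_ge0 ?mulr_ge0.
have := ler_wpM2l c0 (exp_ge1 x); rewrite -/e mulr1 mulrDl => e2.
by move: e1 e2; lra.
Qed.

Let K5 := (8 + 4 * A) * Lm + 2 * K4.

Let Lm0 : 0 <= Lm. Proof. exact: expR_ge0. Qed.

Let K40 : 0 <= K4. Proof. by rewrite /K4 !addr_ge0// mulr_ge0. Qed.

(** At time 0 the potential term integrates Z(t) + Z(- t) = Dn(t) + 2 Z(0), which is small, and
    hp(r) - hp(- r) equals r up to [Hdef]. What remains of the formula is half the integral of |x -
    z| a(z), hence the value 1/2 for [t]. *)
Lemma wave_moment_bound x : I01 x -> good x ->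
  `|\int[mu]_(z in I01) (if between x0 x z then a z * `|x - z| else 0)| <=
  ee * (2 * (K4 + K5 / 4 * Lm + 1 + A)).
Proof.
move=> xI gx; rewrite -/(int_bar x).
have z2 : `|0 : R| <= 2 - `|x - x0| by rewrite normr0; have := dist1 xI; lra.
have K50 : 0 <= K5 by rewrite /K5 addr_ge0 ?mulr_ge0// addr_ge0 ?mulr_ge0.
have m0 : 0 <= ee * K5 by rewrite mulr_ge0.
have := @key1 x 0 (ee * K5) ee (2^-1) xI gx m0 ee0 z2 => h.
have {}h : `|Z x 0 + 2^-1 * int_bar x| <= ee * K5 / 4 * expR (lam * `|x - x0|) + E + ee * A.
  apply: h.
  - move=> z zI gz bz; rewrite add0r sub0r.
    pose G (t : R) := Zp z t - Zp z (- t).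
    have G0 : G 0 = 0 by rewrite /G oppr0 subrr.
    rewrite (_ : _ - _ = G `|x - z| - G 0); last by rewrite G0 /G subr0.
    have dG (t : R) : is_derive t 1 G (Dn z t + 2 * Z z 0).
      have dN0 : is_derive t 1 (fun t => Zp z (- t)) (- Z z (- t)).
        have h1 : is_derive t 1 (fun t : R => - t) (- 1) := is_deriveNf (is_derive_id t 1).
        rewrite -[X in is_derive _ _ _ X]mulrN1.
        by apply: (@is_derive1_comp _ (Zp z) (fun t : R => - t)) => //; exact: is_derive_eprim.
      have d0 : is_derive t 1 (Zp z) (Z z t) by exact: is_derive_eprim.
      apply: (is_derive_eq (is_deriveDf d0 (is_deriveNf dN0))).
      by rewrite /Dn; ring.
    apply: le_trans (mvt_bound (M := ee * K5) dG _) _.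
      move=> t; rewrite min_l// max_r// => /andP[t0 tr].
      have b3 : `|t| <= 2 - `|z - x0|.
        by have := sub_between bz z2; rewrite normr0 (ger0_norm t0); move: tr; lra.
      have q1 := Dsmall zI gz b3; have q2 := Z0small zI gz.
      apply: le_trans (ler_normD _ _) _; rewrite normrM (ger0_norm (_ : 0 <= 2))//.
      have e1 : 2 * (4 * E + 2 * ee * A) * expR (lam * `|z - x0|) <= ee * (8 + 4 * A) * Lm.
        apply: ler_pM; rewrite ?expR_ge0 ?exp_le ?mulr_ge0 ?addr_ge0 ?mulr_ge0//.
        by have := Eee; lra.
      by rewrite /K5; move: q1 q2 e1; lra.
    rewrite subr0 normr_id.
    have := ler_wpM2l m0 (between_r1 xI bz).
    have := ler_wpM2l m0 (exp_ge1 z); move: m0; lra.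
  - move=> z zI bz; rewrite add0r sub0r.
    have [u0 v0] := shift_abs bz z2; rewrite add0r in u0.
    rewrite [X in `|X|](_ : _ = 2^-1 * Hdef n kap `|x - z|); last by rewrite /hp /Hdef !mulrBr.
    by rewrite normrM ger0_norm//; have := Hee (le2 u0); have := ee0; lra.
have h0 := Z0small xI gx.
have e1 : ee * K5 / 4 * expR (lam * `|x - x0|) <= ee * (K5 / 4 * Lm).
  have k0 : 0 <= ee * K5 / 4 by rewrite divr_ge0.
  by apply: le_trans (ler_wpM2l k0 (exp_le xI)) _; rewrite !mulrA.
have := ler_normB (Z x 0 + 2^-1 * int_bar x) (Z x 0).
rewrite (_ : _ - _ = 2^-1 * int_bar x); last by ring.
rewrite normrM (ger0_norm (_ : 0 <= 2^-1))//.
by have := Eee; move: h h0 e1; lra.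
Qed.

End WaveEstimate.

(** * Passage to the limit in the frequency parameters *)

Section Limits.
Context {R : realType}.
Local Notation mu := (@lebesgue_measure R).

Lemma ex_kap (e eta : R) : 0 < e -> 0 < eta ->
  exists2 k : nat, (0 < k)%N & expR (- (k%:R * e)) <= eta.
Proof.
move=> e0 eta0; pose k := (Num.bound (eta^-1 / e)).+1; exists k => //.
have h : eta^-1 / e < k%:R.
  apply: lt_trans (_ : (Num.bound (eta^-1 / e))%:R < k%:R); last by rewrite ltr_nat.
  by apply: archi_boundP; rewrite divr_ge0 ?invr_ge0 ?ltW.
rewrite ltr_pdivrMr// in h.
rewrite expRN -[leRHS]invrK lef_pV2 ?posrE ?expR_gt0 ?invr_gt0//.
by apply: le_trans (ltW h) _; apply: le_trans (expR_ge1Dx _); rewrite lerDr.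
Qed.

Lemma ex_nat_ge (x : R) : exists2 n : nat, (0 < n)%N & x <= n%:R.
Proof.
exists (Num.bound `|x|).+1 => //; apply: le_trans (ler_norm x) _.
apply: (@le_trans _ _ (Num.bound `|x|)%:R); last by rewrite ler_nat.
by apply: ltW; apply: archi_boundP.
Qed.

Lemma expR_sub1_le (y : R) : 0 <= y -> y <= 1 -> expR y - 1 <= expR 1 * y.
Proof.
move=> y0 y1; have h := expR_ge1Dx (- y).
have e := ler_wpM2l (expR_ge0 y) h.
rewrite -expRD subrr expR0 in e.
have : expR y * y <= expR 1 * y by rewrite ler_wpM2r// ler_expR.
by lra.
Qed.

Let I01 : set R := `]0, 1[%classic.

Let mI01 : measurable I01. Proof. exact: measurable_itv. Qed.

(** The choices are made in the order [ee], [kap], [n], with the time [dl] equal to [ee].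
    Subexponential growth of [q] makes [Z] small at time [ee], and the factor e^(2 k) in the
    hypothesis on [rho] is the one in the wave estimate. *)
Lemma source_moment_zero (x0 P : R) (p a : R -> R) (W rho : nat -> R -> R) (good : R -> Prop) (q : nat -> R) :
  I01 x0 -> 0 <= P -> (forall x, I01 x -> `|p x| <= P) ->
  measurable_fun I01 p -> mu.-integrable I01 (EFin \o a) ->
  (forall k, (0 < k)%N -> mu.-integrable I01 (EFin \o W k)) ->
  (forall k, (0 < k)%N -> mu.-integrable I01 (EFin \o rho k)) ->
  (\forall x \ae mu, I01 x -> good x) ->
  (forall k x, (0 < k)%N -> I01 x -> good x ->
    W k x = \int[mu]_(z in I01) (Ker k%:R x0 (x, z) * (p z * W k z + rho k z - a z))) ->
  (forall k x, (0 < k)%N -> I01 x -> good x -> `|W k x| <= q k) ->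
  (forall e : R, 0 < e -> exists2 C, 0 <= C & forall k, (0 < k)%N -> q k <= C * expR (k%:R * e)) ->
  (exists2 C : R, 0 <= C & forall k, (0 < k)%N ->
    expR (2 * k%:R) * \int[mu]_(z in I01) `|rho k z| <= C * expR (- (k%:R))) ->
  forall x, I01 x -> good x ->
    \int[mu]_(z in I01) (if between x0 x z then a z * `|x - z| else 0) = 0.
Proof.
move=> x0I P0 pP mp ia iW irho good_ae Wrep Wq qC [C2 C20 rC] x xI gx.
set I := \int[mu]_(z in I01) _.
pose A := \int[mu]_(z in I01) `|a z|.
pose Lm := expR (4 * P + 1).
(* These are the constants of [wave_moment_bound]; they depend only on [P] and [A], so [ee] may tend
   to 0. *)
pose K4 := 3 + 2 * (1 + A) * Lm + A.
pose K5 := (8 + 4 * A) * Lm + 2 * K4.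
pose KK := 2 * (K4 + K5 / 4 * Lm + 1 + A).
have A0 : 0 <= A by apply: Rintegral_ge0 => z _.
have Lm0 : 0 <= Lm by exact: expR_ge0.
have K40 : 0 <= K4 by rewrite /K4 !addr_ge0// mulr_ge0// mulr_ge0// addr_ge0.
have K50 : 0 <= K5 by rewrite /K5 addr_ge0 ?mulr_ge0// addr_ge0 ?mulr_ge0.
have k54 : 0 <= K5 / 4 * Lm by apply: mulr_ge0 => //; exact: divr_ge0.
have KK0 : 0 <= KK by rewrite /KK; move: K40 A0 k54; lra.
suff main (ee : R) : 0 < ee -> ee <= 1 -> `|I| <= ee * KK.
  apply/eqP; rewrite -normr_le0; apply/ler_addgt0Pr => e e0; rewrite add0r.
  have h1 : 0 < Num.min 1 (e / (KK + 1)).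
    by rewrite lt_min ltr01 divr_gt0// ltr_pwDr.
  apply: le_trans (main _ h1 _) _; first by rewrite ge_min lexx.
  apply: (@le_trans _ _ (e / (KK + 1) * KK)); first by rewrite ler_wpM2r// ge_min lexx orbT.
  by rewrite -mulrA ler_piMr ?(ltW e0)// mulrC ler_pdivrMr ?mul1r ?lerDl// ltr_pwDr.
move=> ee0 ee1.
have e20 : 0 < ee / 2 by rewrite divr_gt0.
have [C1 C10 C1q] := qC _ e20.
pose C := C1 + C2 + 1.
have C0 : 0 < C by rewrite /C ltr_wpDl// addr_ge0.
(* The first bound is for the two tails in [Hdef_bound], each counted twice next to [ee / 2]; the
   second absorbs the constants in the estimates of [rho] and of [Z] at time [ee]. *)
pose eta := Num.min (ee / 8) (ee / (C * expR 1)).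
have eta0 : 0 < eta by rewrite lt_min !divr_gt0// mulr_gt0// expR_gt0.
have [kap kap0 kapP] := ex_kap e20 eta0.
have [n n0 nk] := ex_nat_ge (expR (2 * kap%:R)).
have y1 : expR (- (kap%:R * (ee / 2))) <= 1 by rewrite expR_le1 oppr_le0; apply: mulr_ge0 => //; exact: ltW.
have yC : expR 1 * expR (- (kap%:R * (ee / 2))) * C <= ee.
  have : expR (- (kap%:R * (ee / 2))) <= ee / (C * expR 1).
    by apply: (le_trans kapP); rewrite ge_min lexx orbT.
  by rewrite ler_pdivlMr ?mulr_gt0 ?expR_gt0// => h; apply: le_trans h; rewrite le_eqVlt; apply/orP; left; apply/eqP; ring.
have ymono : expR (- (kap%:R * 1)) <= expR (- (kap%:R * (ee / 2))) :> R.
  by rewrite ler_expR lerN2 ler_wpM2l//; lra.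
apply: (@wave_moment_bound R x0 P p a W rho good x0I P0 pP mp ia iW irho good_ae Wrep q Wq n kap kap0 nk
   ee ee ee0 ee1 (ltW ee0) _ (lexx _) ee1) => //.
- rewrite (@Rint_sum _ _ _ mu I01 mI01); last first.
    move=> i _; apply: (@itgZ _ _ _ mu I01 mI01); apply: (@itg_norm _ _ _ mu I01).
    by apply: irho; rewrite muln_gt0.
  apply: (@le_trans _ _ (\sum_(i < n) `|cf n i.+1 : R| * (expR (2 * (i.+1 * kap)%:R) *
      \int[mu]_(z in I01) `|rho (i.+1 * kap)%N z|))).
    apply: ler_sum => i _; rewrite RintegralZl// ?mulrA//.
    by apply: (@itg_norm _ _ _ mu I01); apply: irho; rewrite muln_gt0.
  apply: (le_trans (@cf_sum_bound R n kap (fun k => expR (2 * k%:R) *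
     \int[mu]_(z in I01) `|rho k z|) C2 1 kap0 C20 _)).
    by move=> k k0; rewrite mulr1; exact: rC.
  apply: (@le_trans _ _ (C2 * (expR 1 * expR (- (kap%:R * (ee / 2)))))).
    rewrite ler_wpM2l//; apply: le_trans (expR_sub1_le (expR_ge0 _) (le_trans ymono y1)) _.
    by rewrite ler_wpM2l ?expR_ge0.
  apply: le_trans yC; rewrite mulrC ler_wpM2l ?mulr_ge0 ?expR_ge0// /C.
  by rewrite -addrA addrCA lerDl addr_ge0.
- move=> y yI gy; apply: le_trans (ler_norm_sum _ _ _) _.
  apply: (@le_trans _ _ (\sum_(i < n) `|cf n i.+1 : R| * (expR (- ((i.+1 * kap)%:R * ee)) *
      q (i.+1 * kap)%N))).
    apply: ler_sum => i _; rewrite !normrM -mulrA ler_wpM2l// mulrC.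
    by rewrite ger0_norm ?expR_ge0// ler_wpM2l ?expR_ge0// Wq// muln_gt0.
  apply: (le_trans (@cf_sum_bound R n kap (fun k => expR (- (k%:R * ee)) * q k) C1 (ee / 2) kap0 C10 _)).
    move=> k k0; apply: le_trans (ler_wpM2l (expR_ge0 _) (C1q k k0)) _.
    rewrite mulrCA -expRD (_ : _ + _ = - (k%:R * (ee / 2)))//; by field.
  apply: (@le_trans _ _ (C1 * (expR 1 * expR (- (kap%:R * (ee / 2)))))).
    by rewrite ler_wpM2l// expR_sub1_le// expR_ge0.
  apply: le_trans yC; rewrite mulrC ler_wpM2l ?mulr_ge0 ?expR_ge0// /C.
  by rewrite -addrA lerDl addr_ge0.
- move=> s s2; have e22 : ee / 2 <= 2 by lra.
  apply: le_trans (Hdef_bound kap0 nk e20 e22 s2) _.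
  have : expR (- expR (kap%:R * (ee / 2))) <= expR (- (kap%:R * (ee / 2))).
    by rewrite ler_expR lerN2; apply: le_trans (expR_ge1Dx _); rewrite lerDr.
  have : expR (- (kap%:R * (ee / 2))) <= ee / 8 by apply: (le_trans kapP); rewrite ge_min lexx.
  by lra.
Qed.

(** The integral from [x0] to [x] of |x - z| a(z) is a second primitive of [a]. Weakly: integrating
    by parts twice, the kernel applied to the second derivative of a test function gives back the
    function, so [a] is orthogonal to all of them. *)
Lemma moment_zero_source_zero (x0 : R) (a : R -> R) : I01 x0 -> mu.-integrable I01 (EFin \o a) ->
  (\forall x \ae mu, I01 x ->
    \int[mu]_(z in I01) (if between x0 x z then a z * `|x - z| else 0) = 0) ->
  \forall x \ae mu, x \in `]0, 1[ -> a x = 0.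
Proof.
move=> x0I ia h; apply: fundamental_lemma => // phi ps pc.
pose K (z : R * R) := if between x0 z.1 z.2 then `|z.1 - z.2| else 0.
have mK : measurable_fun setT K.
  apply: measurable_fun_ifT => //; first exact: measurable_between.
  by apply: measurableT_comp => //; apply: measurable_funB.
have KM x y : I01 x -> I01 y -> `|K (x, y)| <= 1.
  move=> /I01P/andP[x1 x2] /I01P/andP[y1 y2]; rewrite /K/=; case: ifP => _; last by rewrite normr0.
  by rewrite normr_id ler_norml; apply/andP; split; lra.
have s2 : smooth (derive1 (derive1 phi)) by do 2 apply: smooth_derive1.
have c1 : csupp 0 1 (derive1 phi) by exact: csupp_derive1.
have c2 : csupp 0 1 (derive1 (derive1 phi)) by exact: csupp_derive1.
have i2 : mu.-integrable I01 (EFin \o derive1 (derive1 phi)).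
  by apply: integrableS (csupp_itg s2 c2).
have [F1 F2 F3] := Rfubini_bdd mI01 mI01 i2 ia mK KM.
(* At [y = x0] the strict inequalities in [between] make the kernel vanish; this single point is
   discarded later as a null set. *)
have inner y : I01 y -> \int[mu]_(x in I01) (K (x, y) * derive1 (derive1 phi) x) =
    if y == x0 then 0 else phi y.
  move=> /I01P/andP[y0 y1].
  have dphi (x : R) := smooth_derivable x ps.
  have dphi1 (x : R) := smooth_derivable x (smooth_derive1 ps).
  have dF (x : R) : is_derive x 1 (fun x => (x - y) * derive1 phi x - phi x) ((x - y) * derive1 (derive1 phi) x).
    have h1 : is_derive x 1 (fun x : R => x - y) 1.
      by have := is_deriveDf (is_derive_id x 1) (is_derive_cst (- y) x 1); rewrite addr0.
    apply: (is_derive_eq (is_deriveDf (is_deriveMf h1 (dphi1 x)) (is_deriveNf (dphi x)))).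
    by ring.
  have cF : continuous (fun x => (x - y) * derive1 (derive1 phi) x).
    have := smooth_continuous (smoothM (smooth_affine 1 (- y) (@smooth_expR R 0)) s2).
    move=> _; apply: smooth_continuous; apply: smoothM => //.
    apply: (@smooth_is_derive _ _ (fun=> 1)); last exact: smooth_cst.
    by move=> x; have := is_deriveDf (is_derive_id x 1) (is_derive_cst (- y) x 1); rewrite addr0.
  have out0 (x : R) : ~~ (0 < x < 1) -> phi x = 0 /\ derive1 phi x = 0.
    by move=> hx; rewrite (csupp_eq0 pc hx) (csupp_eq0 c1 hx).
  have [p0 d0] : phi 0 = 0 /\ derive1 phi 0 = 0 by apply: out0; rewrite ltxx.
  have [p1 d1] : phi 1 = 0 /\ derive1 phi 1 = 0 by apply: out0; rewrite ltxx andbF.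
  have [yx|yx|yx] := ltgtP y x0.
  - have := Rint_FTC y0 dF cF; rewrite subrr d0 p0 !mulr0 mul0r !subr0 sub0r => e.
    rewrite -[RHS]opprK -e -RintN//; last first.
      apply: integrableS (continuous_compact_integrable (@segment_compact _ 0 y) _) => //.
        by apply: subset_itv; rewrite bnd_simp.
      exact: continuous_subspaceT.
    rewrite Rintegral_mkcond [RHS]Rintegral_mkcond; apply: eq_Rintegral => x _.
    rewrite !patchE /K/= /between yx andbT (ltNge x0) (ltW yx)/=.
    have [xy|xy] := ltP x y.
      have [x0'|x0'] := ltP 0 x.
        rewrite mem_set; last by apply/I01P; rewrite x0' (lt_trans xy y1).
        rewrite mem_set; last by rewrite /= in_itv/= x0' xy.
        by rewrite ltr0_norm ?subr_lt0//; ring.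
      rewrite memNset; last by move=> /I01P/andP[]; rewrite ltNge x0'.
      by rewrite memNset// /= in_itv/= => /andP[]; rewrite ltNge x0'.
    rewrite [in RHS]memNset; last by rewrite /= in_itv/= => /andP[_]; rewrite ltNge xy.
    by case: ifP => // _; rewrite mul0r.
  - have := Rint_FTC y1 dF cF; rewrite subrr d1 p1 !mulr0 mul0r !subr0 !sub0r ?opprK => e.
    rewrite -e.
    rewrite Rintegral_mkcond [RHS]Rintegral_mkcond; apply: eq_Rintegral => x _.
    rewrite !patchE /K/= /between yx (ltNge y x0) (ltW yx)/= andbF orbF.
    have [xy|xy] := ltP y x.
      have [x0'|x0'] := ltP x 1.
        rewrite mem_set; last by apply/I01P; rewrite x0' (lt_trans y0 xy).
        rewrite mem_set; last by rewrite /= in_itv/= x0' xy.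
        by rewrite gtr0_norm ?subr_gt0.
      rewrite memNset; last by move=> /I01P/andP[_]; rewrite ltNge x0'.
      by rewrite memNset// /= in_itv/= => /andP[_]; rewrite ltNge x0'.
    rewrite [in RHS]memNset; last by rewrite /= in_itv/= => /andP[]; rewrite ltNge xy.
    by case: ifP => // _; rewrite mul0r.
  - rewrite (_ : (fun x => _) = cst 0) ?Rintegral_cst ?mul0r//.
    by apply/funext => x; rewrite /K /between/= yx !ltxx/= andbF mul0r.
have ma := itg_meas ia.
transitivity (\int[mu]_(y in I01) (a y * \int[mu]_(x in I01) (K (x, y) * derive1 (derive1 phi) x))).
  apply: (@Rint_ae_eq _ _ _ mu I01 mI01).
  - by apply: measurable_funM => //; exact: smooth_measurable.
  - exact: itg_meas F2.
  exists [set x0]; split; [exact: measurable_set1|exact: lebesgue_measure_set1|].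
  move=> y /= /not_implyP[yI]; apply: contra_notP => yx.
  by rewrite inner// ifN//; apply/eqP.
rewrite -F3 (@Rint_ae_eq _ _ _ mu I01 mI01 _ (cst 0)) ?Rintegral_cst ?mul0r//.
  exact: itg_meas F1.
apply: aeS h => x hx /hx {}hx.
rewrite (_ : \int[mu]_(y in I01) (K (x, y) * a y) = 0) ?mulr0// -[RHS]hx.
by apply: eq_Rintegral => z _; rewrite /K/=; case: ifP => _; [rewrite mulrC|rewrite mul0r].
Qed.

End Limits.

(** * Truncated Laplace transforms *)

Section TruncatedLaplace.
Context {R : realType}.
Local Notation mu := (@lebesgue_measure R).

Let I01 : set R := `]0, 1[%classic.

Let mI01 : measurable I01. Proof. exact: measurable_itv. Qed.

Lemma measurable_expRN (a : R) (D : set R) : measurable_fun D (fun t => expR (- (a * t))).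
Proof.
rewrite (_ : (fun t => _) = fun t => expR (- a * t)); last first.
  by apply/funext => t; rewrite mulNr.
by apply: smooth_measurable; exact: smooth_expR.
Qed.

Lemma between_dist (x0 x z : R) : between x0 x z -> `|x - z| + `|z - x0| <= `|x - x0|.
Proof.
rewrite /between => /orP[/andP[h1 h2]|/andP[h1 h2]].
  by rewrite !gtr0_norm ?subr_gt0//; [lra|exact: lt_trans h2].
by rewrite !ltr0_norm ?subr_lt0//; [lra|exact: lt_trans h2].
Qed.

Lemma I01_dist (x y : R) : I01 x -> I01 y -> `|x - y| <= 1.
Proof.
move=> /I01P/andP[x0 x1] /I01P/andP[y0 y1].
by rewrite ler_norml; apply/andP; split; lra.
Qed.

(** In the weight e^((k + lam) |x - x0|) the rate [k] compensates the kernel, because |x - z| + |z -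
    x0| <= |x - x0|, and [lam] provides the contraction. The exponent 2 k adds the kernel in front
    of [rho] to the weight at distance at most 1; the a priori bound [M0] disappears by halving. *)
Lemma weak_sol_sup_bound (x0 P k M0 : R) (p w rho : R -> R) (good : R -> Prop) :
  0 < k -> I01 x0 -> 0 <= P -> (forall x, I01 x -> `|p x| <= P) ->
  measurable_fun I01 p ->
  mu.-integrable I01 (EFin \o w) -> mu.-integrable I01 (EFin \o rho) ->
  (\forall x \ae mu, I01 x -> good x) ->
  (forall x, I01 x -> good x ->
    w x = \int[mu]_(z in I01) (Ker k x0 (x, z) * (p z * w z + rho z))) ->
  (forall x, I01 x -> good x -> `|w x| <= M0) ->
  forall x, I01 x -> good x ->
    `|w x| <= 2 * expR (4 * P + 1 + 2 * k) * \int[mu]_(z in I01) `|rho z|.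
Proof.
move=> k0 x0I P0 pP mp iw ir good_ae wrep wM.
set r := \int[mu]_(z in I01) `|rho z|.
have r0 : 0 <= r by apply: Rintegral_ge0 => z _.
pose lam : R := 4 * P + 1; have lam0 : 0 < lam by rewrite /lam; lra.
pose e1 (x : R) := expR ((k + lam) * `|x - x0|).
have e10 x : 0 < e1 x by exact: expR_gt0.
have kl0 : 0 <= k + lam by rewrite addr_ge0// ltW.
have e11 x : 1 <= e1 x by rewrite -expR0 ler_expR mulr_ge0.
have e1E x : e1 x = expR (k * `|x - x0|) * expR (lam * `|x - x0|) by rewrite -expRD -mulrDl.
pose Q M := forall x, I01 x -> good x -> `|w x| <= M * e1 x.
suff Qr : Q (2 * (expR k * r)).
  move=> x xI gx; apply: le_trans (Qr x xI gx) _.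
  rewrite [leLHS](_ : _ = 2 * (expR k * e1 x) * r); last by ring.
  rewrite ler_wpM2r// ler_wpM2l// -expRD ler_expR.
  by have := ler_wpM2l kl0 (I01_dist xI x0I); rewrite mulr1 /lam; lra.
apply: (halving (M0 := Num.max M0 0)); last first.
- move=> M QM x xI gx; apply/ler_addgt0Pr => e e0.
  have [|M' QM' M'e] := QM (e / e1 x); first by rewrite divr_gt0.
  apply: le_trans (QM' x xI gx) _.
  apply: le_trans (ler_wpM2r (ltW (e10 x)) M'e) _.
  by rewrite mulrDl divfK// gt_eqF.
- move=> x xI gx; apply: le_trans (wM x xI gx) _.
  apply: (@le_trans _ _ (Num.max M0 0 * 1)); first by rewrite mulr1 le_max lexx.
  by rewrite ler_wpM2l// le_max lexx orbT.
move=> M QM x xI gx.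
have M0' : 0 <= M by rewrite -(pmulr_lge0 _ (e10 x)); exact: le_trans (QM x xI gx).
have i1 : mu.-integrable I01 (EFin \o (fun z => p z * w z + rho z)).
  apply: (@itgD _ _ _ mu I01 mI01) => //.
  apply: (@eq_itg _ _ _ mu I01 mI01 (fun z => w z * p z)); first by move=> z _; rewrite mulrC.
  exact: (@itgM_bdd _ _ _ mu I01 mI01 _ _ P iw).
have m1 : measurable_fun setT (fun z : R => (x, z)) by exact: measurable_pair1.
have i2 : mu.-integrable I01 (EFin \o (fun z => Ker k x0 (x, z) * (p z * w z + rho z))).
  apply: (@eq_itg _ _ _ mu I01 mI01 (fun z => (p z * w z + rho z) * Ker k x0 (x, z))).
    by move=> z _; rewrite mulrC.
  apply: (@itgM_bdd _ _ _ mu I01 mI01 _ _ (expR k) i1).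
    apply: measurable_funTS; exact: (measurableT_comp (@measurable_Ker R k x0) m1).
  move=> z /I01P/andP[z0 z1]; move/I01P : xI => /andP[x00 x1].
  by apply: Ker_bound => //; rewrite !ltW.
pose eB z : R := if between x0 x z then expR (lam * `|z - x0|) else 0.
have ieB : mu.-integrable I01 (EFin \o eB).
  apply: (@itg_I01_bdd _ _ (expR lam)).
    apply: measurable_fun_if => //; first exact: measurable_between1.
    apply: measurable_funTS; apply: measurableT_comp => //.
    apply: measurable_funM => //; apply: measurableT_comp => //.
    exact: measurable_funB.
  move=> z zI; rewrite /eB; case: ifP => _; last by rewrite normr0 expR_ge0.
  by rewrite ger0_norm ?expR_ge0// ler_expR ler_piMr ?(ltW lam0)// I01_dist.
pose c := expR (k * `|x - x0|) * (P * M).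
have i3 := @itgZ _ _ _ mu I01 mI01 c _ ieB.
have inr := @itg_norm _ _ _ mu I01 _ ir.
have i4 := @itgZ _ _ _ mu I01 mI01 (expR k) _ inr.
rewrite wrep//.
apply: (@le_trans _ _ (\int[mu]_(z in I01) (c * eB z + expR k * `|rho z|))).
  apply: (@le_Rint_norm_ae _ _ _ mu I01 mI01) => //.
    exact: (@itgD _ _ _ mu I01 mI01).
  apply: aeS good_ae => z gz zI; have {}gz := gz zI.
  rewrite /eB /Ker/=; have [bz|bz] := boolP (between x0 x z); last first.
    by rewrite mul0r normr0 mulr0 add0r mulr_ge0 ?expR_ge0.
  have d1 := I01_dist xI zI.
  have s1 : shk k `|x - z| <= expR (k * `|x - z|).
    apply: (le_trans (shk_le k0 (normr_ge0 (x - z)))).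
    by rewrite ler_piMl ?expR_ge0.
  have s0 : 0 <= shk k `|x - z| by rewrite shk_ge0.
  rewrite mulrDr; apply: le_trans (ler_normD _ _) _; apply: lerD.
    rewrite normrM (normrM (p z)) (ger0_norm s0).
    apply: (@le_trans _ _ (expR (k * `|x - z|) * (P * (M * e1 z)))).
      by do 2 (apply: ler_pM => //; rewrite ?mulr_ge0//); [exact: pP|exact: QM].
    rewrite e1E /c.
    rewrite (_ : expR (k * `|x - x0|) * (P * M) * _ = (P * M * expR (lam * `|z - x0|)) * expR (k * `|x - x0|)); last by ring.
    rewrite (_ : expR (k * `|x - z|) * _ = (P * M * expR (lam * `|z - x0|)) * (expR (k * `|x - z|) * expR (k * `|z - x0|))); last by ring.
    rewrite ler_wpM2l ?mulr_ge0 ?expR_ge0// -expRD ler_expR -mulrDr ler_wpM2l ?(ltW k0)//.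
    exact: between_dist.
  rewrite normrM (ger0_norm s0) ler_wpM2r// (le_trans s1)// ler_expR.
  by rewrite ler_piMr// ltW.
rewrite (@RintegralD _ _ _ mu I01)// RintegralZl// RintegralZl//.
have b := between_exp lam0 x0I xI.
have c0 : 0 <= c by rewrite /c !mulr_ge0 ?expR_ge0.
have h1 := ler_wpM2l c0 b.
have h2 : c * (expR (lam * `|x - x0|) / lam) <= M / 4 * e1 x.
  rewrite e1E /c.
  move: (expR_ge0 (k * `|x - x0|)) (expR_ge0 (lam * `|x - x0|)).
  move: (expR (k * _)) (expR (lam * _)) => ek el ek0 el0.
  rewrite [leLHS](_ : _ = (P * M / lam) * (ek * el)); last by move: lam^-1 => l; ring.
  rewrite ler_wpM2r ?mulr_ge0 ?expR_ge0// ler_pdivrMr// /lam.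
  have : 0 <= P * M by rewrite mulr_ge0.
  by move: M0'; lra.
have h3 : expR k * r <= expR k * r * e1 x by rewrite ler_peMr// mulr_ge0 ?expR_ge0.
have h4 : 0 <= M * e1 x by rewrite mulr_ge0// ltW.
rewrite -/r mulrDl; move: h1 h2 h3 h4; rewrite /eB; lra.
Qed.

(** Shifted to [u], the cut-off approximates the indicator of t < u and is an exponential polynomial
    in [t]; its integral against [f] combines values of the transform at integers, multiplied by
    e^(j u). As u < T these products decay, so the integral of [f] over ]0, u[ is 0. *)
Lemma mikusinski (T : R) (f : R -> R) : 0 < T ->
  mu.-integrable `]0, T[ (EFin \o f) ->
  (forall e : R, 0 < e -> exists2 C : R, 0 <= C & forall k : nat, (0 < k)%N ->
    `|\int[mu]_(t in `]0, T[) (expR (- (k%:R * t)) * f t)| <= C * expR (- (k%:R * (T - e)))) ->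
  \forall t \ae mu, t \in `]0, T[ -> f t = 0.
Proof.
move=> T0 fi fC.
have mD : measurable (`]0, T[%classic : set R) by exact: measurable_itv.
have mf := itg_meas fi.
suff main (u : R) : 0 < u -> u < T -> \int[mu]_(t in `]0, u[) f t = 0.
  apply: ae_eq0_intervals => // l r l0 lr rT.
  have r0 := lt_trans l0 lr.
  have i1 : mu.-integrable `]0, r[ (EFin \o f).
    by apply: integrableS fi => //; apply: subset_itvl; rewrite bnd_simp ltW.
  have i2 : mu.-integrable `]0, l] (EFin \o f).
    by apply: integrableS i1 => //; apply: subset_itvl; rewrite bnd_simp.
  have i3 : mu.-integrable `]0, l[ (EFin \o f).
    by apply: integrableS i2 => //; apply: subset_itvl; rewrite bnd_simp.
  have := @Rintegral_itvB R f (BRight 0) (BLeft r) l i1.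
  rewrite !bnd_simp => /(_ (ltW l0) lr) <-.
  by rewrite main// -Rintegral_itv_bndo_bndc// main ?subrr// (lt_trans lr).
move=> u0 uT.
(* Half of the gap: then e^(j u) e^(- j (T - e)) = e^(- j e). *)
pose e := (T - u) / 2; have e0 : 0 < e by rewrite divr_gt0// subr_gt0.
have [C C0 CP] := fC e e0.
(* Since t - u > - T on ]0, T[, this size of [n] makes the cut-off admissible on the whole
   interval. *)
have nkex (k : nat) : exists n : nat, (0 < n)%N && (expR (k.+1%:R * T) <= n%:R).
  by have [n n0 nk] := ex_nat_ge (expR (k.+1%:R * T)); exists n; rewrite n0.
pose N k := xchoose (nkex k).
have NP k : (0 < N k)%N /\ expR (k.+1%:R * T) <= (N k)%:R by apply/andP; exact: (xchooseP (nkex k)).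
pose F k t := f t * hsum (N k) k.+1 (t - u).
have range t : `]0, T[%classic t -> forall k, expR (- (k.+1%:R * (t - u))) <= (N k)%:R.
  rewrite /= in_itv/= => /andP[t0 tT] k; have [_] := NP k; apply: le_trans.
  by rewrite ler_expR -mulrN ler_wpM2l//; lra.
have hle1 t k : `]0, T[%classic t -> `|hsum (N k) k.+1 (t - u)| <= 1.
  move=> tT; have [n0 _] := NP k; have [/andP[h1 h2] _ _] := hsum_bound n0 (range t tT k).
  by rewrite ger0_norm.
have [|||||iu cvF] := @Rint_dominated _ _ _ mu `]0, T[ mD F (f \_ `]0, u[) (fun t => `|f t|).
- move=> k; apply: measurable_funM => //; apply: measurable_funTS.
  rewrite (_ : (fun t => hsum _ _ _) = fun t => \sum_(i < N k) cf (N k) i.+1 * expR (- ((i.+1 * k.+1)%:R * (t - u))))//.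
  apply: measurable_sum => i; apply: measurable_funM => //.
  apply: measurableT_comp => //; apply: measurableT_comp => //.
  by apply: measurable_funM => //; exact: measurable_funB.
- apply: (measurable_restrict f (measurable_itv `]0, u[) mD).1.
  by apply: measurable_funS mf => //; exact: subIsetl.
(* At t = u the cut-off does not follow the indicator; one point is negligible. *)
- exists [set u]; split; [exact: measurable_set1|exact: lebesgue_measure_set1|].
  move=> t /= /not_implyP[tT]; apply: contra_notP => tu.
  have [/andP[t0 tT']] : 0 < t < T by move: tT; rewrite in_itv.
  have expc (b : R) : 0 < b -> expR (- (k.+1%:R * b)) @[k --> \oo] --> (0 : R).
    move=> b0; apply/cvgrPdist_lt => eps eps0.
    have [K K0 KP] := ex_kap b0 (divr_gt0 eps0 (ltr0n R 2)).
    exists K => // k /= Kk; rewrite sub0r normrN ger0_norm ?expR_ge0//.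
    apply: le_lt_trans (_ : _ <= expR (- (K%:R * b))) _.
      by rewrite ler_expR lerN2 ler_wpM2r ?(ltW b0)// ler_nat ltnW.
    by apply: le_lt_trans KP _; rewrite ltr_pdivrMr// ltr_pMr// ltr1n.
  rewrite patchE; case: ifPn => [|tnu].
    rewrite inE/= in_itv/= => /andP[_ tltu].
    rewrite -[X in _ --> X]mulr1; apply: cvgMr.
    have ut0 : 0 < u - t by rewrite subr_gt0.
    apply/subr_cvg0; apply/norm_cvg0P.
    apply: (@squeeze_cvgr _ _ _ _ (fun=> 0) (fun k => expR (- (k.+1%:R * (u - t))))); [|exact: cvg_cst|exact: expc].
    apply: nearW => k; rewrite normr_ge0/=.
    have [n0 _] := NP k; have [/andP[h1 h2] _ h3] := hsum_bound n0 (range t tT k).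
    rewrite distrC ger0_norm ?subr_ge0//; apply: (le_trans h3).
    rewrite ler_expR lerN2 -mulrN opprB.
    by apply: le_trans (expR_ge1Dx _); rewrite lerDr.
  have ut : u < t.
    rewrite ltNge; apply/negP => tleu; move: tnu; rewrite notin_setE/= in_itv/= t0/=; apply.
    by rewrite lt_neqAle tleu andbT; apply/eqP.
  rewrite -[X in _ --> X](mulr0 (f t)); apply: cvgMr.
  apply: (@squeeze_cvgr _ _ _ _ (fun=> 0) (fun k => expR (- (k.+1%:R * (t - u)))));
    [|exact: cvg_cst|by apply: expc; rewrite subr_gt0].
  apply: nearW => k; have [n0 _] := NP k.
  by have [/andP[h1 h2] h3 _] := hsum_bound n0 (range t tT k); rewrite h1 h3.
- exact: itg_norm.
- by move=> k t tT; rewrite normrM ler_piMr// hle1.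
have iF (j : nat) : mu.-integrable `]0, T[ (EFin \o (fun t => expR (- (j%:R * t)) * f t)).
  apply: (@eq_itg _ _ _ mu _ mD (fun t => f t * expR (- (j%:R * t)))); first by move=> t _; rewrite mulrC.
  apply: (@itgM_bdd _ _ _ mu _ mD _ _ 1 fi).
    exact: measurable_expRN.
  move=> t /=; rewrite in_itv/= => /andP[t0 _]; rewrite ger0_norm ?expR_ge0// expR_le1.
  by rewrite oppr_le0 mulr_ge0// ltW.
have Fle k : `|\int[mu]_(t in `]0, T[) F k t| <= C * (expR (expR (- (k.+1%:R * e))) - 1).
  have -> : \int[mu]_(t in `]0, T[) F k t = \sum_(i < N k) (cf (N k) i.+1 * expR ((i.+1 * k.+1)%:R * u)) *
      \int[mu]_(t in `]0, T[) (expR (- ((i.+1 * k.+1)%:R * t)) * f t).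
    under [RHS]eq_bigr do rewrite -(@RintegralZl _ _ _ mu _ _ _ mD (iF _)).
    rewrite -(@Rint_sum _ _ _ mu _ mD); last by move=> i _; exact: (@itgZ _ _ _ mu _ mD).
    apply: eq_Rintegral => t _; rewrite /F /hsum mulr_sumr; apply: eq_bigr => i _.
    rewrite (_ : - (_ * (t - u)) = (i.+1 * k.+1)%:R * u + - ((i.+1 * k.+1)%:R * t)); last by ring.
    by rewrite expRD; ring.
  apply: le_trans (ler_norm_sum _ _ _) _.
  apply: le_trans (@cf_sum_bound R (N k) k.+1 (fun j => expR (j%:R * u) *
    `|\int[mu]_(t in `]0, T[) (expR (- (j%:R * t)) * f t)|) C e _ C0 _); last 2 first.
  - by [].
  - move=> j j0; apply: le_trans (ler_wpM2l (expR_ge0 _) (CP j j0)) _.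
    rewrite mulrCA -expRD (_ : _ + _ = - (j%:R * e))//.
    by rewrite /e; field.
  apply: ler_sum => i _; rewrite !normrM -mulrA ler_wpM2l//.
  by rewrite ger0_norm ?expR_ge0.
have F0 : \int[mu]_(t in `]0, T[) F k t @[k --> \oo] --> (0 : R).
  apply/cvgrPdist_lt => eps eps0.
  have eta0 : 0 < Num.min 1 (eps / ((C + 1) * expR 1)).
    by rewrite lt_min ltr01 divr_gt0// mulr_gt0 ?expR_gt0// ltr_wpDl.
  have [K K0 KP] := ex_kap e0 eta0.
  exists K => // k /= Kk; rewrite sub0r normrN.
  apply: le_lt_trans (Fle k) _.
  have y1 : expR (- (k.+1%:R * e)) <= Num.min 1 (eps / ((C + 1) * expR 1)).
    by apply: le_trans KP; rewrite ler_expR lerN2 ler_wpM2r ?(ltW e0)// ler_nat ltnW.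
  have y2 : expR (- (k.+1%:R * e)) <= 1 by apply: (le_trans y1); rewrite ge_min lexx.
  have y3 : expR (- (k.+1%:R * e)) <= eps / ((C + 1) * expR 1).
    by apply: (le_trans y1); rewrite ge_min lexx orbT.
  apply: le_lt_trans (ler_wpM2l C0 (expR_sub1_le (expR_ge0 _) y2)) _.
  rewrite ler_pdivlMr ?mulr_gt0 ?expR_gt0 ?ltr_wpDl// in y3.
  have := mulr_gt0 (expR_gt0 1) (expR_gt0 (- (k.+1%:R * e))) => pos.
  by apply: lt_le_trans y3; move: pos; lra.
have sub : (`]0, T[ `&` `]0, u[)%classic = `]0, u[%classic :> set R.
  by rewrite setIidr//; apply: subset_itvl; rewrite bnd_simp ltW.
have e0' := cvg_unique (@norm_hausdorff _ _) cvF F0.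
by rewrite -[RHS]e0' -Rintegral_mkcondr sub.
Qed.

End TruncatedLaplace.

(** * Affine change of variable for Lebesgue measure *)

Section AffineSubstitution.
Context {R : realType}.
Local Notation mu := (@lebesgue_measure R).

Variables (s b : R).
Hypothesis s0 : 0 < s.

Let phi0 (x : measurableTypeR R) : measurableTypeR R := s * x + b.

Let mphi : measurable_fun setT phi0.
Proof. by apply: measurable_funD => //; exact: measurable_funM. Qed.

Let m : {measure set (measurableTypeR R) -> \bar R} :=
  mscale (NngNum (ltW s0))
    (measure_function_pushforward__canonical__measure_function_Measure mu mphi).

(** Both measures agree on half-open intervals, and Lebesgue measure is determined by its values
    there. *)
Let lebesgue_measure_affine (A : set R) : measurable A -> mu A = m A.
Proof.
move=> mA.
apply: lebesgue_measure_unique => //= _ [[x y] /= _ <-].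
rewrite /m /mscale/= /pushforward.
have -> : phi0 @^-1` `]x, y] = `](x - b) / s, (y - b) / s]%classic.
  apply/seteqP; split => z /=; rewrite /phi0 !in_itv/= ltr_pdivrMr// ler_pdivlMr// => /andP[? ?];
    by apply/andP; split; lra.
rewrite !lebesgue_measure_itv/= !lte_fin ltr_pM2r ?invr_gt0// ltrD2r.
case: ifPn => _; last by rewrite mule0.
by rewrite -!EFinD -EFinM; congr EFin; field; rewrite gt_eqF.
Qed.

Lemma ge0_integral_affine (f : R -> \bar R) :
  measurable_fun setT f -> (forall y, 0 <= f y)%E ->
  (\int[mu]_y f y = s%:E * \int[mu]_x f (s * x + b)%R)%E.
Proof.
move=> mf f0.
transitivity (\int[m]_y f y)%E.
  by apply: eq_measure_integral => A mA _; exact: lebesgue_measure_affine.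
rewrite /m ge0_integral_mscale//; congr (_ * _)%E.
by rewrite (ge0_integral_pushforward mphi).
Qed.

End AffineSubstitution.

(** * The Gamma integral and its tail *)

Section GammaFacts.
Context {R : realType}.
Local Notation mu := (@lebesgue_measure R).
Variable alpha : R.
Hypotheses (a0 : 0 < alpha) (a1 : alpha < 1).

Definition gam (y : R) : R := if 0 < y then y `^ (alpha - 1) * expR (- y) else 0.

Lemma gam_ge0 y : 0 <= gam y.
Proof. by rewrite /gam; case: ifP => // _; rewrite mulr_ge0 ?powR_ge0 ?expR_ge0. Qed.

Lemma measurable_gam : measurable_fun setT gam.
Proof.
apply: measurable_fun_ifT => //; first exact: measurable_fun_ltr.
apply: measurable_funM; first exact: measurable_powR.
by have := @measurable_expRN R 1 setT; under eq_fun do rewrite mul1r.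
Qed.

Lemma GammaE : Gamma alpha = fine (\int[mu]_y (gam y)%:E).
Proof.
rewrite /Gamma Rintegral_mkcond; congr fine; apply: eq_integral => y _.
rewrite patchE /gam; case: ifPn => [|yn].
  by rewrite inE/= in_itv/= andbT => ->.
by case: ifPn => // y0; move: yn; rewrite notin_setE/= in_itv/= y0.
Qed.

Let powR_dec (y z : R) : 0 < y -> y <= z -> z `^ (alpha - 1) <= y `^ (alpha - 1).
Proof.
move=> y0 yz; have z0 := lt_le_trans y0 yz.
have -> : alpha - 1 = - (1 - alpha) by ring.
rewrite !powRN lef_pV2 ?posrE ?powR_gt0//.
have r0 : 0 <= 1 - alpha by rewrite subr_ge0 ltW.
by apply: (ge0_ler_powR r0) => //; rewrite nnegrE ltW.
Qed.

(** The power y^(alpha - 1) decreases because alpha < 1, so only the exponential factor matters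
    under a shift. *)
Lemma gam_shift (b v : R) : 0 <= b -> 0 < v -> gam (v + b) <= expR (- b) * gam v.
Proof.
move=> b0 v0; rewrite /gam v0 ltr_wpDr// opprD expRD.
rewrite [leRHS](_ : _ = v `^ (alpha - 1) * (expR (- v) * expR (- b))); last by ring.
rewrite ler_wpM2r ?mulr_ge0 ?expR_ge0//.
by apply: powR_dec => //; rewrite lerDl.
Qed.

Let is_derive_powRa (y : R) : 0 < y ->
  is_derive y 1 (fun y => y `^ alpha / alpha) (y `^ (alpha - 1)).
Proof.
move=> y0.
have h : is_derive y 1 (fun z : R => z `^ alpha) (alpha * y `^ (alpha - 1)).
  have yI : y \in `]0, +oo[ by rewrite in_itv/= y0.
  rewrite -(powR_derive1 alpha yI).
  by apply: derivable_is_derive; exact: derivable_powR.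
rewrite (_ : (fun y => _) = fun y => alpha^-1 * y `^ alpha); last first.
  by apply/funext => z; rewrite mulrC.
apply: (is_derive_eq (is_deriveZf alpha^-1 h)).
by rewrite mulrA mulVf ?mul1r// gt_eqF.
Qed.

(** The singularity at 0 is reached through the intervals [1 / (n + 1), 1], on which y^alpha / alpha
    is a primitive. *)
Let powR_part : (\int[mu]_(y in `]0%R, 1%R]) (y `^ (alpha - 1))%:E <= (alpha^-1)%:E)%E.
Proof.
have mpow D : measurable_fun D (fun y : R => (y `^ (alpha - 1))%:E).
  by apply: measurable_funTS; apply/measurable_EFinP; exact: measurable_powR.
have E : `]0, 1]%classic = \bigcup_n `[(n.+1%:R)^-1, 1]%classic :> set R.
  apply/seteqP; split => y /=; rewrite in_itv/=; last first.
    move=> [n _]; rewrite /= in_itv/= => /andP[ny ->]; rewrite andbT.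
    by apply: lt_le_trans ny; rewrite invr_gt0.
  move=> /andP[y0 y1].
    have [k k0 ky] := ex_nat_ge (y^-1).
    exists k => //=; rewrite in_itv/= y1 andbT.
    rewrite -[leRHS]invrK lef_pV2 ?posrE ?invr_gt0//.
    by rewrite (le_trans ky)// ler_nat.
pose F (n : nat) : set (measurableTypeR R) := `[(n.+1%:R)^-1, 1]%classic.
have nd : nondecreasing_seq F.
  apply/nondecreasing_seqP => n; apply/subsetPset => y; rewrite /F/= !in_itv/= => /andP[ny ->].
  by rewrite andbT (le_trans _ ny)// lef_pV2 ?posrE// ler_nat.
have mF n : measurable (F n) by exact: measurable_itv.
have h := ge0_nondecreasing_set_cvg_integral (mu := mu) nd mF (fun n => mpow (F n))
  (fun n y _ => powR_ge0 y (alpha - 1)).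
rewrite E.
rewrite -(cvg_lim _ h)//; apply: lime_le; first by apply/cvg_ex; eexists; exact: h.
apply: nearW => n.
have n0 : 0 < n.+1%:R^-1 :> R by rewrite invr_gt0.
have [n1|n1] := ltP (n.+1%:R^-1 : R) 1; last first.
  rewrite (@integral_Sset1 R _ _ 1) ?lee_fin ?invr_ge0 ?ltW//.
  move=> y; rewrite /F/= in_itv/= => /andP[y1 y2]; apply/eqP; rewrite eq_le y2/=.
  exact: le_trans y1.
rewrite (@continuous_FTC2 _ _ (fun y => y `^ alpha / alpha) _ _ n1).
- rewrite -EFinB lee_fin powR1/= div1r gerBl divr_ge0 ?powR_ge0 ?ltW//.
- apply: derivable_within_continuous => y; rewrite in_itv/= => /andP[y1 _].
  by apply: derivable_powR; rewrite in_itv/= andbT; exact: lt_le_trans y1.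
- have cF (y : R) : 0 < y -> {for y, continuous (fun y : R => y `^ alpha / alpha)}.
    move=> y0; apply: differentiable_continuous; apply/derivable1_diffP.
    by have [] := is_derive_powRa y0.
  split.
  + move=> y; rewrite in_itv/= => /andP[y1 _].
    by have [] := is_derive_powRa (lt_trans n0 y1).
  + by apply: cvg_at_right_filter; exact: cF.
  + by apply: cvg_at_left_filter; exact: cF.
- move=> y; rewrite in_itv/= => /andP[y1 _]; apply: derive1_val.
  exact: is_derive_powRa (lt_trans n0 y1).
Qed.

Let expR_part : (\int[mu]_(y in `[1%R, +oo[) (expR (- y))%:E <= 1%:E)%E.
Proof.
have dF (y : R) : is_derive y 1 (fun y => - expR (- y)) (expR (- y)).
  apply: (is_derive_eq (is_deriveNf (is_derive_expRf (is_deriveNf (is_derive_id y 1))))).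
  by rewrite mulN1r opprK.
rewrite (@ge0_continuous_FTC2y _ _ (fun y => - expR (- y)) 1 0).
- by rewrite -EFinB lee_fin sub0r opprK expR_le1 lerN10.
- by move=> y _; exact: expR_ge0.
- apply: continuous_subspaceT => y.
  by apply: continuous_comp; [exact: continuousN|exact: continuous_expR].
- by rewrite -[X in _ --> X]oppr0; apply: cvgN; exact: cvgr_expR.
- by move=> y _; have [] := dF y.
- have c1 : {for (1 : R), continuous (fun y : R => - expR (- y))}.
    apply: differentiable_continuous; apply/derivable1_diffP.
    by have [] := dF 1.
  by apply: cvg_at_right_filter; exact: c1.
- by move=> y _; exact: derive1_val.
Qed.

Lemma gam_int_lty : (\int[mu]_y (gam y)%:E < +oo)%E.
Proof.
have mg D : measurable_fun D (EFin \o gam).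
  by apply: measurable_funTS; apply/measurable_EFinP; exact: measurable_gam.
have g0 y : (0 <= (gam y)%:E)%E by rewrite lee_fin gam_ge0.
have mexp D : measurable_fun D (fun y : R => (expR (- y))%:E).
  apply/measurable_EFinP; have := @measurable_expRN R 1 D.
  by under eq_fun do rewrite mul1r.
have mpow D : measurable_fun D (fun y : R => (y `^ (alpha - 1))%:E).
  by apply: measurable_funTS; apply/measurable_EFinP; exact: measurable_powR.
have -> : (\int[mu]_y (gam y)%:E = \int[mu]_(y in `]0%R, 1%R] `|` `]1%R, +oo[) (gam y)%:E)%E.
  rewrite integral_mkcond [RHS]integral_mkcond; apply: eq_integral => y _.
  rewrite !patchE mem_set//; case: ifPn => // yn.
  rewrite /gam; case: ifPn => // y0; case: (negP yn); rewrite inE/=.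
  by have [y1|y1] := leP y 1; [left|right]; rewrite in_itv/= ?y0 ?y1.
rewrite ge0_integral_setU; [|exact: measurable_itv|exact: measurable_itv|exact: mg|by []|]; last first.
  apply/disj_setPS => y []; rewrite /= !in_itv/= => /andP[_ y1]; rewrite andbT.
  by rewrite ltNge y1.
apply: (@le_lt_trans _ _ ((alpha^-1)%:E + 1%:E)%E); last by rewrite -EFinD ltry.
apply: leeD.
  apply: le_trans powR_part; apply: ge0_le_integral; [exact: measurable_itv|by []|exact: mg|exact: mpow|].
  move=> y /=; rewrite in_itv/= => /andP[y0 _]; rewrite lee_fin /gam y0.
  by rewrite ler_piMr ?powR_ge0// expR_le1 oppr_le0 ltW.
apply: le_trans expR_part; rewrite integral_itv_obnd_cbnd; last exact: mg.
apply: ge0_le_integral; [exact: measurable_itv|by []|exact: mg|exact: mexp|].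
move=> y /=; rewrite in_itv/= andbT => y1; rewrite lee_fin /gam (lt_le_trans ltr01 y1).
rewrite ler_piMl ?expR_ge0//.
by apply: (le_trans (powR_dec ltr01 y1)); rewrite powR1.
Qed.

Let igam : mu.-integrable setT (EFin \o gam).
Proof.
apply/integrableP; split; first by apply/measurable_EFinP; exact: measurable_gam.
under eq_integral do rewrite /= (ger0_norm (gam_ge0 _)).
exact: gam_int_lty.
Qed.

Lemma Gamma_gt0 : 0 < Gamma alpha.
Proof.
have m12 : measurable (`]1%R, 2%R[%classic : set R) by exact: measurable_itv.
have -> : Gamma alpha = \int[mu]_y gam y by exact: GammaE.
pose c : R := 2 `^ (alpha - 1) * expR (- 2).
have c0 : 0 < c by rewrite mulr_gt0 ?powR_gt0 ?expR_gt0.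
apply: (lt_le_trans c0).
have ic : mu.-integrable `]1%R, 2%R[ (EFin \o cst c).
  apply: (@fin_meas_itg _ _ _ mu _ m12 _ c) => //.
    by have := ltry (2 - 1 : R); rewrite -(@mu_itv_oo R 1 2)//; rewrite ler1n.
  by move=> y _; rewrite ger0_norm ?(ltW c0).
have -> : c = \int[mu]_(y in `]1%R, 2%R[) cst c y.
  rewrite Rintegral_cst// (_ : fine _ = 1) ?mulr1//.
  transitivity (fine (2 - 1 : R)%:E); last by rewrite /=; ring.
  by congr fine; apply: mu_itv_oo; rewrite ler1n.
rewrite Rintegral_mkcond; apply: le_Rintegral => //.
  by move/integrable_mkcond : ic => /(_ m12); rewrite -restrict_EFin.
move=> y _; rewrite patchE; case: ifPn => [|_]; last exact: gam_ge0.
rewrite inE/= in_itv/= => /andP[y1 y2]; rewrite /gam (lt_trans ltr01 y1).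
apply: ler_pM; rewrite ?powR_ge0 ?expR_ge0//; last by rewrite ler_expR lerN2 ltW.
by apply: powR_dec; [exact: lt_trans y1|exact: ltW].
Qed.

(** Translating the tail to the origin and applying [gam_shift] bounds it by e^(- b) times the full
    integral. With b = s (T - tau) this is the origin of the truncation error e^(- s T). *)
Lemma gam_tail (b : R) : 0 <= b ->
  0 <= Gamma alpha - \int[mu]_y (if y < b then gam y else 0) <= expR (- b) * Gamma alpha.
Proof.
move=> b0; have -> : Gamma alpha = \int[mu]_y gam y by exact: GammaE.
have mlt : measurable_fun setT (fun y : R => y < b) by exact: measurable_fun_ltr.
pose g1 y := if y < b then 0 else gam y.
have mg1 : measurable_fun setT g1.
  by apply: measurable_fun_ifT => //; exact: measurable_gam.
have i1 : mu.-integrable setT (EFin \o (fun y => if y < b then gam y else 0)).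
  apply: (@itg_le _ _ _ mu setT measurableT _ gam) => //.
    by apply: measurable_fun_ifT => //; exact: measurable_gam.
  by move=> y _; case: ifP => _; rewrite ?normr0 ?gam_ge0 ?ger0_norm ?gam_ge0.
have i2 : mu.-integrable setT (EFin \o g1).
  apply: (@itg_le _ _ _ mu setT measurableT _ gam) => //.
  by move=> y _; rewrite /g1; case: ifP => _; rewrite ?normr0 ?gam_ge0 ?ger0_norm ?gam_ge0.
rewrite -RintegralB// (_ : (fun y => _) = g1); last first.
  by apply/funext => y; rewrite /g1; case: ifP => _; rewrite ?subrr ?subr0.
have g10 y : 0 <= g1 y by rewrite /g1; case: ifP => // _; exact: gam_ge0.
have -> : 0 <= \int[mu]_x g1 x by apply: Rintegral_ge0 => y _.
have i3 := @itgZ _ _ _ mu setT measurableT (expR (- b)) _ igam.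
rewrite -RintegralZl//.
rewrite /Rintegral; apply: fine_le; try by apply: integrable_fin_num.
rewrite (@ge0_integral_affine R 1 b ltr01); [|exact/measurable_EFinP|by move=> y; rewrite lee_fin].
rewrite mul1e; apply: le_nnintegral_ae => //.
- by move=> y _; rewrite lee_fin.
- by move=> y _; rewrite lee_fin mulr_ge0 ?expR_ge0 ?gam_ge0.
exists [set (0 : R)]; split; [exact: measurable_set1|exact: lebesgue_measure_set1|].
move=> y /= /not_implyP[_]; apply: contra_notP => y0; rewrite lee_fin mul1r /g1.
have [yb|yb] := ltP (y + b) b; first by rewrite mulr_ge0 ?expR_ge0 ?gam_ge0.
apply: gam_shift => //; rewrite lt_neqAle; move: yb; rewrite lerDr => ->; rewrite andbT.
by rewrite eq_sym; apply/eqP.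
Qed.

End GammaFacts.

(** * Exponential weights and the adjoint of the fractional integral *)

Section LaplaceKernel.
Context {R : realType}.
Local Notation mu := (@lebesgue_measure R).

(** Integrability is not assumed: if the positive or the negative part has infinite integral, both
    sides are 0 because [fine] sends infinite values to 0. The inner fractional integral needs this
    at exceptional times. *)
Lemma RintegralZl_gt0 (D : set R) (c : R) (f : R -> R) : measurable D -> 0 < c ->
  measurable_fun D f ->
  \int[mu]_(x in D) (c * f x) = c * \int[mu]_(x in D) f x.
Proof.
move=> mD c0 mf; have mf' : measurable_fun D (EFin \o f) by exact/measurable_EFinP.
rewrite /Rintegral; under eq_integral do rewrite EFinM.
rewrite integralE [in RHS]integralE ge0_funeposM ?ltW// ge0_funenegM ?ltW//.
rewrite ge0_integralZl_EFin//; [|exact: measurable_funepos|exact: ltW].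
rewrite ge0_integralZl_EFin//; [|exact: measurable_funeneg|exact: ltW].
have : (0 <= \int[mu]_(x in D) (EFin \o f)^\+ x)%E by apply: integral_ge0.
have : (0 <= \int[mu]_(x in D) (EFin \o f)^\- x)%E by apply: integral_ge0.
case: (integral _ _ _) => [x| |] //; case: (integral _ _ _) => [y| |] // _ _.
- by rewrite /= mulrBr.
- by rewrite gt0_muley ?lte_fin//= mulr0.
- by rewrite gt0_muley ?lte_fin//= mulr0.
- by rewrite gt0_muley ?lte_fin//= mulr0.
Qed.

(* The weight exp (- s t) is, up to the factor s^alpha and an error of size
   exp (- s T), reproduced by the adjoint of the fractional integral on (0, T). *)
Lemma laplace_kernel (alpha T s : R) : 0 < alpha -> alpha < 1 -> 0 < T -> 0 < s ->
  exists zeta : R -> R, [/\ measurable_fun setT zeta,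
    (forall tau, 0 < tau < T ->
      0 <= expR (- (s * tau)) - s `^ alpha * zeta tau <= expR (- (s * T))) &
    (forall G : R -> R, mu.-integrable `]0, T[ (EFin \o G) ->
      [/\ mu.-integrable `]0, T[ (EFin \o (fun t => expR (- (s * t)) * ((Gamma alpha)^-1 *
        \int[mu]_(tau in `]0, t[) ((t - tau) `^ (alpha - 1) * G tau)))),
      \int[mu]_(t in `]0, T[) (expR (- (s * t)) * ((Gamma alpha)^-1 *
        \int[mu]_(tau in `]0, t[) ((t - tau) `^ (alpha - 1) * G tau))) =
      \int[mu]_(tau in `]0, T[) (G tau * zeta tau) &
      \forall t \ae mu, t \in `]0, T[ ->
        mu.-integrable `]0, t[ (EFin \o (fun tau => (t - tau) `^ (alpha - 1) * G tau))])].
Proof.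
move=> a0 a1 T0 s0.
have mT : measurable (`]0, T[%classic : set R) by exact: measurable_itv.
have Gam0 := Gamma_gt0 a0 a1.
set g := (Gamma alpha)^-1; have g0 : 0 < g by rewrite invr_gt0.
(* The kernel of the fractional integral times the exponential weight, cut off at [T]; its integral
   over [t] is the adjoint applied to e^(- s t), and this is [zeta]. *)
pose kk (z : R * R) : R := if z.1 < z.2 then
   (if z.2 < T then g * ((z.2 - z.1) `^ (alpha - 1) * expR (- (s * z.2))) else 0) else 0.
have kk0 z : 0 <= kk z.
  rewrite /kk; case: ifP => // _; case: ifP => // _.
  by rewrite mulr_ge0 ?(ltW g0)// mulr_ge0 ?powR_ge0 ?expR_ge0.
have mkk : measurable_fun setT kk.
  apply: measurable_fun_ifT => //; first exact: measurable_fun_ltr.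
  apply: measurable_fun_ifT => //; first exact: measurable_fun_ltr.
  apply: measurable_funM => //; apply: measurable_funM.
    have mp : measurable_fun setT (fun x : R => x `^ (alpha - 1)) by exact: measurable_powR.
    have md : measurable_fun setT (fun z : R * R => z.2 - z.1) by exact: measurable_funB.
    exact: (measurableT_comp mp md).
  exact: (measurableT_comp (@measurable_expRN R s setT) measurable_snd).
pose zeta tau := \int[mu]_t kk (tau, t).
pose pp (b : R) := \int[mu]_y (if y < b then gam alpha y else 0).
have mgam := @measurable_gam R alpha.
have kkE tau t : kk (tau, t) = g * (expR (- (s * tau)) * s `^ (1 - alpha) *
    (if s * t + - (s * tau) < s * (T - tau) then gam alpha (s * t + - (s * tau)) else 0)).
  rewrite /kk /gam/= -mulrBr pmulr_rgt0// subr_gt0 ltr_pM2l// ltrD2r.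
  case: ifP => tt; last by case: ifP => _; rewrite !mulr0.
  case: ifP => tT; last by rewrite !mulr0.
  have tt0 : 0 <= t - tau by rewrite subr_ge0 ltW.
  rewrite powRM ?(ltW s0)//; congr (_ * _).
  rewrite (_ : expR (- (s * t)) = expR (- (s * tau)) * expR (- (s * (t - tau)))); last first.
    by rewrite -expRD; congr expR; ring.
  have e : s `^ (1 - alpha) * s `^ (alpha - 1) = 1.
    by rewrite -powRD ?(gt_eqF s0) ?implybT// addrA subrK subrr powRr0.
  transitivity ((s `^ (1 - alpha) * s `^ (alpha - 1)) * ((t - tau) `^ (alpha - 1) *
    (expR (- (s * tau)) * expR (- (s * (t - tau)))))); last by ring.
  by rewrite e mul1r.
have igb b : mu.-integrable setT (EFin \o (fun y => if y < b then gam alpha y else 0)).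
  have igam : mu.-integrable setT (EFin \o gam alpha).
    apply/integrableP; split; first by apply/measurable_EFinP; exact: measurable_gam.
    under eq_integral do rewrite /= (ger0_norm (gam_ge0 _ _)).
    exact: gam_int_lty.
  apply: (@itg_le _ _ _ mu setT measurableT _ (gam alpha)) => //.
    by apply: measurable_fun_ifT => //; exact: measurable_fun_ltr.
  by move=> y _; case: ifP => _; rewrite ?normr0 ?gam_ge0 ?ger0_norm ?gam_ge0.
(* The substitution y = s (t - tau) yields the incomplete Gamma integral [pp] at s (T - tau); a
   power of [s] drops from 1 - alpha to - alpha through the Jacobian. *)
have kkint tau : (\int[mu]_t (kk (tau, t))%:E =
    (g * (expR (- (s * tau)) * s `^ (- alpha)) * pp (s * (T - tau)))%:E)%E.
  have mif : measurable_fun setT (fun y : R => (if y < s * (T - tau) then gam alpha y else 0)%:E).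
    by apply/measurable_EFinP; exact: itg_meas (igb _).
  have if0 (y : R) : (0 <= (if y < s * (T - tau) then gam alpha y else 0)%:E)%E.
    by rewrite lee_fin; case: ifP => // _; exact: gam_ge0.
  have := ge0_integral_affine (- (s * tau)) s0 mif if0.
  rewrite -(fineK (integrable_fin_num measurableT (igb (s * (T - tau))))) -/(pp _) => e.
  under eq_integral do rewrite kkE !EFinM.
  have c0 : 0 <= expR (- (s * tau)) * s `^ (1 - alpha) by rewrite mulr_ge0 ?expR_ge0 ?powR_ge0.
  have maff : measurable_fun setT (fun x : R => (if s * x + - (s * tau) < s * (T - tau)
      then gam alpha (s * x + - (s * tau)) else 0)%:E).
    apply: (measurableT_comp mif (_ : measurable_fun setT (fun x : R => s * x + - (s * tau)))).
    apply: measurable_funD => //; exact: measurable_funM.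
  rewrite ge0_integralZl_EFin//; [| | |exact: ltW].
  - rewrite -EFinM ge0_integralZl_EFin//.
    have -> : s `^ (1 - alpha) = s `^ (- alpha) * s.
      by rewrite addrC powRD ?(gt_eqF s0) ?implybT// powRr1// ltW.
    rewrite mulrA !EFinM -!muleA; congr (_ * (_ * (_ * _)))%E.
    by rewrite -e.
  - by move=> x _; rewrite -EFinM mule_ge0// lee_fin.
  - by apply: measurable_funeM.
have zetaE tau : zeta tau = g * (expR (- (s * tau)) * s `^ (- alpha)) * pp (s * (T - tau)).
  by rewrite /zeta /Rintegral kkint.
have mzeta : measurable_fun setT zeta.
  have : measurable_fun setT (fun x : R => \int[mu]_t (kk (x, t))%:E)%E.
    apply: (@measurable_fun_fubini_tonelli_F _ _ _ _ _ mu (fun z => (kk z)%:E)) => //.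
    by apply/measurable_EFinP.
  by move=> h; apply: (measurableT_comp _ h).
have gG : g * Gamma alpha = 1 by rewrite /g mulVf// gt_eqF// Gamma_gt0.
clearbody g.
have zb tau : 0 < tau < T ->
    0 <= expR (- (s * tau)) - s `^ alpha * zeta tau <= expR (- (s * T)).
  move=> /andP[t0 tT]; have b0 : 0 <= s * (T - tau) by rewrite mulr_ge0 ?subr_ge0 ?ltW.
  have /andP[h1 h2] := gam_tail a0 a1 b0; rewrite -/(pp _) in h1 h2.
  have -> : expR (- (s * tau)) - s `^ alpha * zeta tau =
      expR (- (s * tau)) * (g * (Gamma alpha - pp (s * (T - tau)))).
    have e : s `^ alpha * s `^ (- alpha) = 1.
      by rewrite powRN mulfV// gt_eqF// powR_gt0.
    rewrite zetaE (mulrBr g) gG (mulrBr (expR _)) mulr1.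
    rewrite (_ : s `^ alpha * _ = (s `^ alpha * s `^ (- alpha)) * (expR (- (s * tau)) * (g * pp (s * (T - tau))))); last by ring.
    by rewrite e mul1r.
  rewrite !mulr_ge0 ?expR_ge0 ?(ltW g0)//=.
  have -> : expR (- (s * T)) = expR (- (s * tau)) * (g * (expR (- (s * (T - tau))) * Gamma alpha)).
    rewrite (mulrC (expR (- (s * (T - tau))))) (mulrA g) gG mul1r -expRD.
    by congr expR; ring.
  by rewrite ler_wpM2l ?expR_ge0// ler_wpM2l// ltW.
exists zeta; split => // G iG.
pose G0 := G \_ `]0, T[.
have iG0 : mu.-integrable setT (EFin \o G0).
  by move/integrable_mkcond : iG => /(_ mT); rewrite -restrict_EFin.
have mG0 := itg_meas iG0.
pose H (z : R * R) := G0 z.1 * kk z.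
have mH : measurable_fun setT H.
  by apply: measurable_funM => //; exact: (measurableT_comp mG0 measurable_fst).
have zeta0 tau : 0 <= zeta tau by apply: Rintegral_ge0 => t _.
have zle tau : 0 < tau < T -> zeta tau <= s `^ (- alpha).
  move=> tt; have /andP[h1 _] := zb _ tt.
  rewrite powRN -[leRHS]mul1r ler_pdivlMr ?powR_gt0// mulrC.
  have : expR (- (s * tau)) <= 1.
    by rewrite expR_le1 oppr_le0 mulr_ge0 ?(ltW s0)//; case/andP : tt => /ltW.
  by move: h1; lra.
have zetaD tau : zeta tau = \int[mu]_t kk (tau, t) by [].
have kkD x y : kk (x, y) = if x < y then if y < T then
    g * ((y - x) `^ (alpha - 1) * expR (- (s * y))) else 0 else 0 by [].
have HD x y : H (x, y) = G0 x * kk (x, y) by [].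
have Hint tau : (\int[mu]_t `|H (tau, t)|%:E = (`|G0 tau| * zeta tau)%:E)%E.
  rewrite /H /=; under eq_integral do rewrite normrM (ger0_norm (kk0 _)) EFinM.
  rewrite ge0_integralZl_EFin//.
  - by rewrite kkint -EFinM zetaE.
  - by move=> t _; rewrite lee_fin.
  - apply/measurable_EFinP; apply: (measurableT_comp mkk); exact: measurable_pair1.
have i1 : mu.-integrable setT (EFin \o (fun tau => s `^ (- alpha) * `|G0 tau|)).
  by apply: (@itgZ _ _ _ mu setT measurableT); exact: (@itg_norm _ _ _ mu setT).
have Hoo : (\int[mu]_tau \int[mu]_t `|H (tau, t)|%:E < +oo)%E.
  apply: (@le_lt_trans _ _ (\int[mu]_tau (s `^ (- alpha) * `|G0 tau|)%:E)%E); last first.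
    by rewrite -(fineK (integrable_fin_num measurableT i1)) ltry.
  apply: le_nnintegral_ae => //.
  - by move=> x _; apply: integral_ge0.
  - by move=> x _; rewrite lee_fin mulr_ge0 ?powR_ge0.
  apply: aeW => tau _; rewrite Hint lee_fin mulrC /G0 patchE.
  case: ifPn => [|_]; last by rewrite normr0 !mulr0.
  by rewrite inE/= in_itv/= => tt; rewrite ler_wpM2r// zle.
have [F1 F2 F3] := Rfubini mH Hoo.
clearbody pp kk zeta H.
have Hin t tau : 0 < t < T -> H (tau, t) = expR (- (s * t)) * g *
    ((fun tau => (t - tau) `^ (alpha - 1) * G tau) \_ `]0, t[) tau.
  move=> /andP[t0 tT]; rewrite HD kkD /G0/= tT !patchE; case: ifPn => [|taun].
    rewrite inE/= in_itv/= => /andP[tau0 tauT]; case: ifPn => [taut|].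
      have xt : tau \in (`]0, t[%classic : set R) by rewrite inE/= in_itv/= tau0 taut.
      rewrite xt.
      by move: (_ `^ _) (expR _) (G tau) => q1 q2 q3; ring.
    rewrite -leNgt => ttau; rewrite memNset ?mulr0//= in_itv/= => /andP[_].
    by rewrite ltNge ttau.
  rewrite mul0r memNset ?mulr0//= in_itv/= => /andP[tau0 taut]; move: taun.
  by rewrite notin_setE/= in_itv/= tau0 (lt_trans taut tT).
have inner t : \int[mu]_tau H (tau, t) = ((fun t => expR (- (s * t)) * (g *
    \int[mu]_(tau in `]0, t[) ((t - tau) `^ (alpha - 1) * G tau))) \_ `]0, T[) t.
  rewrite patchE; case: ifPn => [|tn].
    rewrite inE/= in_itv/= => /andP[t0 tT].
    have mt : measurable (`]0, t[%classic : set R) by exact: measurable_itv.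
    have mp : measurable_fun setT (fun x : R => x `^ (alpha - 1)) by exact: measurable_powR.
    have md : measurable_fun setT (fun z : R => t - z) by exact: measurable_funB.
    have mGt : measurable_fun `]0, t[ G.
      have sub : `]0, t[%classic `<=` `]0, T[%classic.
        by apply: subset_itvl; rewrite bnd_simp ltW.
      exact: (measurable_funS mT sub (itg_meas iG)).
    have mf : measurable_fun `]0, t[ (fun tau => (t - tau) `^ (alpha - 1) * G tau).
      have mq : measurable_fun `]0, t[ (fun tau => (t - tau) `^ (alpha - 1)).
        exact: (measurable_funTS (measurableT_comp mp md)).
      exact: (measurable_funM mq mGt).
    have eg0 : 0 < expR (- (s * t)) * g by rewrite mulr_gt0 ?expR_gt0.
    rewrite mulrA -(RintegralZl_gt0 mt eg0 mf).
    rewrite [RHS]Rintegral_mkcond; apply: eq_Rintegral => tau _.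
    rewrite Hin ?t0// !patchE; case: ifP => // _; exact: mulr0.
  rewrite (_ : (fun tau => _) = cst 0) ?Rintegral_cst ?mul0r//.
  apply/funext => tau; rewrite HD kkD /G0/= patchE; case: ifPn => [|_]; last by rewrite mul0r.
  rewrite inE/= in_itv/= => /andP[tau0 _]; case: ifPn => [taut|_]; last by rewrite mulr0.
  case: ifPn => [tT|_]; last by rewrite mulr0.
  by move: tn; rewrite notin_setE/= in_itv/= (lt_trans tau0 taut) tT.
have outer tau : \int[mu]_t H (tau, t) = ((fun tau => G tau * zeta tau) \_ `]0, T[) tau.
  under eq_Rintegral do rewrite HD.
  rewrite RintegralZl//.
    by rewrite -zetaD /G0 !patchE; case: ifP => //; rewrite mul0r.
  apply/integrableP; split.
    by apply/measurable_EFinP; apply: (measurableT_comp mkk); exact: measurable_pair1.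
  by under eq_integral do rewrite /= (ger0_norm (kk0 _)); rewrite kkint ltry.
split.
- apply/integrable_mkcond; first exact: mT.
  by rewrite restrict_EFin -(funext inner).
- rewrite Rintegral_mkcond [RHS]Rintegral_mkcond.
  by rewrite -(funext inner) -(funext outer).
(* Almost every section of an integrable function is integrable, and on a section the weight is a
   nonzero constant that can be divided out. *)
- have Hi : (mu \x mu)%E.-integrable setT (EFin \o H).
    by apply/integrable12ltyP => //; exact/measurable_EFinP.
  apply: aeS (ae_integrable2 Hi) => t ih.
  rewrite in_itv/= => tT; apply/integrable_mkcond; first exact: measurable_itv.
  have eg0 : expR (- (s * t)) * g != 0 by rewrite gt_eqF// mulr_gt0 ?expR_gt0.
  have := @itgZ _ _ _ mu setT measurableT (expR (- (s * t)) * g)^-1 _ ih.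
  apply: eq_integrable => // tau _; rewrite restrict_EFin /= Hin//.
  by rewrite mulrA mulVf// mul1r.
Qed.

End LaplaceKernel.

Section BoundedMeasurable.
Context {R : realType}.
Local Notation mu := (@lebesgue_measure R).
Local Notation I01 := (`]0, 1[%classic : set R).

(** These test functions, defined on the whole line, contain smooth test functions, their products
    with a bounded potential and indicators, and pair with every integrable density. *)
Definition bounded_meas (psi : R -> R) :=
  measurable_fun setT psi /\ exists C, forall x, `|psi x| <= C.

Lemma bounded_measD f g : bounded_meas f -> bounded_meas g ->
  bounded_meas (fun x => f x + g x).
Proof.
move=> [mf [C fC]] [mg [C' gC]]; split; first exact: measurable_funD.
by exists (C + C') => x; rewrite (le_trans (ler_normD _ _))// lerD.
Qed.

Lemma bounded_measM f g : bounded_meas f -> bounded_meas g ->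
  bounded_meas (fun x => f x * g x).
Proof.
move=> [mf [C fC]] [mg [C' gC]]; split; first exact: measurable_funM.
by exists (C * C') => x; rewrite normrM ler_pM.
Qed.

Lemma bounded_meas_cst c : bounded_meas (fun=> c : R).
Proof. by split => //; exists `|c|. Qed.

Lemma bounded_measZ c f : bounded_meas f -> bounded_meas (fun x => c * f x).
Proof. by move=> bf; apply: bounded_measM => //; exact: bounded_meas_cst. Qed.

Lemma bounded_measB f g : bounded_meas f -> bounded_meas g ->
  bounded_meas (fun x => f x - g x).
Proof.
move=> bf bg; apply: bounded_measD => //.
rewrite (_ : (fun x => - g x) = (fun x => -1 * g x)); first exact: bounded_measZ.
by apply/funext => x; rewrite mulN1r.
Qed.

Lemma norm_indic_le1 A (x : R) : `|\1_A x : R| <= 1.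
Proof. by rewrite indicE; case: (_ \in _); rewrite ?normr1 ?normr0. Qed.

Lemma bounded_meas_indic A : measurable A -> bounded_meas (\1_A : R -> R).
Proof.
move=> mA; split; first exact: measurable_indic.
by exists 1 => x; rewrite indicE; case: (_ \in _); rewrite ?normr1 ?normr0.
Qed.

Lemma bounded_meas_sum I (s : seq I) (F : I -> R -> R) :
  (forall i, bounded_meas (F i)) -> bounded_meas (fun x => \sum_(i <- s) F i x).
Proof.
move=> bF; elim: s => [|i s IH].
  by under eq_fun do rewrite big_nil; exact: bounded_meas_cst.
by under eq_fun do rewrite big_cons; exact: bounded_measD.
Qed.

Lemma I01_itg_bm psi : bounded_meas psi -> mu.-integrable I01 (EFin \o psi).
Proof. by move=> [mpsi [C psiC]]; apply: (@itg_I01_bdd _ _ C) => //; exact: measurable_funTS. Qed.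

End BoundedMeasurable.

(* A functional on bounded measurable functions that is continuous for the
   L^2 norm is an L^1 density; Radon-Nikodym replaces the Riesz theorem. *)
Section Density.
Context {R : realType}.
Local Notation mu := (@lebesgue_measure R).
Local Notation I01 := (`]0, 1[%classic : set R).
Variables (V : (R -> R) -> R) (N : R).
Hypothesis N0 : 0 <= N.
Hypothesis VD : forall f g, bounded_meas f -> bounded_meas g ->
  V (fun x => f x + g x) = V f + V g.
Hypothesis VZ : forall c f, bounded_meas f -> V (fun x => c * f x) = c * V f.
Hypothesis Vbound : forall f S, bounded_meas f -> 0 < S ->
  \int[mu]_(x in I01) (f x ^+ 2) <= S ^+ 2 -> `|V f| <= S * N.

Let mI : measurable I01. Proof. exact: measurable_itv. Qed.

(** Bounded pointwise convergence implies convergence in L^2, for which [V] is continuous. Countable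
    additivity, absolute continuity and the passage from simple to general functions all rest on
    this. *)
Let V_cvg0 (f : nat -> R -> R) C : (forall n, bounded_meas (f n)) ->
  (forall n x, `|f n x| <= C) ->
  (\forall x \ae mu, I01 x -> f n x @[n --> \oo] --> 0) ->
  V (f n) @[n --> \oo] --> 0.
Proof.
move=> bf fC f0.
have c0 : (\int[mu]_(x in I01) (f n x ^+ 2)) @[n --> \oo] --> (0 : R).
  have [|||||_] := @Rint_dominated _ _ _ mu I01 mI (fun n x => f n x ^+ 2) (fun=> 0) (fun=> C ^+ 2).
  - by move=> n; apply: measurable_funX; apply: measurable_funTS; case: (bf n).
  - by [].
  - apply: aeS f0 => x f0 Ix.
    by have := cvgM (f0 Ix) (f0 Ix); rewrite mulr0; exact.
  - by apply: I01_itg_bm; exact: bounded_meas_cst.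
  - by move=> n x _; rewrite normrX lerXn2r ?nnegrE// (le_trans _ (fC n x)).
  - by rewrite Rintegral_cst// mul0r.
apply/cvgrPdist_lt => e e0.
(* Dividing by N + 1 instead of N gives S * N < e also when N = 0. *)
pose S := e / (N + 1).
  have N1 : 0 < N + 1 by rewrite ltr_wpDl.
  have S0 : 0 < S by rewrite divr_gt0.
  have /cvgrPdist_lt/(_ (S ^+ 2)) := c0.
  rewrite exprn_gt0// => /(_ isT); apply: filterS => n.
  rewrite sub0r normrN => h; rewrite sub0r normrN.
  apply: (@le_lt_trans _ _ (S * N)).
    by apply: Vbound => //; rewrite (le_trans (ler_norm _))// ltW.
  by rewrite /S mulrAC ltr_pdivrMr// ltr_pM2l// ltrDl.
Qed.

(** The constant sequence f - g is 0 almost everywhere, so the previous continuity forces its value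
    under [V] to be 0. *)
Let V_eq f g : bounded_meas f -> bounded_meas g ->
  (\forall x \ae mu, I01 x -> f x = g x) -> V f = V g.
Proof.
move=> bf bg fg; have bfg := bounded_measB bf bg.
have -> : f = (fun x => g x + (f x - g x)) by apply/funext => x; rewrite addrC subrK.
rewrite VD//; suff -> : V (fun x => f x - g x) = 0 by rewrite addr0.
apply: (@cvg_unique _ _ (V (fun x => f x - g x) @[_ --> \oo])) => //.
  exact: cvg_cst.
have [C fgC] := bfg.2.
apply: (V_cvg0 (C := C)) => //.
by apply: aeS fg => x fg Ix; rewrite fg// subrr; exact: cvg_cst.
Qed.

Let nu (A : set (measurableTypeR R)) : \bar R := (V \1_A)%:E.

Let nu0 : nu set0 = 0%E.
Proof.
rewrite /nu indic0; congr EFin; rewrite (_ : cst 0 = (fun x : R => 0 * cst 0 x)).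
  by rewrite VZ ?mul0r//; exact: bounded_meas_cst.
by apply/funext => x; rewrite mul0r.
Qed.

Let nu_fin A : measurable A -> nu A \is a fin_num. Proof. by []. Qed.

Let V_sum I (s : seq I) (F : I -> R -> R) : (forall i, bounded_meas (F i)) ->
  V (fun x => \sum_(i <- s) F i x) = \sum_(i <- s) V (F i).
Proof.
move=> bF; elim: s => [|i s IH].
  rewrite big_nil (_ : (fun _ => _) = \1_set0); first by case: nu0.
  by apply/funext => x; rewrite big_nil indic0.
under eq_fun do rewrite big_cons.
by rewrite big_cons VD ?IH//; exact: bounded_meas_sum.
Qed.

Let nu_sigma : semi_sigma_additive nu.
Proof.
move=> F mF tF mUF; rewrite /nu.
under eq_cvg do rewrite sumEFin.
apply: cvg_EFin; first by near=> n.
(* By disjointness this is the indicator of the union of the [F i] with i >= n, which tends to 0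
   pointwise. *)
pose f n x : R := \1_(\bigcup_n F n) x - \sum_(0 <= i < n) \1_(F i) x.
have bs n : bounded_meas (fun x => \sum_(0 <= i < n) (\1_(F i) x : R)).
  by apply: bounded_meas_sum => i; apply: bounded_meas_indic; exact: (mF i).
have bU := bounded_meas_indic (R := R) mUF.
have fE x : (forall n, f n x = 0) \/ exists j, forall n, f n x = (n <= j)%:R.
  have [[j Fj]|nF] := pselect (exists j, F j x); last first.
    left => n; rewrite /f indicE memNset ?big1 ?subrr// => [i _|[i _ Fi]].
      by rewrite indicE memNset// => Fi; apply: nF; exists i.
    by apply: nF; exists i.
  right; exists j => n.
  have iF i : \1_(F i) x = (i == j)%:R :> R.
    rewrite indicE; case: eqP => [->|ij]; first by rewrite mem_set.
    by rewrite memNset// => Fi; apply: ij; apply: (tF i j) => //; exists x.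
  have -> : f n x = 1 - (j < n)%:R.
    rewrite /f indicE mem_set; last by exists j.
    congr (_ - _); elim: n => [|n IH]; first by rewrite big_nil.
    rewrite big_nat_recr//= IH iF -natrD ltnS; congr (_%:R).
    by case: ltngtP.
  by rewrite ltnNge; case: leqP => _; rewrite ?subr0 ?subrr.
have f1 n x : `|f n x| <= 1.
  have [->|[j ->]] := fE x; first by rewrite normr0.
  by case: (_ <= _)%N; rewrite ?normr0 ?normr1.
have f0 : \forall x \ae mu, I01 x -> f n x @[n --> \oo] --> 0.
  apply: aeW => x _; have [h|[j h]] := fE x; first by under eq_cvg do rewrite h; exact: cvg_cst.
  apply: cvg_near_cst; exists j.+1 => // n /= jn.
  by apply/eqP; rewrite h leqNgt jn.
have bf n : bounded_meas (f n) by apply: bounded_measB.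
have Vf := V_cvg0 bf f1 f0.
have VfE n : V (\1_(\bigcup_n F n)) - V (f n) = \sum_(0 <= i < n) V \1_(F i).
  rewrite -V_sum; last by move=> i; apply: bounded_meas_indic; exact: (mF i).
  apply/eqP; rewrite subr_eq -VD//; apply/eqP; congr V.
  by apply/funext => x; rewrite /f addrC subrK.
rewrite (_ : fine \o _ = (fun n => V (\1_(\bigcup_n F n)) - V (f n))); last first.
  by apply/funext => n; rewrite VfE.
rewrite -[X in _ --> X]subr0; apply: cvgB => //; exact: cvg_cst.
Unshelve. all: by end_near. Qed.

HB.instance Definition _ := isCharge.Build _ _ _ nu nu0 nu_fin nu_sigma.

Let nu_dom : nu `<< mu.
Proof.
apply/null_content_dominatesP => A mA A0; congr EFin.
transitivity (V \1_set0); last by case: nu0.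
apply: V_eq; [exact: bounded_meas_indic|exact: bounded_meas_indic|].
exists A; split => // x /= xA; apply: contrapT => nA; apply: xA => _.
by rewrite indic0 indicE memNset.
Qed.

Let w x := fine (Radon_Nikodym nu mu x).

Let w_itgT : mu.-integrable setT (EFin \o w).
Proof.
apply: eq_integrable (Radon_Nikodym_integrable nu_dom) => // x _ /=.
by rewrite fineK// Radon_Nikodym_fin_num.
Qed.

Let w_itg : mu.-integrable I01 (EFin \o w).
Proof. by apply: integrableS w_itgT. Qed.

Let V_indic A : measurable A -> V \1_A = \int[mu]_(x in I01) (w x * \1_A x).
Proof.
move=> mA; have mAI : measurable (I01 `&` A) by exact: measurableI.
transitivity (V \1_(I01 `&` A)).
  apply: V_eq; [exact: (bounded_meas_indic mA)|exact: (bounded_meas_indic mAI)|].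
  by apply: aeW => x Ix; rewrite !indicE in_setI (mem_set Ix).
apply/EFin_inj; transitivity (nu (I01 `&` A)) => //.
rewrite (Radon_Nikodym_integral nu_dom mAI).
have iA : mu.-integrable I01 (EFin \o (fun x => w x * \1_A x)).
  apply: (@itgM_bdd _ _ _ mu I01 mI w (\1_A) 1 w_itg) => //.
  by move=> x _; rewrite indicE; case: (_ \in _); rewrite ?normr1 ?normr0.
rewrite /Rintegral fineK; last exact: integrable_fin_num.
rewrite integral_mkcondr; apply: eq_integral => x _.
rewrite patchE indicE /w; case: ifPn => _; last by rewrite mulr0.
by rewrite mulr1 fineK// Radon_Nikodym_fin_num.
Qed.

Import HBNNSimple.

(** On simple functions the identity follows from indicators by linearity; both sides are continuous
    along an increasing simple approximation bounded by [C]. *)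
Let V_ge0 f : bounded_meas f -> (forall x, 0 <= f x) -> V f = \int[mu]_(x in I01) (w x * f x).
Proof.
move=> bf f0; have [mf [C fC]] := bf.
have mEf : measurable_fun setT (EFin \o f) by exact/measurable_EFinP.
pose h := nnsfun_approx measurableT mEf.
have hcvg x : h n x @[n --> \oo] --> f x.
  have := @cvg_nnsfun_approx _ _ _ setT measurableT (EFin \o f) mEf _ x I.
  move=> /(_ (fun x _ => f0 x)); exact: fine_cvg.
have hf n x : h n x <= f x.
  have nd := @nd_nnsfun_approx _ _ _ setT measurableT (EFin \o f) mEf.
  have cx : cvgn (h ^~ x) by apply/cvg_ex; exists (f x); exact: hcvg.
  rewrite -(cvg_lim _ (hcvg x))//; apply: nondecreasing_cvgn_le => //.
  by move=> m k mk; have /lefP := nd _ _ mk; exact.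
have hb n x : `|h n x| <= C.
  by rewrite ger0_norm// (le_trans (hf n x))// (le_trans (ler_norm _)).
have bh n : bounded_meas (h n) by split; [exact: measurable_funP|exists C].
have Vh n : V (h n) = \int[mu]_(x in I01) (w x * h n x).
  have fr : finite_set (range (h n)) by exact: fimfunP.
  have hE : (h n : R -> R) = (fun x => \sum_(y <- finmap.enum_fset (fset_set (range (h n)))) y * \1_(h n @^-1` [set y]) x).
    by apply/funext => x; rewrite [LHS]fimfunE fsbig_finite.
  have mp y : measurable (h n @^-1` [set y]) by exact: measurable_sfunP.
  rewrite [in LHS]hE V_sum; last first.
    by move=> y; apply: bounded_measZ; exact: bounded_meas_indic.
  under eq_Rintegral => x _ do rewrite hE mulr_sumr.
  rewrite Rint_sum//; last first.
    move=> y _; apply: (@itgM_bdd _ _ _ mu I01 mI w (fun x => y * \1_(h n @^-1` [set y]) x) `|y| w_itg) => //.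
      by apply: measurable_funM => //; exact: measurable_funTS (bounded_meas_indic (mp y)).1.
    by move=> x _; rewrite indicE; case: (_ \in _); rewrite ?mulr1 ?mulr0 ?normr0.
  apply: eq_bigr => y _; rewrite VZ; last exact: bounded_meas_indic.
  have iy : mu.-integrable I01 (EFin \o (fun x => w x * \1_(h n @^-1` [set y]) x)).
    apply: (@itgM_bdd _ _ _ mu I01 mI w (\1_(h n @^-1` [set y])) 1 w_itg _ (fun x _ => norm_indic_le1 _ x)).
    exact: measurable_funTS (bounded_meas_indic (mp y)).1.
  rewrite V_indic// -RintegralZl//.
  by apply: eq_Rintegral => x _; rewrite mulrCA.
have c1 : V (h n) @[n --> \oo] --> V f.
  have := @V_cvg0 (fun n x => f x - h n x) C (fun n => bounded_measB bf (bh n)).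
  have b n x : `|f x - h n x| <= C.
    rewrite ger0_norm ?subr_ge0// (le_trans _ (fC x))// (le_trans _ (ler_norm _))//.
    by rewrite gerBl.
  have z : \forall x \ae mu, I01 x -> (f x - h n x) @[n --> \oo] --> 0.
    apply: aeW => x _; rewrite -(subrr (f x)); apply: cvgB; first exact: cvg_cst.
    exact: hcvg.
  move=> /(_ b z) {}z.
  rewrite -[X in _ --> X]subr0.
  rewrite (_ : (fun n => V (h n)) = (fun n => V f - V (fun x => f x - h n x))).
    by apply: cvgB => //; exact: cvg_cst.
  apply/funext => n; apply/eqP; rewrite eq_sym subr_eq -VD//; last exact: bounded_measB.
  by apply/eqP; congr V; apply/funext => x; rewrite addrC subrK.
have c2 : \int[mu]_(x in I01) (w x * h n x) @[n --> \oo] --> \int[mu]_(x in I01) (w x * f x).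
  apply: (proj2 (@Rint_dominated _ _ _ mu I01 mI (fun n x => w x * h n x) (fun x => w x * f x)
    (fun x => C * `|w x|) _ _ _ _ _)).
  - move=> n; apply: measurable_funM; first exact: itg_meas w_itg.
    exact: measurable_funTS (bh n).1.
  - by apply: measurable_funM; [exact: itg_meas w_itg|exact: measurable_funTS].
  - by apply: aeW => x _; apply: cvgMr; exact: hcvg.
  - by apply: (@itgZ _ _ _ mu I01 mI); exact: (@itg_norm _ _ _ mu I01).
  - by move=> n x _; rewrite normrM mulrC ler_wpM2r.
apply: cvg_unique c1 _ => //.
by rewrite (funext Vh).
Qed.

Let V_density f : bounded_meas f -> V f = \int[mu]_(x in I01) (w x * f x).
Proof.
move=> bf; have [mf [C fC]] := bf.
have bC := bounded_meas_cst `|C|.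
have b1 := bounded_measD bf bC.
have p1 : forall x, 0 <= f x + `|C|.
  move=> x; have := fC x; rewrite ler_norml => /andP[h _].
  by rewrite -lerBlDr sub0r (le_trans _ h)// lerN2 ler_norm.
have wb g : bounded_meas g -> mu.-integrable I01 (EFin \o (fun x => w x * g x)).
  move=> [mg [K gK]]; apply: (@itgM_bdd _ _ _ mu I01 mI w g K w_itg) => //.
  exact: measurable_funTS.
have := V_ge0 b1 p1; rewrite VD// (V_ge0 bC (fun=> normr_ge0 C)).
rewrite (_ : \int[mu]_(x in I01) (w x * (f x + `|C|)) =
    \int[mu]_(x in I01) (w x * f x + w x * `|C|)); last first.
  by apply: eq_Rintegral => x _; rewrite mulrDr.
by rewrite RintegralD ?wb// => /addIr.
Qed.

Lemma density : exists w, [/\ mu.-integrable I01 (EFin \o w),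
  forall f, bounded_meas f -> V f = \int[mu]_(x in I01) (w x * f x) &
  \int[mu]_(x in I01) `|w x| <= N].
Proof.
exists w; split => //.
(* The sign of the density has L^2 norm 1 on ]0, 1[; testing with it converts continuity of [V] into
   the L^1 bound. *)
pose sg (x : R) : R := if w x < 0 then -1 else 1.
have mw : measurable_fun setT w by exact: itg_meas w_itgT.
have sg2 x : sg x ^+ 2 = 1 by rewrite /sg; case: ifP; rewrite ?sqrrN expr1n.
have bsg : bounded_meas sg.
  split; first by apply: measurable_fun_ifT => //; exact: measurable_fun_ltr.
  by exists 1 => x; rewrite /sg; case: ifP; rewrite ?normrN1 ?normr1.
have := @Vbound sg 1 bsg ltr01.
under eq_Rintegral do rewrite sg2.
have e1 : fine (mu I01) = 1 by have := @mu_itv_oo R 0 1 ler01; rewrite subr0 => ->.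
rewrite Rintegral_cst// mul1r expr1n e1 lexx => /(_ isT).
rewrite mul1r V_density// => /(le_trans (ler_norm _)); apply: le_trans.
rewrite le_eqVlt; apply/orP; left; apply/eqP; apply: eq_Rintegral => x _.
rewrite /sg; case: ltP => x0; first by rewrite ltr0_norm// mulrN1.
by rewrite ger0_norm// mulr1.
Qed.

End Density.

(** * The scalar uniqueness theorem *)

Definition pairing {R : realType} (f psi : R -> R) :=
  \int[@lebesgue_measure R]_(x in `]0, 1[) (f x * psi x).

Section Pairing.
Context {R : realType}.
Local Notation mu := (@lebesgue_measure R).
Local Notation I01 := (`]0, 1[%classic : set R).
Implicit Types h f g : R -> R.

Let mI : measurable I01. Proof. exact: measurable_itv. Qed.

Lemma pairing_bm_itg h f : mu.-integrable I01 (EFin \o h) -> bounded_meas f ->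
  mu.-integrable I01 (EFin \o (fun x => h x * f x)).
Proof.
move=> ih [mf [C fC]].
by apply: (@itgM_bdd _ _ _ mu I01 mI _ _ C ih) => //; exact: measurable_funTS.
Qed.

Lemma pairingD h f g : mu.-integrable I01 (EFin \o h) -> bounded_meas f -> bounded_meas g ->
  pairing h (fun x => f x + g x) = pairing h f + pairing h g.
Proof.
move=> ih bf bg; rewrite /pairing -RintegralD//; [|exact: pairing_bm_itg..].
by apply: eq_Rintegral => x _; rewrite mulrDr.
Qed.

Lemma pairingZ h (r : R) f : mu.-integrable I01 (EFin \o h) -> bounded_meas f ->
  pairing h (fun x => r * f x) = r * pairing h f.
Proof.
move=> ih bf; rewrite /pairing -RintegralZl//; last exact: pairing_bm_itg.
by apply: eq_Rintegral => x _; rewrite mulrCA.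
Qed.

Lemma pairingB h f g : mu.-integrable I01 (EFin \o h) -> bounded_meas f -> bounded_meas g ->
  pairing h (fun x => f x - g x) = pairing h f - pairing h g.
Proof.
move=> ih bf bg; rewrite /pairing -RintegralB//; [|exact: pairing_bm_itg..].
by apply: eq_Rintegral => x _; rewrite mulrBr.
Qed.

Lemma pairing_indic h (l r : R) : 0 <= l -> r <= 1 ->
  pairing h \1_(`]l, r[) = \int[mu]_(x in `]l, r[) h x.
Proof.
move=> l0 r1; rewrite /pairing Rintegral_mkcond [RHS]Rintegral_mkcond.
apply: eq_Rintegral => x _; rewrite !patchE indicE.
case: (boolP (x \in `]l, r[%classic)) => xlr; last by rewrite mulr0 if_same.
rewrite mulr1 mem_set//; move: xlr; rewrite inE/= !in_itv/= => /andP[lx xr].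
by rewrite (le_lt_trans l0 lx) (lt_le_trans xr r1).
Qed.

Lemma bm_test phi (A B : R) : smooth phi -> csupp A B phi -> bounded_meas phi.
Proof. by move=> ps pc; split; [exact: smooth_measurable|exact: csupp_bounded pc]. Qed.

End Pairing.

Definition exp_mass {R : realType} (T s : R) :=
  \int[@lebesgue_measure R]_(t in `]0, T[) expR (- (s * t)).

(** * The equation after a truncated Laplace transform *)

Section Core.
Context {R : realType}.
Local Notation mu := (@lebesgue_measure R).
Local Notation I01 := (`]0, 1[%classic : set R).
Variables (alpha T c d P M : R) (p a : R -> R) (u : R -> R -> R).
Hypotheses (a0 : 0 < alpha) (a1 : alpha < 1) (T0 : 0 < T).
Hypotheses (c0 : 0 <= c) (cd : c < d) (d1 : d <= 1) (M0 : 0 <= M).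
Hypotheses (mp : measurable_fun setT p) (pP : forall x, `|p x| <= P).
Hypothesis ia : mu.-integrable I01 (EFin \o a).
Hypothesis iu : forall t, mu.-integrable I01 (EFin \o u t).
Hypothesis mu_pairing : forall f, bounded_meas f ->
  measurable_fun `]0, T[ (fun t => pairing (u t) f).
Hypothesis u_dom : forall f S, bounded_meas f -> 0 < S ->
  \int[mu]_(x in I01) (f x ^+ 2) <= S ^+ 2 ->
  (\int[mu]_(t in `]0%R, T[) `|pairing (u t) f|%:E <= (S * M)%:E)%E.
Hypothesis eqn : forall phi, smooth phi -> csupp 0 1 phi ->
  \forall t \ae mu, t \in `]0, T[ -> pairing (u t) phi - pairing a phi =
    (Gamma alpha)^-1 * \int[mu]_(tau in `]0, t[) ((t - tau) `^ (alpha - 1) *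
      (pairing (u tau) (derive1 (derive1 phi)) - pairing (u tau) (fun x => p x * phi x))).
Hypothesis u0 : forall t, \forall x \ae mu, x \in `]c, d[ -> u t x = 0.

Let mI : measurable I01. Proof. exact: measurable_itv. Qed.
Let mD : measurable (`]0, T[%classic : set R). Proof. exact: measurable_itv. Qed.

Let bm_p : bounded_meas p. Proof. by split => //; exists P. Qed.

Lemma pairing_itg f : bounded_meas f ->
  mu.-integrable `]0, T[ (EFin \o (fun t => pairing (u t) f)).
Proof.
move=> bf; have [mf [C fC]] := bf.
apply/integrableP; split; first by apply/measurable_EFinP; exact: mu_pairing.
have C0 : 0 <= C by apply: le_trans (fC 0).
have S0 : 0 < C + 1 by rewrite ltr_wpDl.
apply: (le_lt_trans (u_dom bf S0 _)); last exact: ltry.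
apply: (@le_trans _ _ (\int[mu]_(x in I01) ((C + 1) ^+ 2))).
  apply: le_Rintegral => //.
  - by apply: (I01_itg_bm (psi := fun x => f x ^+ 2)); under eq_fun do rewrite expr2; exact: bounded_measM.
  - by apply: I01_itg_bm; exact: bounded_meas_cst.
  move=> x _; rewrite -[f x ^+ 2]ger0_norm ?sqr_ge0// normrX lerXn2r ?nnegrE//.
    exact: ltW.
  by rewrite (le_trans (fC x))// lerDl.
have e1 : fine (mu I01) = 1 by have := @mu_itv_oo R 0 1 ler01; rewrite subr0 => ->.
by rewrite Rintegral_cst// e1 mulr1.
Qed.

Lemma weighted_itg (theta : R -> R) (B : R) f : measurable_fun `]0, T[ theta ->
  (forall t, 0 < t < T -> `|theta t| <= B) -> bounded_meas f ->
  mu.-integrable `]0, T[ (EFin \o (fun t => theta t * pairing (u t) f)).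
Proof.
move=> mth thB bf; have := @itgM_bdd _ _ _ mu _ mD _ _ B (pairing_itg bf) mth.
rewrite (_ : (fun t => theta t * _) = (fun t => pairing (u t) f * theta t)).
  by apply => t; rewrite /= in_itv/=; exact: thB.
by apply/funext => t; rewrite mulrC.
Qed.

(** A weighted time average of [u] as a function of [x], obtained by duality through [density]. No
    joint measurability of [u] in (t, x) is thereby required, and vanishing on ]c, d[ is checked
    against indicators of subintervals. *)
Lemma weighted_density (theta : R -> R) (B : R) : 0 < B -> measurable_fun `]0, T[ theta ->
  (forall t, 0 < t < T -> `|theta t| <= B) ->
  exists w, [/\ mu.-integrable I01 (EFin \o w),
    (forall f, bounded_meas f ->
      \int[mu]_(t in `]0, T[) (theta t * pairing (u t) f) = pairing w f),
    \int[mu]_(x in I01) `|w x| <= B * M &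
    \forall x \ae mu, x \in `]c, d[ -> w x = 0].
Proof.
move=> B0 mth thB.
have ith f (bf : bounded_meas f) := weighted_itg mth thB bf.
pose V f := \int[mu]_(t in `]0, T[) (theta t * pairing (u t) f).
have [||||w [iw wV wB]] := @density R V (B * M).
- by rewrite mulr_ge0// ltW.
- move=> f g bf bg; rewrite /V -RintegralD//; last 2 first.
    exact: ith.
    exact: ith.
  by apply: eq_Rintegral => t _; rewrite (pairingD (iu t))// mulrDr.
- move=> r f bf; rewrite /V -RintegralZl//; last exact: ith.
  by apply: eq_Rintegral => t _; rewrite (pairingZ r (iu t))// mulrCA.
- move=> f S bf S0 fS.
  apply: (@le_trans _ _ (\int[mu]_(t in `]0, T[) (B * `|pairing (u t) f|))).
    apply: le_Rint_norm => //; first exact: ith.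
      apply: (@itgZ _ _ _ mu _ mD); exact: (@itg_norm _ _ _ mu _ _ (pairing_itg bf)).
    by move=> t; rewrite /= in_itv/= => tT; rewrite normrM ler_wpM2r// thB.
  rewrite RintegralZl//; last exact: (@itg_norm _ _ _ mu _ _ (pairing_itg bf)).
  rewrite mulrCA ler_wpM2l ?(ltW B0)//.
  rewrite -lee_fin /Rintegral fineK ?u_dom//.
  apply: integrable_fin_num => //; exact: (@itg_norm _ _ _ mu _ _ (pairing_itg bf)).
exists w; split => //.
have scd : `]c, d[%classic `<=` I01.
  by apply: subset_itv; rewrite bnd_simp.
apply: ae_eq0_intervals; first exact: integrableS iw.
move=> l r cl lr rd.
have mlr : measurable (`]l, r[%classic : set R) by exact: measurable_itv.
have slr : `]l, r[%classic `<=` `]c, d[%classic.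
  by apply: subset_itv; rewrite bnd_simp ltW.
have bl := bounded_meas_indic mlr.
have pl (f : R -> R) : pairing f \1_(`]l, r[) = \int[mu]_(x in `]l, r[) f x.
  by apply: pairing_indic; [exact: ltW (le_lt_trans c0 cl)|exact: ltW (lt_le_trans rd d1)].
rewrite -pl -[LHS]wV// /V.
rewrite (_ : (fun t => _) = cst 0) ?Rintegral_cst ?mul0r//.
apply/funext => t; rewrite pl; suff -> : \int[mu]_(x in `]l, r[) u t x = 0 by rewrite mulr0.
transitivity (\int[mu]_(x in `]l, r[) (0 : R)); last by rewrite Rintegral_cst ?mul0r.
apply: Rint_ae_eq => //.
  apply: measurable_funS (itg_meas (iu t)) => //; exact: subset_trans slr scd.
by apply: aeS (u0 t) => x h xlr; apply: h; rewrite inE; apply: slr.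
Qed.

Local Notation bs := (exp_mass T).

Let exp_le1 s t : 0 < s -> 0 < t < T -> `|expR (- (s * t))| <= 1.
Proof.
move=> s0 /andP[t0 _]; rewrite ger0_norm ?expR_ge0// expR_le1 oppr_le0.
by rewrite mulr_ge0// ltW.
Qed.

Let itg_exp s : 0 < s -> mu.-integrable `]0, T[ (EFin \o (fun t => expR (- (s * t)))).
Proof.
move=> s0; apply: (@fin_meas_itg _ _ _ mu _ mD _ 1).
- by have := ltry (T - 0 : R); rewrite -(mu_itv_oo (ltW T0)).
- exact: measurable_expRN.
by move=> t; rewrite /= in_itv/= => tT; exact: exp_le1.
Qed.

(** Here [w] is the average with weight [zeta] and [rho] the one with weight e^(- s t) - s^alpha
    zeta. Integrating the equation against e^(- s t) and moving the fractional integral to the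
    weight turns its right-hand side into a pairing with [w]; the average of [u] itself is s^alpha w
    + rho. *)
Lemma laplace_reduction s : 0 < s ->
  exists w rho, [/\ mu.-integrable I01 (EFin \o w), mu.-integrable I01 (EFin \o rho),
    weak_sol (s `^ (alpha / 2)) w (fun x => p x * w x + rho x - bs s * a x),
    (\int[mu]_(x in I01) `|w x| <= s `^ (- alpha) * M) /\
    \int[mu]_(x in I01) `|rho x| <= expR (- (s * T)) * M &
    (\forall x \ae mu, x \in `]c, d[ -> w x = 0) /\
    forall f, bounded_meas f -> \int[mu]_(t in `]0, T[) (expR (- (s * t)) * pairing (u t) f) =
      s `^ alpha * pairing w f + pairing rho f].
Proof.
move=> s0; have [zeta [mz zb zL]] := laplace_kernel a0 a1 T0 s0.
have sa0 : 0 < s `^ alpha by exact: powR_gt0.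
have z1 t : 0 < t < T -> `|zeta t| <= s `^ (- alpha).
  move=> tT; have /andP[h1 h2] := zb _ tT.
  have : expR (- (s * T)) <= expR (- (s * t)) <= 1.
    have /andP[t0 tT'] := tT.
    rewrite ler_expR lerN2 ler_wpM2l ?(ltW s0) ?(ltW tT')//=.
    by rewrite (le_trans (ler_norm _))// exp_le1.
  move=> /andP[h3 h4]; have h5 : 0 <= s `^ alpha * zeta t by move: h2 h3; lra.
  have zt0 : 0 <= zeta t by move: h5; rewrite pmulr_rge0.
  rewrite ger0_norm// powRN -[leRHS]mul1r ler_pdivlMr// mulrC.
  by move: h1 h4; lra.
have z2 t : 0 < t < T -> `|expR (- (s * t)) - s `^ alpha * zeta t| <= expR (- (s * T)).
  by move=> tT; have /andP[h1 h2] := zb _ tT; rewrite ger0_norm.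
have mz1 : measurable_fun `]0, T[ zeta by exact: measurable_funTS.
have mz2 : measurable_fun `]0, T[ (fun t => expR (- (s * t)) - s `^ alpha * zeta t).
  by apply: measurable_funB; [exact: measurable_expRN|exact: measurable_funM].
have [w [iw wV wB w0]] := weighted_density (powR_gt0 (- alpha) s0) mz1 z1.
have [rho [irho rV rB _]] := weighted_density (expR_gt0 _) mz2 z2.
have L f : bounded_meas f -> \int[mu]_(t in `]0, T[) (expR (- (s * t)) * pairing (u t) f) =
      s `^ alpha * pairing w f + pairing rho f.
  move=> bf; rewrite -wV// -rV//.
  have i1 := weighted_itg mz1 z1 bf; have i2 := weighted_itg mz2 z2 bf.
  rewrite -RintegralZl// -RintegralD//; last exact: (@itgZ _ _ _ mu _ mD).
  by apply: eq_Rintegral => t _; ring.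
exists w, rho; split => //.
move=> phi ps pc.
have bphi := bm_test ps pc.
have b2 : bounded_meas (derive1 (derive1 phi)).
  apply: (@bm_test _ _ 0 1); first by do 2 apply: smooth_derive1.
  by do 2 apply: csupp_derive1.
have bp := bounded_measM bm_p bphi.
transitivity (pairing w (derive1 (derive1 phi)) - s `^ alpha * pairing w phi).
  rewrite -(pairingZ _ iw bphi) -(pairingB iw b2 (bounded_measZ _ bphi)).
  apply: eq_Rintegral => x _; congr (_ * (_ - _ * _)).
  by rewrite -powR_mulrn ?powR_ge0// -powRrM divfK.
transitivity (pairing w (fun x => p x * phi x) + pairing rho phi - bs s * pairing a phi).
  pose G t := pairing (u t) (derive1 (derive1 phi)) - pairing (u t) (fun x => p x * phi x).
  have iG : mu.-integrable `]0, T[ (EFin \o G).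
    by apply: (@itgB _ _ _ mu _ mD); exact: pairing_itg.
  have [j1 j2 _] := zL _ iG.
  have i3 := weighted_itg mz1 z1 b2; have i4 := weighted_itg mz1 z1 bp.
  have e1 : \int[mu]_(t in `]0, T[) (G t * zeta t) =
      pairing w (derive1 (derive1 phi)) - pairing w (fun x => p x * phi x).
    rewrite -!wV// -RintegralB//; apply: eq_Rintegral => t _.
    by rewrite /G mulrC mulrBr.
  have ie : mu.-integrable `]0, T[ (EFin \o (fun t => expR (- (s * t)) * pairing (u t) phi)).
    by apply: (@weighted_itg _ 1) => //; [exact: measurable_expRN|move=> t; exact: exp_le1].
  have iea : mu.-integrable `]0, T[ (EFin \o (fun t => pairing a phi * expR (- (s * t)))).
    by apply: (@itgZ _ _ _ mu _ mD); exact: itg_exp.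
  have e2 : \int[mu]_(t in `]0, T[) (expR (- (s * t)) * ((Gamma alpha)^-1 *
      \int[mu]_(tau in `]0, t[) ((t - tau) `^ (alpha - 1) * G tau))) =
      \int[mu]_(t in `]0, T[) (expR (- (s * t)) * pairing (u t) phi - pairing a phi * expR (- (s * t))).
    apply: Rint_ae_eq => //; first exact: itg_meas j1.
      by apply: itg_meas; exact: (@itgB _ _ _ mu _ mD).
    apply: aeS (eqn ps pc) => t h tT; rewrite -h; last by rewrite inE.
    by ring.
  have ies := itg_exp s0.
  have := j2; rewrite e1 e2 RintegralB// L// RintegralZl// -/(exp_mass T s) => h.
  by move: h; lra.
have ipw : mu.-integrable I01 (EFin \o (fun x => w x * (p x * phi x))) by exact: pairing_bm_itg.
have ir : mu.-integrable I01 (EFin \o (fun x => rho x * phi x)) by exact: pairing_bm_itg.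
have ipa : mu.-integrable I01 (EFin \o (fun x => a x * phi x)) by exact: pairing_bm_itg.
rewrite /pairing -RintegralD// -RintegralZl// -RintegralB//; last 2 first.
  exact: (@itgD _ _ _ mu _ mI).
  exact: (@itgZ _ _ _ mu _ mI).
by apply: eq_Rintegral => x _; ring.
Qed.

End Core.

Section Growth.
Context {R : realType}.
Implicit Types (x e : R).

Lemma le_expR_div x e : 0 < e -> x <= e^-1 * expR (x * e).
Proof.
move=> e0; rewrite ler_pdivlMl// mulrC.
by rewrite (le_trans _ (expR_ge1Dx _))// lerDr.
Qed.

Lemma pow_le_expR m e : 0 < e ->
  exists2 C, 0 <= C & forall x, 0 <= x -> x ^+ m <= C * expR (x * e).
Proof.
elim: m e => [|m IH] e e0.
  by exists 1 => // x x0; rewrite expr0 mul1r -expR0 ler_expR mulr_ge0// ltW.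
have e2 : 0 < e / 2 by rewrite divr_gt0.
have [C C0 hC] := IH _ e2; have ei0 : 0 <= (e / 2)^-1 by rewrite invr_ge0 ltW.
exists (C * (e / 2)^-1) => [|x x0]; first by rewrite mulr_ge0.
have -> : expR (x * e) = expR (x * (e / 2)) * expR (x * (e / 2)).
  by rewrite -expRD; congr expR; lra.
rewrite exprSr mulrACA ler_pM ?exprn_ge0 ?hC//.
exact: le_expR_div.
Qed.

End Growth.

Section WeakSolution.
Context {R : realType}.
Local Notation mu := (@lebesgue_measure R).
Local Notation I01 := (`]0, 1[%classic : set R).
Implicit Types (w G phi : R -> R).

Let mI : measurable I01. Proof. exact: measurable_itv. Qed.

Let bm_op k phi : smooth phi -> csupp 0 1 phi ->
  bounded_meas (fun x => derive1 (derive1 phi) x - k ^+ 2 * phi x).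
Proof.
move=> ps pc; apply: bounded_measB; last by apply: bounded_measZ; exact: bm_test pc.
apply: (@bm_test _ _ 0 1); first by do 2 apply: smooth_derive1.
by do 2 apply: csupp_derive1.
Qed.

Lemma weak_solZ (k r : R) w G : mu.-integrable I01 (EFin \o w) ->
  mu.-integrable I01 (EFin \o G) -> weak_sol k w G ->
  weak_sol k (fun x => r * w x) (fun x => r * G x).
Proof.
move=> iw iG h phi ps pc.
have i1 := pairing_bm_itg iw (bm_op k ps pc).
have i2 := pairing_bm_itg iG (bm_test ps pc).
under eq_Rintegral do rewrite -mulrA.
under [RHS]eq_Rintegral do rewrite -mulrA.
by rewrite !RintegralZl// h.
Qed.

Lemma weak_sol_shift (k k' : R) w G : mu.-integrable I01 (EFin \o w) ->
  mu.-integrable I01 (EFin \o G) -> weak_sol k w G ->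
  weak_sol k' w (fun x => G x + (k ^+ 2 - k' ^+ 2) * w x).
Proof.
move=> iw iG h phi ps pc.
have i1 := pairing_bm_itg iw (bm_op k ps pc).
have i2 := pairing_bm_itg iG (bm_test ps pc).
have i3 := pairing_bm_itg iw (bm_test ps pc).
transitivity (\int[mu]_(x in I01) (w x * (derive1 (derive1 phi) x - k ^+ 2 * phi x) +
    (k ^+ 2 - k' ^+ 2) * (w x * phi x))).
  by apply: eq_Rintegral => x _; ring.
rewrite RintegralD//; last exact: (@itgZ _ _ _ mu _ mI).
rewrite h// -RintegralD//; last exact: (@itgZ _ _ _ mu _ mI).
by apply: eq_Rintegral => x _; ring.
Qed.

Lemma Ker_bm_itg (k x0 x : R) G : 0 < k -> I01 x -> mu.-integrable I01 (EFin \o G) ->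
  mu.-integrable I01 (EFin \o (fun z => Ker k x0 (x, z) * G z)).
Proof.
move=> k0 xI iG.
have m1 : measurable_fun setT (fun z : R => (x, z)) by exact: measurable_pair1.
rewrite (_ : (fun z => _) = (fun z => G z * Ker k x0 (x, z))); last first.
  by apply/funext => z; rewrite mulrC.
apply: (@itgM_bdd _ _ _ mu I01 mI _ _ (expR k) iG).
  by apply: measurable_funTS; exact: (measurableT_comp (@measurable_Ker R k x0) m1).
move=> z; move: xI; rewrite /= !in_itv/= => /andP[a b] /andP[a' b'].
by apply: Ker_bound; rewrite ?(ltW a) ?(ltW a') ?(ltW b) ?(ltW b').
Qed.

Lemma Ker_pair_le (k x0 x : R) G : 0 < k -> I01 x -> mu.-integrable I01 (EFin \o G) ->
  `|\int[mu]_(z in I01) (Ker k x0 (x, z) * G z)| <= expR k * \int[mu]_(z in I01) `|G z|.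
Proof.
move=> k0 xI iG.
have ig : mu.-integrable I01 (EFin \o (fun z => `|G z|)) by exact: (@itg_norm _ _ _ mu _ _ iG).
rewrite -RintegralZl//; apply: le_Rint_norm => //.
- exact: Ker_bm_itg.
- exact: (@itgZ _ _ _ mu _ mI).
move=> z; move: xI; rewrite /= !in_itv/= => /andP[a b] /andP[a' b'].
rewrite normrM ler_wpM2r//.
by apply: Ker_bound; rewrite ?(ltW a) ?(ltW a') ?(ltW b) ?(ltW b').
Qed.

Lemma exp_massE (T s : R) : 0 < T -> 0 < s -> exp_mass T s = (1 - expR (- (s * T))) / s.
Proof.
move=> T0 s0; pose F (t : R) := - (s^-1) * expR (- (s * t)).
have E : (fun t : R => expR (- (s * t))) = (fun t => expR ((- s) * t + 0)).
  by apply/funext => t; rewrite addr0 mulNr.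
have dF (t : R) : is_derive t 1 F (expR (- (s * t))).
  rewrite /F; under eq_fun do rewrite (congr1 (@^~ _) E).
  apply: (is_derive_eq (is_deriveZf _ (is_derive_expRf (is_derive_affine (- s) 0 t)))).
  by rewrite addr0 !mulNr mulrN opprK mulrA mulVf ?mul1r ?gt_eqF.
have cE : continuous (fun t : R => expR (- (s * t))).
  rewrite E; under eq_fun do rewrite addr0.
  by apply: smooth_continuous; exact: smooth_expR.
rewrite /exp_mass (Rint_FTC T0 dF cE).
by rewrite /F mulr0 oppr0 expR0; field; rewrite gt_eqF.
Qed.

End WeakSolution.

(** * The initial value vanishes *)

Section SourceVanishing.
Context {R : realType}.
Local Notation mu := (@lebesgue_measure R).
Local Notation I01 := (`]0, 1[%classic : set R).
Variables (alpha T c d P M : R) (p a : R -> R) (u : R -> R -> R).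
Hypotheses (a0 : 0 < alpha) (a1 : alpha < 1) (T0 : 0 < T).
Hypotheses (c0 : 0 <= c) (cd : c < d) (d1 : d <= 1) (M0 : 0 <= M).
Hypotheses (mp : measurable_fun setT p) (pP : forall x, `|p x| <= P).
Hypothesis ia : mu.-integrable I01 (EFin \o a).
Hypothesis iu : forall t, mu.-integrable I01 (EFin \o u t).
Hypothesis ipairing : forall f, bounded_meas f ->
  mu.-integrable `]0, T[ (EFin \o (fun t => pairing (u t) f)).
Hypothesis reduced : forall s : R, 0 < s ->
  exists w rho, [/\ mu.-integrable I01 (EFin \o w), mu.-integrable I01 (EFin \o rho),
    weak_sol (s `^ (alpha / 2)) w (fun x => p x * w x + rho x - exp_mass T s * a x),
    (\int[mu]_(x in I01) `|w x| <= s `^ (- alpha) * M) /\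
    \int[mu]_(x in I01) `|rho x| <= expR (- (s * T)) * M &
    (\forall x \ae mu, x \in `]c, d[ -> w x = 0) /\
    forall f, bounded_meas f -> \int[mu]_(t in `]0, T[) (expR (- (s * t)) * pairing (u t) f) =
      s `^ alpha * pairing w f + pairing rho f].

Let mI : measurable I01. Proof. exact: measurable_itv. Qed.
Let mD : measurable (`]0, T[%classic : set R). Proof. exact: measurable_itv. Qed.

Let x0 := (c + d) / 2.
Let cx0 : c < x0. Proof. by rewrite /x0 ltr_pdivlMr//; move: cd; lra. Qed.
Let x0d : x0 < d. Proof. by rewrite /x0 ltr_pdivrMr//; move: cd; lra. Qed.
Let x0I : I01 x0.
Proof. by rewrite /= in_itv/= (le_lt_trans c0 cx0) (lt_le_trans x0d d1). Qed.
Let P0 : 0 <= P. Proof. exact: le_trans (pP 0). Qed.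

Let expT : 0 < 1 - expR (- T) :> R.
Proof. by rewrite subr_gt0 expR_lt1 oppr_lt0. Qed.

Let mass_ge s : 1 <= s -> 0 < exp_mass T s /\ (exp_mass T s)^-1 <= s / (1 - expR (- T)).
Proof.
move=> s1; have s0 : 0 < s by exact: lt_le_trans s1.
have h : 1 - expR (- T) <= 1 - expR (- (s * T)).
  by rewrite lerD2l lerN2 ler_expR lerN2 ler_peMl// ltW.
have h0 := lt_le_trans expT h.
rewrite exp_massE//; split; first exact: divr_gt0.
by rewrite invf_div ler_pM2l// lef_pV2// posrE.
Qed.

Let ipw w : mu.-integrable I01 (EFin \o w) -> mu.-integrable I01 (EFin \o (fun x => p x * w x)).
Proof.
move=> iw; rewrite (_ : (fun x => _) = (fun x => w x * p x)).
  by apply: pairing_bm_itg => //; split => //; exists P.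
by apply/funext => x; rewrite mulrC.
Qed.

Let pw_le w : mu.-integrable I01 (EFin \o w) ->
  \int[mu]_(x in I01) `|p x * w x| <= P * \int[mu]_(x in I01) `|w x|.
Proof.
move=> iw; have iw' := @itg_norm _ _ _ mu _ _ iw.
rewrite -RintegralZl//; apply: le_Rintegral => //.
- exact: (@itg_norm _ _ _ mu _ _ (ipw iw)).
- exact: (@itgZ _ _ _ mu _ mI).
by move=> x _; rewrite normrM ler_wpM2r.
Qed.

Let norm3 (f g h : R -> R) : mu.-integrable I01 (EFin \o f) -> mu.-integrable I01 (EFin \o g) ->
  mu.-integrable I01 (EFin \o h) ->
  \int[mu]_(x in I01) `|f x + g x - h x| <=
  \int[mu]_(x in I01) `|f x| + \int[mu]_(x in I01) `|g x| + \int[mu]_(x in I01) `|h x|.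
Proof.
move=> jf jg jh.
have jf' := @itg_norm _ _ _ mu _ _ jf; have jg' := @itg_norm _ _ _ mu _ _ jg.
have jh' := @itg_norm _ _ _ mu _ _ jh; have jfg := @itgD _ _ _ mu _ mI _ _ jf' jg'.
rewrite -RintegralD// -RintegralD//; apply: le_Rintegral => //.
- apply: (@itg_norm _ _ _ mu); apply: (@itgB _ _ _ mu _ mI) => //.
  exact: (@itgD _ _ _ mu _ mI).
- exact: (@itgD _ _ _ mu _ mI).
by move=> x _; rewrite (le_trans (ler_normB _ _))// lerD2r ler_normD.
Qed.

(** The averages divided by the mass of the weight satisfy the hypotheses of [source_moment_zero]
    along s = k^(2 / alpha), after which [a] is read off from its vanishing moments. *)
Lemma source_zero : \forall x \ae mu, x \in `]0, 1[ -> a x = 0.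
Proof.
have al2 : 2 <= 2 / alpha by rewrite ler_pdivlMr// ler_piMr// ltW.
(* Chosen so that s^(alpha / 2) = k, the integer frequency needed by the exponential sums. *)
pose s (k : nat) := k%:R `^ (2 / alpha) : R.
(* An integer exponent m with s <= k^m makes the bounds polynomial in [k]. *)
have [m m0 ms] := ex_nat_ge (2 / alpha).
have k1 k : (0 < k)%N -> 1 <= k%:R :> R by move=> k0; rewrite ler1n.
have sk k : (0 < k)%N -> s k `^ (alpha / 2) = k%:R.
  move=> k0; rewrite /s -powRrM (_ : 2 / alpha * (alpha / 2) = 1) ?powRr1//.
  by field; rewrite gt_eqF.
have s2 k : (0 < k)%N -> k%:R ^+ 2 <= s k.
  by move=> k0; rewrite -powR_mulrn// /s ler_powR// k1.
have sm k : (0 < k)%N -> s k <= k%:R ^+ m.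
  by move=> k0; rewrite -powR_mulrn// /s ler_powR// k1.
have s1 k : (0 < k)%N -> 1 <= s k.
  by move=> k0; rewrite (le_trans _ (s2 _ k0))// -[leLHS](expr1n _ 2) lerXn2r ?nnegrE ?k1.
pose D := M / (1 - expR (- T)).
have D0 : 0 <= D by rewrite divr_ge0// ltW.
have : forall k : nat, exists wr : (R -> R) * (R -> R), (0 < k)%N ->
    [/\ mu.-integrable I01 (EFin \o wr.1), mu.-integrable I01 (EFin \o wr.2),
     weak_sol k%:R wr.1 (fun x => p x * wr.1 x + wr.2 x - a x),
     (\int[mu]_(x in I01) `|wr.1 x| <= D * s k) /\
     \int[mu]_(x in I01) `|wr.2 x| <= D * (s k * expR (- (s k * T))) &
     \forall x \ae mu, x \in `]c, d[ -> wr.1 x = 0].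
  (* Nothing is required at k = 0, so any pair of functions serves. *)
  move=> [|k]; first by exists (p, p).
  have k0 : (0 < k.+1)%N by [].
  have sk0 : 0 < s k.+1 by rewrite (lt_le_trans ltr01)// s1.
  have [w [rho [iw irho wG [wB rB] [w0 _]]]] := reduced sk0.
  have [b0 bD] := mass_ge (s1 _ k0).
  set b := exp_mass T (s k.+1) in wG b0 bD.
  exists ((fun x => b^-1 * w x), (fun x => b^-1 * rho x)) => _ /=.
  have iw' := @itg_norm _ _ _ mu _ _ iw; have ir' := @itg_norm _ _ _ mu _ _ irho.
  have nZ (f : R -> R) : mu.-integrable I01 (EFin \o (fun x => `|f x|)) ->
      \int[mu]_(x in I01) `|b^-1 * f x| = b^-1 * \int[mu]_(x in I01) `|f x|.
    move=> jf; rewrite -RintegralZl//; apply: eq_Rintegral => x _.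
    by rewrite normrM gtr0_norm ?invr_gt0.
  split.
  - exact: (@itgZ _ _ _ mu _ mI).
  - exact: (@itgZ _ _ _ mu _ mI).
  - have iG : mu.-integrable I01 (EFin \o (fun x => p x * w x + rho x - b * a x)).
      apply: (@itgB _ _ _ mu _ mI); last exact: (@itgZ _ _ _ mu _ mI).
      by apply: (@itgD _ _ _ mu _ mI) => //; exact: ipw.
    have := weak_solZ b^-1 iw iG wG; rewrite sk//.
    rewrite (_ : (fun x => b^-1 * (_ + _ - _)) = (fun x => p x * (b^-1 * w x) + b^-1 * rho x - a x))//.
    by apply/funext => x; field; rewrite gt_eqF.
  - rewrite !nZ//; split.
      rewrite (_ : D * _ = (s k.+1 / (1 - expR (- T))) * M); last by rewrite /D; ring.
      rewrite ler_pM ?invr_ge0 ?(ltW b0)//; first by apply: Rintegral_ge0.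
      apply: le_trans wB _; rewrite ler_piMl// powRN invf_le1 ?powR_gt0//.
      by rewrite -[leLHS](powRr0 (s k.+1)) ler_powR ?s1// ltW.
    rewrite (_ : D * _ = (s k.+1 / (1 - expR (- T))) * (expR (- (s k.+1 * T)) * M)); last first.
      by rewrite /D; ring.
    by rewrite ler_pM ?invr_ge0 ?(ltW b0)//; first by apply: Rintegral_ge0.
  - by apply: aeS w0 => x h xcd; rewrite h// mulr0.
move=> /choice[wr wrP].
pose W k := (wr k).1; pose rho k := (wr k).2.
pose A := \int[mu]_(x in I01) `|a x|.
have A0 : 0 <= A by apply: Rintegral_ge0.
(* The kernel bound for wave number 1 times the L^1 norms of the terms of the shifted source. *)
pose q (k : nat) := expR 1 * (P * (D * s k) + D * s k + A + k%:R ^+ 2 * (D * s k)).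
pose G k x := p x * W k x + rho k x - a x.
have iG k : (0 < k)%N -> mu.-integrable I01 (EFin \o G k).
  move=> k0; have [iw ir _ _ _] := wrP _ k0.
  by apply: (@itgB _ _ _ mu _ mI) => //; apply: (@itgD _ _ _ mu _ mI) => //; exact: ipw.
pose good x := forall k, (0 < k)%N ->
  W k x = \int[mu]_(z in I01) (Ker k%:R x0 (x, z) * G k z) /\ `|W k x| <= q k.
have good_ae : \forall x \ae mu, I01 x -> good x.
  suff /ae_forall : forall k, \forall x \ae mu, I01 x -> (0 < k)%N ->
    W k x = \int[mu]_(z in I01) (Ker k%:R x0 (x, z) * G k z) /\ `|W k x| <= q k.
    by apply: aeS => x h xI k k0; exact: h.
  move=> k; have [->|k0] := posnP k; first exact: aeW.
  have [iw ir wG [wB rB] w0] := wrP _ k0; have kp : 0 < k%:R :> R by rewrite ltr0n.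
  have r1 := representation kp c0 cx0 x0d d1 iw (iG _ k0) wG w0.
  have iG' : mu.-integrable I01 (EFin \o (fun x => G k x + (k%:R ^+ 2 - 1 ^+ 2) * W k x)).
    by apply: (@itgD _ _ _ mu _ mI); [exact: iG|exact: (@itgZ _ _ _ mu _ mI)].
  (* The same function is represented a second time, with wave number 1; the first representation is
     the one used in the wave estimate, the second only gives the bound [q]. *)
  have wG1 := weak_sol_shift 1 iw (iG _ k0) wG.
  have r2 := representation ltr01 c0 cx0 x0d d1 iw iG' wG1 w0.
  apply: aeS (aeI r1 r2) => x [h1 h2] xI _; have xI' : x \in `]0, 1[ by [].
  split; first exact: h1.
  have := h2 xI'; rewrite -/(W k x) => ->; apply: le_trans (Ker_pair_le _ ltr01 xI iG') _.
  rewrite ler_wpM2l ?expR_ge0//.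
  have iw' := @itg_norm _ _ _ mu _ _ iw; have ir' := @itg_norm _ _ _ mu _ _ ir.
  apply: (@le_trans _ _ (\int[mu]_(x in I01) (`|G k x| + (k%:R ^+ 2) * `|W k x|))).
    have iGn := @itg_norm _ _ _ mu _ _ (iG _ k0).
    apply: le_Rintegral => //.
    + exact: (@itg_norm _ _ _ mu _ _ iG').
    + by apply: (@itgD _ _ _ mu _ mI) => //; exact: (@itgZ _ _ _ mu _ mI).
    move=> z _; rewrite (le_trans (ler_normD _ _))// lerD2l normrM ler_wpM2r//.
    rewrite expr1n ger0_norm ?gerBl// subr_ge0 -[leLHS](expr1n _ 2).
    by rewrite lerXn2r ?nnegrE ?k1.
  rewrite RintegralD//; last 2 first.
    exact: (@itg_norm _ _ _ mu _ _ (iG _ k0)).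
    exact: (@itgZ _ _ _ mu _ mI).
  rewrite RintegralZl// lerD ?ler_wpM2l//.
  apply: le_trans (norm3 (ipw iw) ir ia) _; rewrite lerD2r lerD//.
    by apply: le_trans (pw_le iw) _; rewrite ler_wpM2l.
  apply: le_trans rB _; rewrite ler_wpM2l// ler_piMr//.
    by rewrite (le_trans ler01)// s1.
  by rewrite expR_le1 oppr_le0 mulr_ge0 ?(ltW T0)// (le_trans ler01)// s1.
apply: (moment_zero_source_zero x0I ia); have gae := good_ae; apply: aeS gae => x gx xI.
apply: (source_moment_zero (P := P) (p := p) (W := W) (rho := rho) (good := good) (q := q)) => //.
- exact: measurable_funTS.
- by move=> k k0; have [] := wrP _ k0.
- by move=> k k0; have [] := wrP _ k0.
- by move=> k y k0 yI /(_ k k0)[].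
- by move=> k y k0 yI /(_ k k0)[].
- move=> e e0; have [C C0 hC] := pow_le_expR (m + 2) e0.
  exists (expR 1 * ((P + 2) * D + A) * C) => [|k k0].
    by rewrite !mulr_ge0 ?expR_ge0// addr_ge0// mulr_ge0// addr_ge0.
  rewrite -[leRHS]mulrA; apply: (@le_trans _ _ (expR 1 * ((P + 2) * D + A) * k%:R ^+ (m + 2))); last first.
    rewrite ler_wpM2l ?hC//; rewrite mulr_ge0 ?expR_ge0//.
    by rewrite addr_ge0// mulr_ge0// addr_ge0.
  rewrite -[leRHS]mulrA /q ler_wpM2l ?expR_ge0//.
  have e1 : 1 <= k%:R ^+ (m + 2) :> R by rewrite exprn_ege1 ?k1.
  have e2 : k%:R ^+ 2 * s k <= k%:R ^+ (m + 2).
    by rewrite exprD mulrC ler_wpM2r ?sm// exprn_ge0.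
  have e3 : s k <= k%:R ^+ (m + 2).
    apply: le_trans e2; rewrite ler_peMl ?(le_trans ler01 (s1 _ k0))//.
    by rewrite exprn_ege1 ?k1.
  have g1 := ler_wpM2l A0 e1; have g2 := ler_wpM2l D0 e2; have g3 := ler_wpM2l D0 e3.
  have g4 := ler_wpM2l P0 g3.
  rewrite mulrCA; move: g1 g2 g3 g4; lra.
(* One half of the decay e^(- s T) absorbs the factor [s]. The other half must beat e^(3 k), namely
   e^(2 k) and the required decay e^(- k); as s >= k^2 this follows from (k T - 3)^2 >= 0, whence
   the 9 / (2 T). *)
- exists (D * ((T / 2)^-1 * expR (9 / (2 * T)))) => [|k k0].
    by rewrite mulr_ge0// mulr_ge0 ?expR_ge0// invr_ge0 divr_ge0// ltW.
  have [_ _ _ [_ rB] _] := wrP _ k0.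
  have T2 : 0 < T / 2 by rewrite divr_gt0.
  apply: (le_trans (ler_wpM2l (expR_ge0 _) rB)).
  rewrite mulrCA -[leRHS]mulrA; apply: ler_wpM2l => //.
  apply: (@le_trans _ _ (expR (2 * k%:R) * ((T / 2)^-1 * expR (s k * (T / 2)) * expR (- (s k * T))))).
    by rewrite ler_wpM2l ?expR_ge0// ler_wpM2r ?expR_ge0// le_expR_div.
  rewrite -mulrA mulrCA -mulrA; apply: ler_wpM2l; first by rewrite invr_ge0 ltW.
  rewrite -!expRD ler_expR.
  have h := ler_wpM2r (ltW T2) (s2 _ k0).
  have h2 : 3 * k%:R <= k%:R ^+ 2 * (T / 2) + 9 / (2 * T) :> R.
    rewrite -subr_ge0 (_ : _ - _ = (k%:R * T - 3) ^+ 2 / (2 * T)).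
      by rewrite divr_ge0 ?sqr_ge0// mulr_ge0// ltW.
    by field; rewrite gt_eqF.
  by move: h h2; lra.
- exact: gx.
Qed.

End SourceVanishing.

(** * The solution vanishes once the initial value does *)

Section Vanishing.
Context {R : realType}.
Local Notation mu := (@lebesgue_measure R).
Local Notation I01 := (`]0, 1[%classic : set R).
Variables (alpha T c d P M : R) (p a : R -> R) (u : R -> R -> R).
Hypotheses (a0 : 0 < alpha) (a1 : alpha < 1) (T0 : 0 < T).
Hypotheses (c0 : 0 <= c) (cd : c < d) (d1 : d <= 1) (M0 : 0 <= M).
Hypotheses (mp : measurable_fun setT p) (pP : forall x, `|p x| <= P).
Hypothesis ia : mu.-integrable I01 (EFin \o a).
Hypothesis iu : forall t, mu.-integrable I01 (EFin \o u t).
Hypothesis ipairing : forall f, bounded_meas f ->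
  mu.-integrable `]0, T[ (EFin \o (fun t => pairing (u t) f)).
Hypothesis reduced : forall s : R, 0 < s ->
  exists w rho, [/\ mu.-integrable I01 (EFin \o w), mu.-integrable I01 (EFin \o rho),
    weak_sol (s `^ (alpha / 2)) w (fun x => p x * w x + rho x - exp_mass T s * a x),
    (\int[mu]_(x in I01) `|w x| <= s `^ (- alpha) * M) /\
    \int[mu]_(x in I01) `|rho x| <= expR (- (s * T)) * M &
    (\forall x \ae mu, x \in `]c, d[ -> w x = 0) /\
    forall f, bounded_meas f -> \int[mu]_(t in `]0, T[) (expR (- (s * t)) * pairing (u t) f) =
      s `^ alpha * pairing w f + pairing rho f].

Let mI : measurable I01. Proof. exact: measurable_itv. Qed.
Let mD : measurable (`]0, T[%classic : set R). Proof. exact: measurable_itv. Qed.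

Let x0 := (c + d) / 2.
Let cx0 : c < x0. Proof. by rewrite /x0 ltr_pdivlMr//; move: cd; lra. Qed.
Let x0d : x0 < d. Proof. by rewrite /x0 ltr_pdivrMr//; move: cd; lra. Qed.
Let x0I : I01 x0.
Proof. by rewrite /= in_itv/= (le_lt_trans c0 cx0) (lt_le_trans x0d d1). Qed.
Let P0 : 0 <= P. Proof. exact: le_trans (pP 0). Qed.

Let ipw w : mu.-integrable I01 (EFin \o w) -> mu.-integrable I01 (EFin \o (fun x => p x * w x)).
Proof.
move=> iw; rewrite (_ : (fun x => _) = (fun x => w x * p x)).
  by apply: pairing_bm_itg => //; split => //; exists P.
by apply/funext => x; rewrite mulrC.
Qed.

Hypothesis a_zero : \forall x \ae mu, x \in `]0, 1[ -> a x = 0.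

Let fin01 : fine (mu I01) = 1.
Proof. by have := @mu_itv_oo R 0 1 ler01; rewrite subr0 => ->. Qed.

Let rep_bound s w rho : 0 < s -> mu.-integrable I01 (EFin \o w) ->
  mu.-integrable I01 (EFin \o rho) ->
  weak_sol (s `^ (alpha / 2)) w (fun x => p x * w x + rho x - exp_mass T s * a x) ->
  (\forall x \ae mu, x \in `]c, d[ -> w x = 0) ->
  \forall x \ae mu, I01 x -> `|w x| <=
    2 * expR (4 * P + 1 + 2 * (s `^ (alpha / 2))) * \int[mu]_(x in I01) `|rho x|.
Proof.
move=> s0 iw ir wG w0; set k := s `^ (alpha / 2).
have k0 : 0 < k by exact: powR_gt0.
have ig : mu.-integrable I01 (EFin \o (fun x => p x * w x + rho x)).
  by apply: (@itgD _ _ _ mu _ mI) => //; exact: ipw.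
have iG : mu.-integrable I01 (EFin \o (fun x => p x * w x + rho x - exp_mass T s * a x)).
  by apply: (@itgB _ _ _ mu _ mI) => //; exact: (@itgZ _ _ _ mu _ mI).
have r := representation k0 c0 cx0 x0d d1 iw iG wG w0.
pose good x := w x = \int[mu]_(z in I01) (Ker k x0 (x, z) * (p z * w z + rho z)).
have gae : \forall x \ae mu, I01 x -> good x.
  apply: aeS r => x h xI; rewrite /good h; last by [].
  apply: Rint_ae_eq => //.
  - exact: itg_meas (Ker_bm_itg x0 k0 xI iG).
  - exact: itg_meas (Ker_bm_itg x0 k0 xI ig).
  by apply: aeS a_zero => z az zI; rewrite az// mulr0 subr0.
have good_ae := gae; apply: aeS gae => x gx xI.
(* The kernel bound supplies the a priori supremum; it may be huge, since it does not enter the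
   conclusion. *)
apply: (@weak_sol_sup_bound _ x0 P k (expR k * \int[mu]_(z in I01) `|p z * w z + rho z|) p w rho good) => //.
- exact: measurable_funTS.
- by move=> y yI ->; exact: Ker_pair_le.
- exact: gx.
Qed.

(** The transform of t -> pairing (u t) f is s^alpha w + rho tested with [f], hence of size e^(c k -
    s T) with k = s^(alpha / 2). For s >= 1 one has k^2 <= s, so e^(2 k) costs only e^(e s) up to a
    constant, for every e > 0. *)
Lemma pairing_zero f : bounded_meas f ->
  \forall t \ae mu, t \in `]0, T[ -> pairing (u t) f = 0.
Proof.
move=> bf; have [mf [C fC]] := bf.
have C0 : 0 <= C by apply: le_trans (fC 0).
apply: (mikusinski T0 (ipairing bf)) => e e0.
(* The first 2 / e comes from s <= (2 / e) e^(s e / 2), the one in the exponent from 2 k <= s e / 2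
   + 2 / e, a completed square. *)
pose K := (2 / e) * (2 * expR (4 * P + 1 + 2 / e)).
have e2 : 0 < e / 2 by rewrite divr_gt0.
have K0 : 0 <= K by rewrite mulr_ge0 ?divr_ge0 ?mulr_ge0 ?expR_ge0// ltW.
exists (C * (K + 1) * M) => [|n n0]; first by rewrite mulr_ge0// mulr_ge0// addr_ge0.
have s1 : 1 <= n%:R :> R by rewrite ler1n.
move: (n%:R : R) s1 => s s1; have s0 : 0 < s by exact: lt_le_trans s1.
have [w [rho [iw ir wG [wB rB] [w0 wf]]]] := reduced s0.
have wb := rep_bound s0 iw ir wG w0.
rewrite wf//; set k := s `^ (alpha / 2) in wb.
pose r := \int[mu]_(x in I01) `|rho x|.
have r0 : 0 <= r by apply: Rintegral_ge0.
pose E := 2 * expR (4 * P + 1 + 2 * k).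
have E0 : 0 <= E by rewrite mulr_ge0 ?expR_ge0.
have h1 : `|pairing w f| <= E * r * C.
  apply: (@le_trans _ _ (\int[mu]_(x in I01) (E * r * C))); last first.
    by rewrite Rintegral_cst// fin01 mulr1.
  apply: le_Rint_norm_ae => //; first exact: pairing_bm_itg.
    by apply: I01_itg_bm; exact: bounded_meas_cst.
  apply: aeS wb => x h xI; rewrite normrM ler_pM//; exact: h.
have h2 : `|pairing rho f| <= r * C.
  have irn := @itg_norm _ _ _ mu _ _ ir.
  rewrite mulrC -RintegralZl//; apply: le_Rint_norm => //; first exact: pairing_bm_itg.
    exact: (@itgZ _ _ _ mu _ mI).
  by move=> x _; rewrite normrM mulrC ler_wpM2r.
have ka : k ^+ 2 = s `^ alpha by rewrite -powR_mulrn ?powR_ge0// -powRrM divfK.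
have sa : s `^ alpha <= s by rewrite -[leRHS]powRr1 ?(ltW s0)// ler_powR// ltW.
have sa0 : 0 <= s `^ alpha by exact: powR_ge0.
have k2 : 2 * k <= s * (e / 2) + 2 / e.
  apply: (@le_trans _ _ (k ^+ 2 * (e / 2) + 2 / e)).
    rewrite -subr_ge0 (_ : _ - _ = (k * e - 2) ^+ 2 / (2 * e)).
      by rewrite divr_ge0 ?sqr_ge0// mulr_ge0// ltW.
    by field; rewrite gt_eqF.
  by rewrite lerD2r ler_wpM2r ?(ltW e2)// ka.
have kE : s `^ alpha * E <= K * expR (s * e).
  have -> : K * expR (s * e) = ((2 / e) * expR (s * (e / 2))) *
      (2 * (expR (4 * P + 1 + 2 / e) * expR (s * (e / 2)))).
    rewrite /K (_ : s * e = s * (e / 2) + s * (e / 2)); last by field.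
    by rewrite (expRD (s * (e / 2))); ring.
  apply: ler_pM => //.
    by apply: le_trans sa _; rewrite -invf_div; exact: le_expR_div.
  by rewrite ler_pM2l// -expRD ler_expR; move: k2; lra.
have e1 : 1 <= expR (s * e) by rewrite -expR0 ler_expR mulr_ge0 ?ltW.
have -> : expR (- (s * (T - e))) = expR (s * e) * expR (- (s * T)).
  by rewrite -expRD; congr expR; ring.
rewrite (le_trans (ler_normD _ _))// normrM (ger0_norm sa0).
apply: (@le_trans _ _ (s `^ alpha * (E * r * C) + r * C)).
  by rewrite lerD// ler_wpM2l.
rewrite [leLHS](_ : _ = (s `^ alpha * E + 1) * r * C); last by ring.
rewrite [leRHS](_ : _ = (K + 1) * expR (s * e) * (expR (- (s * T)) * M) * C); last by ring.
rewrite ler_wpM2r// ler_pM//; first by rewrite addr_ge0// mulr_ge0.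
by rewrite mulrDl mul1r lerD.
Qed.

Lemma ex_rat_cvg (r : R) : exists q : nat -> rat, ratr (q n) @[n --> \oo] --> r.
Proof.
have : forall n : nat, exists q : rat, r < ratr q < r + n.+1%:R^-1.
  move=> n; have [|q qr] := @rat_in_itvoo R r (r + n.+1%:R^-1).
    by rewrite ltrDl invr_gt0.
  by exists q; move: qr; rewrite in_itv.
move=> /choice[q qr]; exists q.
apply/cvgrPdist_lt => e e0.
near=> n; have /andP[h1 h2] := qr n.
rewrite distrC gtr0_norm ?subr_gt0// ltrBlDl (lt_trans h2)// ltrD2l.
near: n; exact: (near_infty_natSinv_lt (PosNum e0)).
Unshelve. all: by end_near. Qed.

(** The exceptional set of times depends on the test function, so only the countably many indicators
    of rational intervals are used; other intervals follow by dominated convergence at a fixed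
    time. *)
Lemma u_zero : \forall t \ae mu, t \in `]0, T[ -> \forall x \ae mu, x \in `]0, 1[ -> u t x = 0.
Proof.
have mitv (q : rat * rat) : measurable (`]ratr q.1 : R, ratr q.2[%classic) by exact: measurable_itv.
have h : \forall t \ae mu, forall n, t \in `]0, T[ -> forall q : rat * rat, unpickle n = Some q ->
    pairing (u t) \1_(`]ratr q.1 : R, ratr q.2[%classic) = 0.
  apply: ae_forall => n; case E : (unpickle n : option (rat * rat)) => [q|]; last first.
    by apply: aeW => t _ q.
  have := pairing_zero (bounded_meas_indic (mitv q)).
  by apply: aeS => t ht tT _ [<-]; exact: ht.
apply: aeS h => t ht tT.
have {}ht (q1 q2 : rat) : pairing (u t) \1_(`]ratr q1 : R, ratr q2[%classic) = 0.
  by apply: (ht (pickle (q1, q2)) tT (q1, q2)); rewrite pickleK.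
apply: (ae_eq0_intervals (iu t)) => l r l0 lr r1.
have [ql lq] := ex_rat_cvg l; have [qr rq] := ex_rat_cvg r.
pose f (n : nat) : R -> R := \1_(`]ratr (ql n) : R, ratr (qr n)[%classic).
have mlr : measurable (`]l, r[%classic : set R) by exact: measurable_itv.
have mf n : measurable_fun I01 (f n).
  exact: measurable_funTS (bounded_meas_indic (mitv (ql n, qr n))).1.
have nz (y : R) : \forall x \ae mu, x != y.
  exists [set y]; split => //; first by rewrite lebesgue_measure_set1.
  by move=> x /= /negP; rewrite negbK => /eqP.
have muT := itg_meas (iu t).
have ff : \forall x \ae mu, I01 x -> f n x @[n --> \oo] --> (\1_(`]l, r[%classic) x : R).
  apply: aeS (aeI (nz l) (nz r)) => x [xl xr] xI.
  have cst0 (b : bool) : (\forall n \near \oo, (ratr (ql n) < x < ratr (qr n)) = b) ->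
      (l < x < r) = b -> f n x @[n --> \oo] --> (\1_(`]l, r[%classic) x : R).
    move=> nb lb; apply: cvg_near_cst; apply: filterS nb => n nb.
    by rewrite /f !indicE !mem_setE !in_itv/= nb lb.
  have lql (y : R) : l < y -> \forall n \near \oo, ratr (ql n) < y.
    by move=> ly; exact: (cvgr_lt _ lq).
  have gql (y : R) : y < l -> \forall n \near \oo, y < ratr (ql n).
    by move=> ly; exact: (cvgr_gt _ lq).
  have lqr (y : R) : r < y -> \forall n \near \oo, ratr (qr n) < y.
    by move=> ly; exact: (cvgr_lt _ rq).
  have gqr (y : R) : y < r -> \forall n \near \oo, y < ratr (qr n).
    by move=> ly; exact: (cvgr_gt _ rq).
  have [lx|xl'|xl'] := ltgtP l x; last by move: xl; rewrite xl' eqxx.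
  - have [rx|xr'|xr'] := ltgtP r x; last by move: xr; rewrite xr' eqxx.
    + apply: (cst0 false); last by rewrite (ltNge x r) (ltW rx) andbF.
      by apply: filterS (lqr _ rx) => n h; rewrite (ltNge x) (ltW h) andbF.
    + apply: (cst0 true); last by rewrite lx xr'.
      by apply: filterS2 (lql _ lx) (gqr _ xr') => n -> ->.
  - apply: (cst0 false); last by rewrite (ltNge l x) (ltW xl').
    by apply: filterS (gql _ xl') => n h; rewrite (ltNge _ x) (ltW h).
have [|||||_ cv] := @Rint_dominated _ _ _ mu I01 mI (fun n x => u t x * f n x)
    (fun x => u t x * \1_(`]l, r[%classic) x) (fun x => `|u t x|).
- by move=> n; apply: measurable_funM; [exact: muT|exact: mf].
- apply: measurable_funM; first exact: muT.
  exact: measurable_funTS (bounded_meas_indic mlr).1.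
- apply: aeS ff => x h xI; apply: cvgMr; exact: h.
- exact: (@itg_norm _ _ _ mu _ _ (iu t)).
- by move=> n x _; rewrite normrM ler_piMr// norm_indic_le1.
rewrite -pairing_indic ?(ltW l0) ?(ltW r1)//.
apply: (cvg_unique _ cv) => //.
rewrite (_ : (fun n => _) = fun=> 0); first exact: cvg_cst.
by apply/funext => n; exact: ht.
Qed.

End Vanishing.

Section ScalarCore.
Context {R : realType}.
Local Notation mu := (@lebesgue_measure R).
Local Notation I01 := (`]0, 1[%classic : set R).

(** The solution enters only through scalar functions of time, its pairings with bounded functions.
    Sobolev norms and vector-valued integrals are thus kept out of the analytic argument, and [p]
    may be bounded everywhere rather than almost everywhere. *)
Theorem scalar_uniqueness (alpha T c d P M : R) (p a : R -> R) (u : R -> R -> R) :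
  0 < alpha -> alpha < 1 -> 0 < T -> 0 <= c -> c < d -> d <= 1 -> 0 <= M ->
  measurable_fun setT p -> (forall x, `|p x| <= P) ->
  mu.-integrable I01 (EFin \o a) -> (forall t, mu.-integrable I01 (EFin \o u t)) ->
  (forall f, bounded_meas f -> measurable_fun `]0, T[ (fun t => pairing (u t) f)) ->
  (forall f S, bounded_meas f -> 0 < S -> \int[mu]_(x in I01) (f x ^+ 2) <= S ^+ 2 ->
    (\int[mu]_(t in `]0%R, T[) `|pairing (u t) f|%:E <= (S * M)%:E)%E) ->
  (forall phi, smooth phi -> csupp 0 1 phi ->
    \forall t \ae mu, t \in `]0, T[ -> pairing (u t) phi - pairing a phi =
      (Gamma alpha)^-1 * \int[mu]_(tau in `]0, t[) ((t - tau) `^ (alpha - 1) *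
        (pairing (u tau) (derive1 (derive1 phi)) - pairing (u tau) (fun x => p x * phi x)))) ->
  (forall t, \forall x \ae mu, x \in `]c, d[ -> u t x = 0) ->
  \forall t \ae mu, t \in `]0, T[ -> \forall x \ae mu, x \in `]0, 1[ -> u t x = 0.
Proof.
move=> a0 a1 T0 c0 cd d1 M0 mp pP ia iu um ud eqn u0.
have red := laplace_reduction a0 a1 T0 c0 d1 M0 mp pP ia iu um ud eqn u0.
have ip := pairing_itg um ud.
have az := source_zero a0 a1 T0 c0 cd d1 M0 mp pP ia red.
exact: (u_zero a1 T0 c0 cd d1 M0 mp pP ia iu ip red az).
Qed.

End ScalarCore.

(** * Sobolev spaces *)

Section SquareIntegrable.
Context {R : realType}.
Local Notation mu := (@lebesgue_measure R).
Local Notation I01 := (`]0, 1[%classic : set R).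
Implicit Types (f g h phi psi : R -> R).

Let mI : measurable I01. Proof. exact: measurable_itv. Qed.

Definition square_itg f := measurable_fun I01 f /\
  mu.-integrable I01 (EFin \o (fun x => f x ^+ 2)).

Definition sqnorm f := \int[mu]_(x in I01) (f x ^+ 2).

Lemma sqnorm_ge0 f : 0 <= sqnorm f.
Proof. by apply: Rintegral_ge0 => x _; exact: sqr_ge0. Qed.

Let int_sq0 f : (0 <= \int[mu]_(x in I01) (f x ^+ 2)%:E)%E.
Proof. by apply: integral_ge0 => x _; rewrite lee_fin sqr_ge0. Qed.

Lemma L2norm01E f : L2norm01 f = sqrte (\int[mu]_(x in I01) (f x ^+ 2)%:E)%E.
Proof.
rewrite /L2norm01 unlock -poweR12_sqrt ?int_sq0//; congr (_ `^ _)%E.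
rewrite [RHS]integral_mkcond; apply: eq_integral => x _.
rewrite /patch /=; case: ifP => _; last by rewrite normr0 powR0.
by rewrite powR_mulrn// real_normK ?num_real.
Qed.

Lemma L2norm01_sqr f : (L2norm01 f ^+ 2 = \int[mu]_(x in I01) (f x ^+ 2)%:E)%E.
Proof. by rewrite L2norm01E sqr_sqrte ?int_sq0. Qed.

Lemma Lq01_2P f : Lq01 2%:E f <-> square_itg f.
Proof.
have mfE : measurable_fun setT (f \_ I01) <-> measurable_fun I01 f.
  by split => h; apply/(measurable_restrictT f mI).
have nE : ('N[mu]_2[EFin \o (f \_ I01)] < +oo)%E = (\int[mu]_(x in I01) (f x ^+ 2)%:E < +oo)%E.
  rewrite (L2norm01E f : 'N[mu]_2[_] = _)%E -poweR12_sqrt ?int_sq0//.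
  by apply/idP/idP => [/lty_poweRy->|/poweR_lty->].
have iE : measurable_fun I01 f -> (\int[mu]_(x in I01) (f x ^+ 2)%:E < +oo)%E =
    mu.-integrable I01 (EFin \o (fun x => f x ^+ 2)).
  move=> mf; apply/idP/integrableP => [h|[_]].
    split; first by apply/measurable_EFinP; exact: measurable_funX.
    by under eq_integral do rewrite /= ger0_norm ?sqr_ge0//.
  by under eq_integral do rewrite /= ger0_norm ?sqr_ge0//.
split => [h|[mf fi]].
  have := sub_Lfun_mfun h; rewrite inE/= => mf.
  have := sub_Lfun_finLfun h; rewrite inE/= => nf.
  have mf' : measurable_fun I01 f by exact/mfE.
  by split => //; rewrite -iE// -nE.
rewrite /Lq01/=; apply/andP; split; rewrite inE/=; first exact/mfE.
by rewrite /finite_norm nE iE.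
Qed.

Lemma L2norm01_sqnorm f : square_itg f -> (L2norm01 f ^+ 2 = (sqnorm f)%:E)%E.
Proof.
move=> [mf fi]; rewrite L2norm01_sqr /sqnorm /Rintegral fineK//.
exact: integrable_fin_num.
Qed.

Lemma square_itg_lin (r : R) f g : square_itg f -> square_itg g ->
  square_itg (fun x => r * f x + g x).
Proof.
move=> [mf fi] [mg gi].
have m : measurable_fun I01 (fun x => r * f x + g x).
  by apply: measurable_funD => //; exact: measurable_funM.
split => //; apply: (@itg_le _ _ _ mu I01 mI _ (fun x => 2 * r ^+ 2 * f x ^+ 2 + 2 * g x ^+ 2)).
- exact: measurable_funX.
- move=> x _; rewrite ger0_norm ?sqr_ge0// -subr_ge0.
  by rewrite (_ : _ - _ = (r * f x - g x) ^+ 2) ?sqr_ge0//; ring.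
- by apply: (@itgD _ _ _ mu _ mI); exact: (@itgZ _ _ _ mu _ mI).
Qed.

Lemma square_itg_mul f g : square_itg f -> square_itg g ->
  mu.-integrable I01 (EFin \o (fun x => f x * g x)).
Proof.
move=> [mf fi] [mg gi].
apply: (@itg_le _ _ _ mu I01 mI _ (fun x => f x ^+ 2 + g x ^+ 2)).
- exact: measurable_funM.
- move=> x _; rewrite normrM -[f x ^+ 2]real_normK ?num_real// -[g x ^+ 2]real_normK ?num_real//.
  have := sqr_ge0 (`|f x| - `|g x|); have := mulr_ge0 (normr_ge0 (f x)) (normr_ge0 (g x)).
  by move: (`|f x|) (`|g x|) => y z; nra.
- exact: (@itgD _ _ _ mu _ mI).
Qed.

Lemma square_itg_bm f : bounded_meas f -> square_itg f.
Proof.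
move=> bf; split; first exact: measurable_funTS bf.1.
by apply: (I01_itg_bm (psi := fun x => f x ^+ 2)); under eq_fun do rewrite expr2; exact: bounded_measM.
Qed.

Lemma square_itg_itg f : square_itg f -> mu.-integrable I01 (EFin \o f).
Proof.
move=> sf; have := square_itg_mul sf (square_itg_bm (bounded_meas_cst 1)).
by apply: eq_integrable => // x _ /=; rewrite mulr1.
Qed.

(** Young's inequality with the weights B / (2 A) and A / (2 B), which only needs upper bounds for
    the norms. *)
Lemma cauchy_schwarz f g (A B : R) : square_itg f -> square_itg g ->
  0 <= A -> 0 < B -> sqnorm f <= A ^+ 2 -> sqnorm g <= B ^+ 2 ->
  `|\int[mu]_(x in I01) (f x * g x)| <= A * B.
Proof.
move=> sf sg A0 B0 fA gB; apply/ler_addgt0Pr => e e0.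
(* [A] may be 0; a positive perturbation makes the division legitimate and costs exactly [e]. *)
pose A' := A + e / B; have A'0 : 0 < A' by rewrite ltr_wpDl// divr_gt0.
have fA' : sqnorm f <= A' ^+ 2.
  by apply: le_trans fA _; rewrite lerXn2r ?nnegrE ?(ltW A'0)// lerDl divr_ge0// ltW.
have -> : A * B + e = A' * B by rewrite /A'; field; rewrite gt_eqF.
have fi := sf.2; have gi := sg.2.
have i1 := @itgZ _ _ _ mu _ mI (B / (2 * A')) _ fi.
have i2 := @itgZ _ _ _ mu _ mI (A' / (2 * B)) _ gi.
apply: (@le_trans _ _ (\int[mu]_(x in I01) (B / (2 * A') * f x ^+ 2 + A' / (2 * B) * g x ^+ 2))).
  apply: le_Rint_norm => //; first exact: square_itg_mul.
    exact: (@itgD _ _ _ mu _ mI).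
  move=> x _; rewrite normrM -[f x ^+ 2]real_normK ?num_real// -[g x ^+ 2]real_normK ?num_real//.
  rewrite -subr_ge0 (_ : _ - _ = (B * `|f x| - A' * `|g x|) ^+ 2 / (2 * A' * B)).
    by rewrite divr_ge0 ?sqr_ge0// !mulr_ge0// ltW.
  by field; rewrite !gt_eqF.
rewrite RintegralD// !RintegralZl// -!/(sqnorm _).
apply: (@le_trans _ _ (B / (2 * A') * A' ^+ 2 + A' / (2 * B) * B ^+ 2)).
  by apply: lerD; rewrite ler_wpM2l// divr_ge0 ?mulr_ge0// ltW.
by rewrite le_eqVlt; apply/orP; left; apply/eqP; field; rewrite !gt_eqF.
Qed.

Lemma sqnorm_ae f g : square_itg f -> square_itg g ->
  (\forall x \ae mu, x \in `]0, 1[ -> f x = g x) -> sqnorm f = sqnorm g.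
Proof.
move=> [mf _] [mg _] fg; apply: Rint_ae_eq => //; try exact: measurable_funX.
by apply: aeS fg => x h xI; rewrite h.
Qed.

End SquareIntegrable.

Section WeakDerivative.
Context {R : realType}.
Local Notation mu := (@lebesgue_measure R).
Local Notation I01 := (`]0, 1[%classic : set R).
Implicit Types (f g h phi psi : R -> R).

Let mI : measurable I01. Proof. exact: measurable_itv. Qed.

Lemma test_smooth phi : test_fun01 phi -> smooth phi /\ csupp 0 1 phi.
Proof. by move/test_fun01P. Qed.

Lemma test_bm phi : test_fun01 phi -> bounded_meas phi.
Proof. by move=> /test_smooth[ps pc]; exact: bm_test pc. Qed.

Lemma test_derive phi : test_fun01 phi -> test_fun01 (derive1 phi).
Proof.
move=> /test_smooth[ps pc]; apply/test_fun01P; split; first exact: smooth_derive1.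
exact: csupp_derive1.
Qed.

Lemma testZ (r : R) phi : test_fun01 phi -> test_fun01 (r *: phi).
Proof.
move=> /test_smooth[ps [l [k [l0 lk k1 h]]]]; apply/test_fun01P; split.
  exact: (smoothM (smooth_cst r) ps).
exists l, k; split => // x nz; apply: h; apply: contra nz => /eqP h.
by rewrite (_ : (r *: phi) x = r * phi x)// h mulr0.
Qed.

Lemma weak_deriv_test phi : test_fun01 phi -> is_weak_deriv phi (derive1 phi).
Proof.
move=> tp; have [ps pc] := test_smooth tp; have bp := test_bm tp.
have bp' := test_bm (test_derive tp).
split; first by apply/Lq01_2P; exact: square_itg_bm.
move=> psi tq; have [qs qc] := test_smooth tq; have bq := test_bm tq.
have bq' := test_bm (test_derive tq).
have i1 := I01_itg_bm (bounded_measM bp bq').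
have i2 := I01_itg_bm (bounded_measM bp' bq).
apply/eqP; rewrite -addr_eq0 -RintegralD//; apply/eqP.
have dF (x : R) : is_derive x 1 (fun x => phi x * psi x) (phi x * derive1 psi x + derive1 phi x * psi x).
  by rewrite addrC; exact: (is_deriveMf (smooth_derivable x ps) (smooth_derivable x qs)).
have cF : continuous (fun x => phi x * derive1 psi x + derive1 phi x * psi x).
  apply: smooth_continuous.
  exact: (smoothD (smoothM ps (smooth_derive1 qs)) (smoothM (smooth_derive1 ps) qs)).
have p0 : phi 0 = 0 by apply: (csupp_eq0 pc); rewrite ltxx.
have p1 : phi 1 = 0 by apply: (csupp_eq0 pc); rewrite ltxx andbF.
by rewrite (Rint_FTC ltr01 dF cF) p0 p1 !mul0r subrr.
Qed.

Lemma weak_deriv_lin (r : R) f g f' g' : square_itg f -> square_itg g ->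
  is_weak_deriv f f' -> is_weak_deriv g g' ->
  is_weak_deriv (r *: f + g)%R (r *: f' + g')%R.
Proof.
move=> sf sg [/Lq01_2P sf' hf] [/Lq01_2P sg' hg]; split.
  by apply/Lq01_2P; exact: square_itg_lin.
move=> phi tp; have s1 := square_itg_bm (test_bm tp); have s2 := square_itg_bm (test_bm (test_derive tp)).
have E (f1 g1 h : R -> R) : square_itg f1 -> square_itg g1 -> square_itg h ->
    \int[mu]_(x in I01) ((r *: f1 + g1)%R x * h x) =
    r * \int[mu]_(x in I01) (f1 x * h x) + \int[mu]_(x in I01) (g1 x * h x).
  move=> s3 s4 s5; have j1 := square_itg_mul s3 s5; have j2 := square_itg_mul s4 s5.
  rewrite -RintegralZl// -RintegralD//; last exact: (@itgZ _ _ _ mu _ mI).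
  by apply: eq_Rintegral => x _; rewrite mulrDl -mulrA.
by rewrite !E// hf// hg// mulrN -opprD.
Qed.

Lemma weak_deriv_uniq f g h : is_weak_deriv f g -> is_weak_deriv f h ->
  \forall x \ae mu, x \in `]0, 1[ -> g x = h x.
Proof.
move=> [/Lq01_2P sg hg] [/Lq01_2P sh hh].
have ig := square_itg_itg sg; have ih := square_itg_itg sh.
have : \forall x \ae mu, x \in `]0, 1[ -> g x - h x = 0.
  apply: fundamental_lemma; first exact: (@itgB _ _ _ mu _ mI).
  move=> phi ps pc; have tp : test_fun01 phi by exact/test_fun01P.
  have s1 := square_itg_bm (test_bm tp).
  have j1 := square_itg_mul sg s1; have j2 := square_itg_mul sh s1.
  under eq_Rintegral do rewrite mulrBl.
  by rewrite RintegralB//; apply/eqP; rewrite subr_eq0 -eqr_opp -hg// hh.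
by apply: aeS => x k xI; apply/eqP; rewrite -subr_eq0 k.
Qed.

Lemma H1P f : ncar H1 f -> square_itg f /\ is_weak_deriv f (weak_deriv f).
Proof.
move=> [/Lq01_2P sf [g wg]]; split => //.
exact: (@xgetPex _ 0 [set g | is_weak_deriv f g] (ex_intro _ g wg)).
Qed.

Lemma H1_lin (r : R) f g : ncar H1 f -> ncar H1 g -> ncar H1 (r *: f + g)%R.
Proof.
move=> /H1P[sf wf] /H1P[sg wg]; split; first by apply/Lq01_2P; exact: square_itg_lin.
by exists (r *: weak_deriv f + weak_deriv g)%R; exact: weak_deriv_lin.
Qed.

(** Weak derivatives are unique almost everywhere, so the choice hidden in [weak_deriv] does not
    affect the norm. *)
Lemma H1normE f g : ncar H1 f -> is_weak_deriv f g ->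
  H1norm f = (Num.sqrt (sqnorm f + sqnorm g))%:E.
Proof.
move=> nf wg; have [sf wf] := H1P nf.
have /Lq01_2P s1 := wf.1; have /Lq01_2P s2 := wg.1.
rewrite /H1norm (L2norm01_sqnorm sf) (L2norm01_sqnorm s1) -EFinD/=.
by rewrite (sqnorm_ae s1 s2 (weak_deriv_uniq wf wg)).
Qed.

Lemma test_H1 phi : test_fun01 phi -> ncar H1 phi.
Proof.
move=> tp; split; last by exists (derive1 phi); exact: weak_deriv_test.
by apply/Lq01_2P; exact: square_itg_bm (test_bm tp).
Qed.

Lemma test_fun0 : test_fun01 (0 : R -> R).
Proof.
apply/test_fun01P; split; first exact: smooth_cst.
by exists (1/4), (3/4); split; [lra|lra|lra|move=> x; rewrite eqxx].
Qed.

Lemma H1norm0 : H1norm (0 : R -> R) = 0%E.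
Proof.
rewrite (H1normE (test_H1 test_fun0) (weak_deriv_test test_fun0)).
have d0 : derive1 (0 : R -> R) = 0.
  by apply/funext => x; rewrite derive1E; exact: derive_cst.
rewrite d0 /sqnorm; under eq_Rintegral do rewrite expr0n/=.
by rewrite Rintegral_cst// mul0r addr0 sqrtr0.
Qed.

Lemma test_H10 phi : test_fun01 phi -> H10 phi.
Proof.
move=> tp; split; first exact: test_H1.
by move=> e e0; exists phi; split => //; rewrite subrr H1norm0 lte_fin.
Qed.

End WeakDerivative.

(** * The dual space H^-1(0,1) *)

Section NegativeSobolev.
Context {R : realType}.
Local Notation mu := (@lebesgue_measure R).
Local Notation I01 := (`]0, 1[%classic : set R).
Implicit Types (f g h phi psi : R -> R) (F G : (R -> R) -> R).

Let mI : measurable I01. Proof. exact: measurable_itv. Qed.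

Lemma sqnormZ (r : R) f : square_itg f -> sqnorm (r *: f) = r ^+ 2 * sqnorm f.
Proof.
move=> [_ fi]; rewrite /sqnorm -RintegralZl//.
by apply: eq_Rintegral => x _; exact: exprMn.
Qed.

Lemma H1_0 : ncar H1 (0 : R -> R).
Proof. exact: test_H1 test_fun0. Qed.

Lemma H1Z (r : R) f : ncar H1 f -> ncar H1 (r *: f).
Proof. by move=> nf; have := H1_lin r nf H1_0; rewrite addr0. Qed.

Lemma weak_derivZ (r : R) f g : ncar H1 f -> is_weak_deriv f g -> is_weak_deriv (r *: f) (r *: g).
Proof.
move=> nf wg; have [sf _] := H1P nf.
have w0 := weak_deriv_lin r sf (square_itg_bm (test_bm test_fun0)) wg (weak_deriv_test test_fun0).
have d0 : derive1 (0 : R -> R) = 0.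
  by apply/funext => x; rewrite derive1E; exact: derive_cst.
by rewrite d0 !addr0 in w0.
Qed.

Lemma H1normZ (r : R) f : ncar H1 f -> H1norm (r *: f) = (`|r|%:E * H1norm f)%E.
Proof.
move=> nf; have [sf wf] := H1P nf; have /Lq01_2P sw := wf.1.
rewrite (H1normE nf wf) (H1normE (H1Z r nf) (weak_derivZ r nf wf)) !sqnormZ//.
by rewrite -mulrDr sqrtrM ?sqr_ge0// sqrtr_sqr EFinM.
Qed.

Lemma H10Z (r : R) f : H10 f -> H10 (r *: f).
Proof.
move=> [nf fa]; split; first exact: H1Z.
move=> e e0; have r1 : 0 < `|r| + 1 by rewrite ltr_wpDl.
have [|phi [tp pe]] := fa (e / (`|r| + 1)); first exact: divr_gt0.
exists (r *: phi); split; first exact: testZ.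
have nfp : ncar H1 (f - phi).
  by have := H1_lin (-1) (test_H1 tp) nf; rewrite scaleN1r addrC.
rewrite -scalerBr H1normZ//; have [sf wf] := H1P nfp.
move: pe; rewrite (H1normE nfp wf) -EFinM !lte_fin => pe.
rewrite (le_lt_trans (ler_wpM2l (normr_ge0 r) (ltW pe)))//.
by rewrite mulrCA -[ltRHS]mulr1 ltr_pM2l// ltr_pdivrMr// mul1r ltrDl.
Qed.

(** The dual norm sees only the unit ball, so functions are first scaled into it; dividing by N + 1
    avoids a case distinction on N = 0. *)
Lemma H10_scale f : H10 f -> exists r : R, [/\ 0 < r, H10 (r *: f) & (H1norm (r *: f) <= 1)%E].
Proof.
move=> hf; have [nf _] := hf; have [sf wf] := H1P nf.
have := H1normE nf wf; set N := Num.sqrt _ => NE.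
have N0 : 0 <= N by exact: sqrtr_ge0.
have N1 : 0 < N + 1 by rewrite ltr_wpDl.
exists (N + 1)^-1; split; [by rewrite invr_gt0|exact: H10Z|].
rewrite H1normZ// NE -EFinM lee_fin gtr0_norm ?invr_gt0// mulrC ler_pdivrMr// mul1r.
by rewrite lerDl.
Qed.

Lemma H1_pairing_le f psi (S : R) : ncar H1 f -> bounded_meas psi -> 0 < S ->
  sqnorm psi <= S ^+ 2 -> (`|pairing f psi|%:E <= H1norm f * S%:E)%E.
Proof.
move=> nf bp S0 pS; have [sf wf] := H1P nf.
rewrite (H1normE nf wf) -EFinM lee_fin; apply: cauchy_schwarz => //.
  exact: square_itg_bm.
by rewrite sqr_sqrtr ?lerDl ?addr_ge0 ?sqnorm_ge0.
Qed.

Lemma Hm1norm_ub F phi : H10 phi -> (H1norm phi <= 1)%E -> (`|F phi|%:E <= Hm1norm F)%E.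
Proof. by move=> h1 h2; apply: ereal_sup_ubound; exists phi. Qed.

Lemma Hm1norm_le F M : (forall phi, H10 phi -> (H1norm phi <= 1)%E -> (`|F phi|%:E <= M)%E) ->
  (Hm1norm F <= M)%E.
Proof. by move=> h; apply: ge_ereal_sup => _ [phi [h1 h2] <-]; exact: h. Qed.

Lemma Hm1norm_ge0 F : (0 <= Hm1norm F)%E.
Proof.
apply: (@le_trans _ _ (`|F 0|%:E)); first by rewrite lee_fin.
by apply: Hm1norm_ub; [exact: test_H10 test_fun0|rewrite H1norm0].
Qed.

Lemma Hm1normD F G : (Hm1norm (F + G)%R <= Hm1norm F + Hm1norm G)%E.
Proof.
apply: Hm1norm_le => phi h1 h2.
apply: (@le_trans _ _ (`|F phi|%:E + `|G phi|%:E)%E).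
  by rewrite -EFinD lee_fin; exact: ler_normD.
by apply: leeD; exact: Hm1norm_ub.
Qed.

Lemma Hm1normZ (r : R) F : (Hm1norm (r *: F)%R <= `|r|%:E * Hm1norm F)%E.
Proof.
apply: Hm1norm_le => phi h1 h2.
apply: (@le_trans _ _ (`|r|%:E * `|F phi|%:E)%E).
  by rewrite -EFinM lee_fin -normrM.
by apply: lee_wpmul2l; [rewrite lee_fin|exact: Hm1norm_ub].
Qed.

Lemma Hm1norm0 : Hm1norm (0 : (R -> R) -> R) = 0%E.
Proof.
apply/eqP; rewrite eq_le Hm1norm_ge0 andbT; apply: Hm1norm_le => phi _ _.
by rewrite lee_fin normr0.
Qed.

Lemma Hm1_lin (r : R) F G : ncar Hm1 F -> ncar Hm1 G -> ncar Hm1 (r *: F + G).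
Proof.
move=> [lF nF] [lG nG]; split.
  move=> c phi psi h1 h2.
  have E chi : (r *: F + G) chi = r * F chi + G chi by [].
  by rewrite !E lF// lG//; ring.
apply: (le_lt_trans (Hm1normD _ _)); apply: lte_add_pinfty => //.
by apply: (le_lt_trans (Hm1normZ _ _)); apply: lte_mul_pinfty.
Qed.

Lemma Hm1_0 : ncar Hm1 (0 : (R -> R) -> R).
Proof.
split; last by rewrite Hm1norm0.
by move=> c phi psi _ _; rewrite -[RHS]/(c * 0 + 0) mulr0 addr0.
Qed.

Lemma Hm1_homog F phi (r : R) : ncar Hm1 F -> H10 phi -> F (r *: phi) = r * F phi.
Proof.
move=> [lF _] hp; have h0 := test_H10 test_fun0 : H10 (0 : R -> R).
have F0 : F 0 = 0.
  have := lF 1 0 0 h0 h0; rewrite addr0 scaler0 mul1r => /eqP.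
  by rewrite -subr_eq subrr eq_sym => /eqP.
by have := lF r phi 0 hp h0; rewrite !addr0 F0 addr0.
Qed.

(** Homogeneity of [F] at [phi] suffices, membership in [Hm1] is not asked. Residuals of the
    equation can therefore be inserted directly. *)
Lemma Hm1_test_bound phi : test_fun01 phi -> exists2 C : R, 0 <= C & forall F,
  (forall r : R, F (r *: phi) = r * F phi) -> (`|F phi|%:E <= C%:E * Hm1norm F)%E.
Proof.
move=> tp; have [r [r0 h1 h2]] := H10_scale (test_H10 tp).
exists r^-1 => [|F hF]; first by rewrite invr_ge0 ltW.
apply: (@le_trans _ _ (r^-1%:E * `|F (r *: phi)|%:E)%E).
  by rewrite -EFinM lee_fin hF normrM gtr0_norm// mulKf// gt_eqF.
by apply: lee_wpmul2l; [rewrite lee_fin invr_ge0 ltW|exact: Hm1norm_ub].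
Qed.

(** This functional extends the distribution f'' from test functions to H^1_0, by one integration by
    parts; the Cauchy-Schwarz inequality bounds it. It is the witness behind [dxx]. *)
Lemma weak_deriv_dual f : ncar H1 f ->
  ncar Hm1 (fun phi => - \int[mu]_(x in I01) (weak_deriv f x * weak_deriv phi x)).
Proof.
move=> nf; have [sf wf] := H1P nf; have /Lq01_2P s1 := wf.1.
split=> [c phi psi [np _] [nq _]|].
  have [sp wp] := H1P np; have [sq wq] := H1P nq.
  have /Lq01_2P s2 := wp.1; have /Lq01_2P s3 := wq.1.
  have [sl wl] := H1P (H1_lin c np nq); have /Lq01_2P s4 := wl.1.
  have j2 := square_itg_mul s1 s2; have j3 := square_itg_mul s1 s3; have j4 := square_itg_mul s1 s4.
  have jc := @itgZ _ _ _ mu _ mI c _ j2.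
  rewrite mulrN -opprD -RintegralZl// -RintegralD//; congr (- _).
  apply: Rint_ae_eq => //; first exact: itg_meas j4.
    by apply: itg_meas; exact: (@itgD _ _ _ mu _ mI).
  have := weak_deriv_uniq wl (weak_deriv_lin c sp sq wp wq).
  by apply: aeS => x h xI; rewrite h// mulrDr mulrCA.
pose A := Num.sqrt (sqnorm (weak_deriv f)).
apply: (@le_lt_trans _ _ A%:E); last exact: ltry.
apply: Hm1norm_le => phi [np _] np1; have [sp wp] := H1P np; have /Lq01_2P s2 := wp.1.
rewrite lee_fin normrN -[leRHS]mulr1 /A; apply: cauchy_schwarz => //.
  by rewrite sqr_sqrtr ?sqnorm_ge0.
move: np1; rewrite (H1normE np wp) lee_fin expr1n -[leRHS]sqrtr1 ler_sqrt//.
by apply: le_trans; rewrite lerDr sqnorm_ge0.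
Qed.

Lemma dxxP f : ncar H1 f -> ncar Hm1 (dxx f) /\ forall phi, test_fun01 phi ->
  dxx f phi = pairing f (derive1 (derive1 phi)).
Proof.
move=> nf; have [sf wf] := H1P nf; have /Lq01_2P s1 := wf.1.
apply: (@xgetPex _ 0 [set F | ncar Hm1 F /\ forall phi, test_fun01 phi ->
    F phi = \int[mu]_(x in I01) (f x * derive1n 2 phi x)]).
exists (fun phi => - \int[mu]_(x in I01) (weak_deriv f x * weak_deriv phi x)).
split; first exact: weak_deriv_dual.
move=> phi tp; have [sp wp] := H1P (test_H1 tp); have /Lq01_2P s2 := wp.1.
have sd := square_itg_bm (test_bm (test_derive tp)).
have -> : \int[mu]_(x in I01) (f x * derive1n 2 phi x) = pairing f (derive1 (derive1 phi)) by [].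
rewrite /pairing (wf.2 _ (test_derive tp)); congr (- _).
apply: Rint_ae_eq => //.
- exact: itg_meas (square_itg_mul s1 s2).
- exact: itg_meas (square_itg_mul s1 sd).
have := weak_deriv_uniq wp (weak_deriv_test tp).
by apply: aeS => x h xI; rewrite h.
Qed.

End NegativeSobolev.

(** * Bochner integrals *)

Section SimpleFunctions.
Context {R : realType} {V : lmodType R}.
Variable X : nspace V.
Local Notation mu := (@lebesgue_measure R).
Hypothesis X0 : ncar X 0.
Hypothesis Xlin : forall (r : R) v w, ncar X v -> ncar X w -> ncar X (r *: v + w).
Hypothesis Xge0 : forall v, (0 <= nnorm X v)%E.
Hypothesis Xfin : forall v, ncar X v -> (nnorm X v < +oo)%E.
Hypothesis XD : forall v w, (nnorm X (v + w)%R <= nnorm X v + nnorm X w)%E.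
Hypothesis XZ : forall (r : R) v, (nnorm X (r *: v)%R <= `|r|%:E * nnorm X v)%E.

Definition rnorm v := fine (nnorm X v).

Lemma rnormE v : ncar X v -> nnorm X v = (rnorm v)%:E.
Proof. by move=> nv; rewrite fineK// ge0_fin_numE ?Xge0// Xfin. Qed.

Lemma rnorm_ge0 v : 0 <= rnorm v.
Proof. exact: fine_ge0. Qed.

Lemma ncarZ (r : R) v : ncar X v -> ncar X (r *: v).
Proof. by move=> nv; have := Xlin r nv X0; rewrite addr0. Qed.

Lemma ncarD v w : ncar X v -> ncar X w -> ncar X (v + w).
Proof. by move=> nv nw; have := Xlin 1 nv nw; rewrite scale1r. Qed.

Lemma ncarN v : ncar X v -> ncar X (- v).
Proof. by move=> nv; have := ncarZ (-1) nv; rewrite scaleN1r. Qed.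

Lemma ncarB v w : ncar X v -> ncar X w -> ncar X (v - w).
Proof. by move=> nv nw; apply: ncarD => //; exact: ncarN. Qed.

Lemma rnormD v w : ncar X v -> ncar X w -> rnorm (v + w) <= rnorm v + rnorm w.
Proof.
move=> nv nw; have := XD v w; rewrite (rnormE nv) (rnormE nw) (rnormE (ncarD nv nw)).
by rewrite -EFinD lee_fin.
Qed.

Lemma rnormZ (r : R) v : ncar X v -> rnorm (r *: v) <= `|r| * rnorm v.
Proof.
move=> nv; have := XZ r v; rewrite (rnormE nv) (rnormE (ncarZ r nv)).
by rewrite -EFinM lee_fin.
Qed.

Lemma rnormB v w : ncar X v -> ncar X w -> rnorm (v - w) <= rnorm v + rnorm w.
Proof.
move=> nv nw; apply: (le_trans (rnormD nv (ncarN nw))); rewrite lerD2l.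
by have := rnormZ (-1) nw; rewrite scaleN1r normrN1 mul1r.
Qed.

Lemma rnorm_distC v w : ncar X v -> ncar X w -> rnorm (v - w) = rnorm (w - v).
Proof.
have h v' w' : ncar X v' -> ncar X w' -> rnorm (v' - w') <= rnorm (w' - v').
  move=> nv nw; have := rnormZ (-1) (ncarB nw nv).
  by rewrite scaleN1r normrN1 mul1r opprB.
by move=> nv nw; apply/eqP; rewrite eq_le !h.
Qed.

Lemma rnorm_dist v w : ncar X v -> ncar X w -> `|rnorm v - rnorm w| <= rnorm (v - w).
Proof.
move=> nv nw; have h1 := rnormD (ncarB nv nw) nw; rewrite subrK in h1.
have h2 := rnormD (ncarB nw nv) nv; rewrite subrK in h2.
rewrite (rnorm_distC nw nv) in h2.
by rewrite ler_norml; apply/andP; split; move: h1 h2; lra.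
Qed.

Lemma sfun_eval_cons c s t : sfun_eval (c :: s) t = \1_(c.1) t *: c.2 + sfun_eval s t :> V.
Proof. by rewrite /sfun_eval big_cons. Qed.

Lemma sfun_eval_cat s1 s2 t : sfun_eval (s1 ++ s2) t = sfun_eval s1 t + sfun_eval s2 t :> V.
Proof. by rewrite /sfun_eval big_cat. Qed.

Lemma sfun_valid_cons c s : sfun_valid X (c :: s) -> (measurable c.1 /\ ncar X c.2) /\ sfun_valid X s.
Proof.
move=> h; split; first by apply: h; rewrite mem_head.
by move=> c' c's; apply: h; rewrite in_cons c's orbT.
Qed.

Lemma sfun_eval_ncar s t : sfun_valid X s -> ncar X (sfun_eval s t).
Proof.
elim: s => [_|c s IH /sfun_valid_cons[[_ nc] vs]]; first by rewrite /sfun_eval big_nil.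
by rewrite sfun_eval_cons; apply: Xlin => //; exact: IH.
Qed.

(** A simple function takes finitely many values on measurable pieces, so no condition on [Phi] is
    needed. The induction splits along the first piece and shifts the argument of [Phi]. *)
Lemma measurable_sfun_eval (Phi : V -> R) s : sfun_valid X s ->
  measurable_fun setT (fun t => Phi (sfun_eval s t)).
Proof.
elim: s Phi => [Phi _|c s IH Phi /sfun_valid_cons[[mc _] vs]].
  by under eq_fun do rewrite /sfun_eval big_nil; exact: measurable_cst.
rewrite (_ : (fun t => _) = (fun t => \1_(c.1) t * Phi (c.2 + sfun_eval s t) +
    (1 - \1_(c.1) t) * Phi (sfun_eval s t))); last first.
  apply/funext => t; rewrite sfun_eval_cons indicE; case: (t \in c.1).
    by rewrite scale1r mul1r subrr mul0r addr0.
  by rewrite scale0r add0r mul0r add0r subr0 mul1r.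
have m1 : measurable_fun setT (\1_(c.1) : R -> R) := (bounded_meas_indic mc).1.
apply: measurable_funD; apply: measurable_funM => //.
- exact: (IH (fun v => Phi (c.2 + v)) vs).
- by apply: measurable_funB => //; exact: measurable_cst.
- exact: (IH Phi vs).
Qed.

Definition sfun_opp (s : seq (set R * V)) := [seq (c.1, - c.2) | c <- s].

Lemma sfun_eval_opp s t : sfun_eval (sfun_opp s) t = - sfun_eval s t.
Proof.
rewrite /sfun_eval /sfun_opp big_map -sumrN; apply: eq_bigr => c _.
by rewrite scalerN.
Qed.

Lemma sfun_valid_cat s1 s2 : sfun_valid X s1 -> sfun_valid X s2 -> sfun_valid X (s1 ++ s2).
Proof. by move=> h1 h2 c; rewrite mem_cat => /orP[/h1|/h2]. Qed.

Lemma sfun_valid_opp s : sfun_valid X s -> sfun_valid X (sfun_opp s).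
Proof. by move=> h _ /mapP[c cs ->]; have [mc nc] := h c cs; split => //; exact: ncarN. Qed.

Lemma measurable_sfun_dist s1 s2 : sfun_valid X s1 -> sfun_valid X s2 ->
  measurable_fun setT (fun t => rnorm (sfun_eval s1 t - sfun_eval s2 t)).
Proof.
move=> h1 h2; have := measurable_sfun_eval rnorm (sfun_valid_cat h1 (sfun_valid_opp h2)).
by under eq_fun do rewrite sfun_eval_cat sfun_eval_opp.
Qed.

Lemma cvg_rnorm_dist (v w : nat -> V) (a : V) (b : V) : (forall n, ncar X (v n)) -> ncar X a -> ncar X b ->
  rnorm (a - v n) @[n --> \oo] --> 0 -> rnorm (v n - b) @[n --> \oo] --> rnorm (a - b).
Proof.
move=> nv na nb h; apply/cvgrPdist_le => e e0.
move/cvgrPdist_le : h => /(_ e e0); apply: filterS => n.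
rewrite sub0r normrN ger0_norm ?rnorm_ge0// => h.
apply: le_trans (rnorm_dist (ncarB na nb) (ncarB (nv n) nb)) _.
by rewrite opprB addrA subrK.
Qed.

(** Almost everywhere the norm is the limit of the norms along the simple approximation. The upper
    limit of those measurable functions is defined everywhere, and the absolute value keeps it
    nonnegative on the exceptional set. *)
Lemma measurable_norm (D : set R) F s : strongly_measurable X D F -> sfun_valid X s ->
  exists N : R -> R, [/\ measurable_fun setT N, forall t, 0 <= N t &
    \forall t \ae mu, D t -> nnorm X (F t - sfun_eval s t) = (N t)%:E].
Proof.
move=> [Fcar [r [vr cr]]] vs.
pose N t := `|fine (limn_esup (fun m => (rnorm (sfun_eval (r m) t - sfun_eval s t))%:E))|.
exists N; split; [|by move=> t; exact: normr_ge0|].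
  apply: measurableT_comp => //; apply: (measurableT_comp (f := fine)) => //.
  apply: measurable_fun_limn_esup => m; apply/measurable_EFinP.
  exact: measurable_sfun_dist.
apply: aeS (aeI Fcar cr) => t [nF c] Dt; have nFt := nF Dt.
have nr m := sfun_eval_ncar t (vr m); have ns := sfun_eval_ncar t vs.
have c' : rnorm (F t - sfun_eval (r m) t) @[m --> \oo] --> 0 by exact: (fine_cvg (c Dt)).
have h := cvg_rnorm_dist (fun=> 0) nr nFt ns c'.
have hE : (rnorm (sfun_eval (r m) t - sfun_eval s t))%:E @[m --> \oo] -->
  (rnorm (F t - sfun_eval s t))%:E by apply: cvg_EFin => //; exact: nearW.
rewrite /N (cvg_limn_einf_sup hE).2/= ger0_norm ?rnorm_ge0//.
by apply: rnormE; exact: ncarB.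
Qed.

Import HBNNSimple.

(** Each piece is cut along the level sets of the scalar factor, on which multiplication by it is
    multiplication by a constant. *)
Lemma sfun_scale (k : {nnsfun R >-> R}) s : sfun_valid X s ->
  exists s', sfun_valid X s' /\ forall t, sfun_eval s' t = k t *: sfun_eval s t.
Proof.
elim: s => [_|c s IH /sfun_valid_cons[[mc nc] /IH[s' [vs' es']]]].
  by exists [::]; split => // t; rewrite /sfun_eval !big_nil scaler0.
pose ys := finmap.enum_fset (fset_set (range k)).
pose h := [seq (c.1 `&` k @^-1` [set y], y *: c.2) | y <- ys].
exists (h ++ s'); split.
  apply: sfun_valid_cat => // _ /mapP[y _ ->]; split; last exact: ncarZ.
  by apply: measurableI => //; exact: measurable_sfunP.
move=> t; rewrite sfun_eval_cat es' sfun_eval_cons scalerDr; congr (_ + _).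
have fr : finite_set (range k) by exact: fimfunP.
have kE : k t = \sum_(y <- ys) y * \1_(k @^-1` [set y]) t.
  by rewrite [LHS]fimfunE fsbig_finite.
rewrite [in RHS]kE scaler_suml /sfun_eval /h big_map; apply: eq_bigr => y _.
by rewrite !scalerA indicI/= mulrC mulrA mulrAC.
Qed.

(** The scalar factor is approximated by simple functions from below, the vector part by its own
    simple functions truncated where they exceed twice the norm of [g]. The errors are then
    dominated by 3 kap N, so that convergence almost everywhere becomes convergence of integrals. *)
Lemma bochner_approx (D : set R) (kap N : R -> R) g : measurable D ->
  measurable_fun setT kap -> (forall t, 0 <= kap t) -> strongly_measurable X D g ->
  measurable_fun setT N -> (forall t, 0 <= N t) ->
  (\forall t \ae mu, D t -> nnorm X (g t) = (N t)%:E) ->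
  mu.-integrable D (EFin \o (fun t => kap t * N t)) ->
  exists (s : nat -> seq (set R * V)) (E : nat -> R -> R),
    [/\ forall n, sfun_valid X (s n), strongly_measurable X D (fun t => kap t *: g t),
      (forall n, mu.-integrable D (EFin \o E n) /\ \forall t \ae mu, D t ->
        nnorm X (kap t *: g t - sfun_eval (s n) t) = (E n t)%:E) &
      \int[mu]_(t in D) E n t @[n --> \oo] --> 0].
Proof.
move=> mD mk k0 sg mN N0 gN' ikN; have [gcar [r [vr cr]]] := sg.
have mEk : measurable_fun setT (EFin \o kap) by exact/measurable_EFinP.
pose q := nnsfun_approx measurableT mEk.
have qcvg x : q n x @[n --> \oo] --> kap x.
  have := @cvg_nnsfun_approx _ _ _ setT measurableT (EFin \o kap) mEk _ x I.
  by move=> /(_ (fun x _ => k0 x)); exact: fine_cvg.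
have qk n x : q n x <= kap x.
  have nd := @nd_nnsfun_approx _ _ _ setT measurableT (EFin \o kap) mEk.
  have cx : cvgn (q ^~ x) by apply/cvg_ex; exists (kap x); exact: qcvg.
  rewrite -(cvg_lim _ (qcvg x))//; apply: nondecreasing_cvgn_le => //.
  by move=> m k mk'; have /lefP := nd _ _ mk'; exact.
(* Without this truncation the approximants of [g] need not be dominated by any integrable
   function. *)
pose B n := [set t | rnorm (sfun_eval (r n) t) <= 2 * N t].
have mB n : measurable (B n).
  have m1 := measurable_sfun_eval rnorm (vr n).
  have m2 : measurable_fun setT (fun t => 2 * N t) by exact: measurable_funM.
  by have := measurable_fun_le measurableT m1 m2; rewrite setTI.
pose kB n := mul_nnsfun (q n) (indic_nnsfun R (mB n)).
have kBE n t : kB n t = q n t * \1_(B n) t by [].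
have /choice[s sP] : forall n, exists s', sfun_valid X s' /\
  forall t, sfun_eval s' t = kB n t *: sfun_eval (r n) t.
  by move=> n; exact: sfun_scale.
have vs n : sfun_valid X (s n) by have [] := sP n.
have main : \forall t \ae mu, D t -> [/\ ncar X (kap t *: g t),
    (forall n, rnorm (kap t *: g t - sfun_eval (s n) t) <= 3 * (kap t * N t)) &
    rnorm (kap t *: g t - sfun_eval (s n) t) @[n --> \oo] --> 0].
  apply: aeS (aeI gN' (aeI gcar cr)) => t [gn [nc c]] Dt.
  have ng := nc Dt; have nr n := sfun_eval_ncar t (vr n).
  have {}gn : rnorm (g t) = N t by rewrite /rnorm gn.
  have {}c : rnorm (g t - sfun_eval (r n) t) @[n --> \oo] --> 0 by exact: (fine_cvg (c Dt)).
  have kg : ncar X (kap t *: g t) by exact: ncarZ.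
  have bnd n : rnorm (kap t *: g t - sfun_eval (s n) t) <= 3 * (kap t * N t).
    have [_ ->] := sP n.
    apply: le_trans (rnormB kg (ncarZ (kB n t) (nr n))) _.
    have h1 := rnormZ (kap t) ng; rewrite ger0_norm// gn in h1.
    have h2 := rnormZ (kB n t) (nr n).
    have h3 : `|kB n t| * rnorm (sfun_eval (r n) t) <= kap t * (2 * N t).
      rewrite kBE indicE; case: (boolP (t \in B n)) => [|_].
        rewrite inE => tB; rewrite mulr1 ger0_norm//.
        by rewrite ler_pM// rnorm_ge0.
      by rewrite mulr0 normr0 mul0r !mulr_ge0.
    by move: h1 h2 h3; lra.
  split => //; have [Nt0|Nt0] := eqVneq (N t) 0.
    rewrite (_ : (fun n => _) = (fun=> 0)); first exact: cvg_cst.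
    apply/funext => n; apply/eqP; rewrite eq_le rnorm_ge0 andbT.
    by apply: le_trans (bnd n) _; rewrite Nt0 !mulr0.
  have Ntp : 0 < N t by rewrite lt_neqAle eq_sym Nt0 N0.
  have near_in : \forall n \near \oo, B n t.
    move/cvgrPdist_le : c => /(_ _ Ntp); apply: filterS => n.
    rewrite sub0r normrN ger0_norm ?rnorm_ge0// => h.
    have h1 := rnormB ng (ncarB ng (nr n)); rewrite opprB addrC subrK gn in h1.
    by rewrite /B/=; move: h h1; lra.
  apply: (@squeeze_cvgr _ _ _ _ (fun=> 0)
      (fun n => (kap t - q n t) * N t + kap t * rnorm (g t - sfun_eval (r n) t))).
  - apply: filterS near_in => n Bn; rewrite rnorm_ge0/=.
    have [_ ->] := sP n; rewrite kBE indicE mem_set// mulr1.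
    have -> : kap t *: g t - q n t *: sfun_eval (r n) t =
        (kap t - q n t) *: g t + q n t *: (g t - sfun_eval (r n) t).
      by rewrite scalerBl scalerBr addrA subrK.
    apply: le_trans (rnormD (ncarZ _ ng) (ncarZ _ (ncarB ng (nr n)))) _.
    apply: lerD.
      by apply: le_trans (rnormZ _ ng) _; rewrite gn ger0_norm ?subr_ge0.
    apply: le_trans (rnormZ _ (ncarB ng (nr n))) _.
    by rewrite ger0_norm// ler_wpM2r ?rnorm_ge0.
  - exact: cvg_cst.
  - rewrite -[X in _ --> X]addr0 -[X in _ --> X + _](mul0r (N t)) -[X in _ --> _ + X](mulr0 (kap t)).
    apply: cvgD; last by apply: cvgMr.
    apply: cvgMl; rewrite -(subrr (kap t)); apply: cvgB; first exact: cvg_cst.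
    exact: qcvg.
have skg : strongly_measurable X D (fun t => kap t *: g t).
  split; first by apply: aeS main => t h /h[].
  exists s; split => //; apply: aeS main => t h /h[nk _ c].
  have nE n : nnorm X (kap t *: g t - sfun_eval (s n) t) = (rnorm (kap t *: g t - sfun_eval (s n) t))%:E.
    by apply: rnormE; apply: ncarB => //; exact: sfun_eval_ncar.
  by under eq_cvg do rewrite nE; apply: cvg_EFin => //; exact: nearW.
have /choice[E EP] : forall n, exists N : R -> R, [/\ measurable_fun setT N, forall t, 0 <= N t &
    \forall t \ae mu, D t -> nnorm X (kap t *: g t - sfun_eval (s n) t) = (N t)%:E].
  by move=> n; exact: measurable_norm.
pose G t := 3 * (kap t * N t).
have iG : mu.-integrable D (EFin \o G) by exact: (@itgZ _ _ _ mu _ mD).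
have mG : measurable_fun setT G by do 2 apply: measurable_funM => //.
(* The error functions are known only almost everywhere; the minimum with [G] makes the domination
   hold at every point. *)
pose E' n t := Num.min (E n t) (G t).
have mE' n : measurable_fun D (E' n).
  by have [mE _ _] := EP n; apply: measurable_funTS; exact: measurable_minr.
have G0 t : 0 <= G t by rewrite /G !mulr_ge0.
have E'0 n t : 0 <= E' n t by have [_ E0 _] := EP n; rewrite /E' le_min E0 G0.
have E'E : \forall t \ae mu, D t -> (forall n, nnorm X (kap t *: g t - sfun_eval (s n) t) = (E' n t)%:E)
    /\ E' n t @[n --> \oo] --> 0.
  have h : \forall t \ae mu, forall n, D t -> nnorm X (kap t *: g t - sfun_eval (s n) t) = (E n t)%:E.
    by apply: ae_forall => n; have [] := EP n.
  apply: aeS (aeI main h) => t [m {}h] Dt; have [nk bk ck] := m Dt.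
  have EE n : E n t = rnorm (kap t *: g t - sfun_eval (s n) t) by rewrite /rnorm h.
  have E'n n : E' n t = E n t by rewrite /E' min_l// EE bk.
  split; first by move=> n; rewrite E'n h.
  by under eq_cvg do rewrite E'n EE.
exists s, E'; split => // [n|].
  split; last by apply: aeS E'E => t h /h[].
  by apply: (@itg_le _ _ _ mu _ mD _ G (mE' n) _ iG) => t _; rewrite ger0_norm// /E' ge_min lexx orbT.
have ae0 : \forall x \ae mu, D x -> E' n x @[n --> \oo] --> (0 : R).
  by apply: (aeS _ E'E) => x h Dx; have [_] := h Dx.
have E'G m x : D x -> `|E' m x| <= G x.
  by move=> _; rewrite ger0_norm// /E' ge_min lexx orbT.
have m0 : measurable_fun D (fun=> 0 : R) by [].
have [_ c] := @Rint_dominated _ _ _ mu D mD E' (fun=> 0) G mE' m0 ae0 iG E'G.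
have -> : 0 = \int[mu]_(t in D) (0 : R).
  rewrite (_ : (fun=> 0) = (fun x : R => 0 * 0)); last by apply/funext => x; rewrite mul0r.
  by rewrite RintegralZl ?mul0r//; exact: (@itg0 _ _ _ mu _).
exact: c.
Qed.

End SimpleFunctions.

(** * Existence and evaluation of Bochner integrals in H^-1 *)

Section DualBochner.
Context {R : realType}.
Local Notation mu := (@lebesgue_measure R).
Implicit Types (phi psi : R -> R) (F v : (R -> R) -> R) (D : set R).

Let Hfin F : ncar Hm1 F -> (nnorm Hm1 F < +oo)%E. Proof. by case. Qed.

Let evZ (r : R) F phi : (r *: F) phi = r * F phi. Proof. by []. Qed.
Let evD F G phi : (F + G) phi = F phi + G phi. Proof. by []. Qed.
Let evB F G phi : (F - G) phi = F phi - G phi. Proof. by []. Qed.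

Lemma sfun_integral_app D (s : seq (set R * ((R -> R) -> R))) phi :
  measurable D -> (mu D < +oo)%E -> sfun_valid Hm1 s ->
  mu.-integrable D (EFin \o (fun t => sfun_eval s t phi)) /\
  sfun_integral D s phi = \int[mu]_(t in D) (sfun_eval s t phi).
Proof.
move=> mD fD; elim: s => [_|c s IH /sfun_valid_cons[[mc nc] /IH[i1 e1]]].
  have E t : sfun_eval ([::] : seq (set R * ((R -> R) -> R))) t phi = 0 by rewrite /sfun_eval big_nil.
  rewrite /sfun_integral big_nil; split.
    have -> : (fun t => sfun_eval ([::] : seq (set R * ((R -> R) -> R))) t phi) = (fun=> 0) by exact/funext.
    exact: (@itg0 _ _ _ mu D).
  under eq_Rintegral do rewrite E.
  by rewrite Rintegral_cst// mul0r.
have E t : sfun_eval (c :: s) t phi = c.2 phi * \1_(c.1) t + sfun_eval s t phi.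
  by rewrite sfun_eval_cons evD evZ mulrC.
have i2 : mu.-integrable D (EFin \o (\1_(c.1) : R -> R)).
  apply: (@fin_meas_itg _ _ _ mu D mD _ 1).
  - exact: fD.
  - exact: measurable_funTS (bounded_meas_indic mc).1.
  - by move=> x _; exact: norm_indic_le1.
have i3 := @itgZ _ _ _ mu D mD (c.2 phi) _ i2.
split.
  by apply: eq_integrable (@itgD _ _ _ mu D mD _ _ i3 i1) => // t _ /=; rewrite E.
under eq_Rintegral do rewrite E.
rewrite RintegralD// RintegralZl// -e1 /sfun_integral big_cons evD evZ mulrC.
by rewrite /Rintegral integral_indic// setIC.
Qed.

Lemma sfun_integral_ncar D (s : seq (set R * ((R -> R) -> R))) :
  sfun_valid Hm1 s -> ncar Hm1 (sfun_integral D s).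
Proof.
elim: s => [_|c s IH /sfun_valid_cons[[_ nc] /IH n]].
  by rewrite /sfun_integral big_nil; exact: Hm1_0.
by rewrite /sfun_integral big_cons; exact: Hm1_lin.
Qed.

(** Completeness of a dual space, carried out by hand: integrals of the simple approximations are
    uniformly Cauchy on the unit ball of H^1_0, their pointwise limit is linear on H^1_0, and the
    same uniform bound gives convergence in the dual norm. *)
Lemma bochner_exists D (kap N : R -> R) (g : R -> (R -> R) -> R) : measurable D -> (mu D < +oo)%E ->
  measurable_fun setT kap -> (forall t, 0 <= kap t) -> strongly_measurable Hm1 D g ->
  measurable_fun setT N -> (forall t, 0 <= N t) ->
  (\forall t \ae mu, D t -> nnorm Hm1 (g t) = (N t)%:E) ->
  mu.-integrable D (EFin \o (fun t => kap t * N t)) ->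
  exists v, is_bochner_integral Hm1 D (fun t => kap t *: g t) v.
Proof.
move=> mD fD mk k0 sg mN N0 gN ikN.
have [s [E [vs skg EP E0]]] := bochner_approx Hm1_0 (@Hm1_lin R) (@Hm1norm_ge0 R) Hfin
  (@Hm1normD R) (@Hm1normZ R) mD mk k0 sg mN N0 gN ikN.
pose J n := sfun_integral D (s n); pose e n := \int[mu]_(t in D) E n t.
have nJ n : ncar Hm1 (J n) by exact: sfun_integral_ncar.
have Jd phi n m : H10 phi -> (H1norm phi <= 1)%E -> `|J m phi - J n phi| <= e m + e n.
  move=> hp p1; have [im Im] := sfun_integral_app phi mD fD (vs m).
  have [jn In] := sfun_integral_app phi mD fD (vs n); rewrite /J Im In.
  have [iEm Em] := EP m; have [iEn En] := EP n.
  rewrite -RintegralB// /e -RintegralD//; apply: le_Rint_norm_ae => //.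
  - exact: (@itgB _ _ _ mu D mD).
  - exact: (@itgD _ _ _ mu D mD).
  apply: aeS (aeI Em En) => t [hm hn] Dt.
  have bm := Hm1norm_ub (kap t *: g t - sfun_eval (s m) t) hp p1.
  have bn := Hm1norm_ub (kap t *: g t - sfun_eval (s n) t) hp p1.
  move: bm bn; rewrite [Hm1norm _](hm Dt) [X in _ -> (_ <= X)%E -> _](hn Dt) !lee_fin !evB.
  move: ((kap t *: g t) phi) (sfun_eval (s m) t phi) (sfun_eval (s n) t phi) => x y z h1 h2.
  rewrite (_ : y - z = (x - z) - (x - y)); last by ring.
  by apply: le_trans (ler_normB _ _) _; rewrite addrC lerD.
have e0 : e n @[n --> \oo] --> 0 by [].
(* The Cauchy estimate holds on the unit ball only; other functions are scaled into it and back by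
   homogeneity. *)
have Jc phi : H10 phi -> cvgn (fun n => J n phi).
  move=> hp; have [r [r0 h1 h2]] := H10_scale hp.
  have c1 : cvgn (fun n => J n (r *: phi)).
    apply: cauchy_cvg; apply/cauchy_exP => eps eps0.
    have [m _ hm] : \forall n \near \oo, `|e n| < eps / 2.
      have /cvgrPdist_lt/(_ (eps / 2)) := e0; rewrite divr_gt0// => /(_ isT).
      by apply: filterS => n; rewrite sub0r normrN.
    exists (J m (r *: phi)); exists m => // n /= mn.
    rewrite /ball/=; apply: le_lt_trans (Jd (r *: phi) n m h1 h2) _.
    have g1 := hm m (leqnn m); have g2 := hm n mn.
    have := ler_norm (e m); have := ler_norm (e n); move: g1 g2 => /=; lra.
  have -> : (fun n => J n phi) = (fun n => r^-1 * J n (r *: phi)).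
    by apply/funext => n; rewrite (Hm1_homog r (nJ n) hp) mulKf// gt_eqF.
  by apply: is_cvgMr.
pose v phi := limn (fun n => J n phi).
have Jv phi : H10 phi -> J n phi @[n --> \oo] --> v phi by move=> hp; exact: Jc.
have vJ n phi : H10 phi -> (H1norm phi <= 1)%E -> `|v phi - J n phi| <= e n.
  move=> hp p1.
  have c1 : `|J m phi - J n phi| @[m --> \oo] --> `|v phi - J n phi|.
    by apply: cvg_norm; apply: cvgB; [exact: Jv|exact: cvg_cst].
  have c2 : (e m + e n) @[m --> \oo] --> 0 + e n.
    by apply: cvgD; [exact: e0|exact: cvg_cst].
  rewrite -(add0r (e n)); apply: (ler_cvg_to c1 c2).
  by apply: nearW => m; exact: Jd.
have vlin (c : R) phi psi : H10 phi -> H10 psi -> v (c *: phi + psi) = c * v phi + v psi.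
  move=> hp hq; apply/cvg_lim => //.
  have -> : (fun n => J n (c *: phi + psi)) = (fun n => c * J n phi + J n psi).
    by apply/funext => n; have [l _] := nJ n; exact: l.
  by apply: cvgD; [apply: cvgMr; exact: Jv|exact: Jv].
have nvJ n : (Hm1norm (v - J n)%R <= (e n)%:E)%E.
  by apply: Hm1norm_le => phi hp p1; rewrite lee_fin; exact: vJ.
have nv : ncar Hm1 v.
  split => //; have -> : v = (v - J 0%N) + J 0%N by rewrite subrK.
  apply: le_lt_trans (Hm1normD _ _) _; apply: lte_add_pinfty; last by have [] := nJ 0%N.
  by apply: le_lt_trans (nvJ 0%N) _; exact: ltry.
have e0E : (e n)%:E @[n --> \oo] --> 0%E by apply: cvg_EFin => //; exact: nearW.
exists v; split => //; split => //; exists s; split => //; split.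
  apply: (squeeze_cvge _ (cvg_cst 0%E) e0E); apply: nearW => n.
  rewrite integral_ge0; last by move=> t _; exact: Hm1norm_ge0.
  have [iE En] := EP n.
  have En0 : \forall t \ae mu, D t -> E n t = `|E n t|.
    apply: aeS En => t h Dt; rewrite ger0_norm// -lee_fin -(h Dt); exact: Hm1norm_ge0.
  have iEn := @itg_norm _ _ _ mu D _ iE.
  have -> : e n = \int[mu]_(t in D) `|E n t|.
    by apply: Rint_ae_eq En0 => //; [exact: itg_meas iE|exact: itg_meas iEn].
  rewrite /Rintegral fineK; last exact: integrable_fin_num.
  apply: le_nnintegral_ae => //.
  - by move=> t _; exact: Hm1norm_ge0.
  by apply: aeS En => t h Dt; rewrite (h Dt) lee_fin ler_norm.
apply: (squeeze_cvge _ (cvg_cst 0%E) e0E); apply: nearW => n.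
by rewrite [X in (0 <= X)%E]/= Hm1norm_ge0; exact: nvJ.
Qed.

(** At a function of the unit ball, evaluation does not increase the dual norm, so both defining
    limits of the Bochner integral pass to scalar integrals. [h] stands in for the evaluated
    integrand, whose measurability would otherwise be in question. *)
Lemma bochner_eval D (f : R -> (R -> R) -> R) v (h : R -> R) phi : measurable D -> (mu D < +oo)%E ->
  is_bochner_integral Hm1 D f v -> test_fun01 phi -> measurable_fun D h ->
  (\forall t \ae mu, D t -> f t phi = h t) -> v phi = \int[mu]_(t in D) h t.
Proof.
move=> mD fD [nv [[fcar _] [s [vs [s1 s2]]]]] tp mh fh.
have [r [r0 hp p1]] := H10_scale (test_H10 tp).
pose psi := r *: phi; pose k t := r * h t.
have mk : measurable_fun D k by exact: measurable_funM.
have fk : \forall t \ae mu, D t -> f t psi = k t.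
  apply: aeS (aeI fcar fh) => t [nf ff] Dt.
  by rewrite (Hm1_homog r (nf Dt) (test_H10 tp)) ff.
pose J n := sfun_integral D (s n) psi.
have Ji n : mu.-integrable D (EFin \o (fun t => sfun_eval (s n) t psi)) by
  have [] := sfun_integral_app psi mD fD (vs n).
have JE n : J n = \int[mu]_(t in D) (sfun_eval (s n) t psi) by
  have [] := sfun_integral_app psi mD fD (vs n).
pose del n := (\int[mu]_(t in D) nnorm Hm1 (f t - sfun_eval (s n) t))%E.
have dle n : (\int[mu]_(t in D) `|k t - sfun_eval (s n) t psi|%:E <= del n)%E.
  apply: le_nnintegral_ae => //.
  - by move=> t _; exact: Hm1norm_ge0.
  apply: aeS fk => t ft Dt; rewrite -ft//.
  exact: (Hm1norm_ub (f t - sfun_eval (s n) t) hp p1).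
have /fine_cvgP[dfin d0] := s1; have /fine_cvgP[efin e0] := s2.
have mks n : measurable_fun D (fun t => k t - sfun_eval (s n) t psi).
  by apply: measurable_funB => //; exact: itg_meas (Ji n).
(* A single approximant at finite distance suffices for integrability, since the approximant itself
   is integrable. *)
have ik : mu.-integrable D (EFin \o k).
  have [N _ /(_ N (leqnn N)) dN] := dfin.
  have id : mu.-integrable D (EFin \o (fun t => k t - sfun_eval (s N) t psi)).
    apply/integrableP; split; first by apply/measurable_EFinP; exact: mks.
    by apply: le_lt_trans (dle N) _; rewrite ltey_eq; apply/orP; left; exact: dN.
  apply: eq_integrable (@itgD _ _ _ mu D mD _ _ id (Ji N)) => // t _ /=.
  by rewrite subrK.
have main : `|v psi - \int[mu]_(t in D) k t| <= 0.
  apply/ler_addgt0Pr => eps eps0; rewrite add0r.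
  have eps2 : 0 < eps / 2 by rewrite divr_gt0.
  have [n [[dn en] [d1 e1]]] : exists n, (del n \is a fin_num /\ Hm1norm (v - sfun_integral D (s n))%R \is a fin_num)
      /\ (fine (del n) < eps / 2 /\ fine (Hm1norm (v - sfun_integral D (s n))%R) < eps / 2).
    have near_d : \forall n \near \oo, fine (del n) < eps / 2 by apply: (cvgr_lt 0 d0).
    have near_e : \forall n \near \oo, fine (Hm1norm (v - sfun_integral D (s n))%R) < eps / 2.
      by apply: (cvgr_lt 0 e0).
    have [N _ hN] := filterI (filterI dfin efin) (filterI near_d near_e).
    by exists N; have [[? ?] [? ?]] := hN N (leqnn N).
  have h1 : `|v psi - J n| <= fine (Hm1norm (v - sfun_integral D (s n))%R).
    rewrite -lee_fin fineK//; exact: (Hm1norm_ub (v - sfun_integral D (s n)) hp p1).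
  have h2 : `|J n - \int[mu]_(t in D) k t| <= fine (del n).
    have iB := @itgB _ _ _ mu D mD _ _ ik (Ji n).
    have E : \int[mu]_(t in D) (k t - sfun_eval (s n) t psi) = \int[mu]_(t in D) k t - J n.
      by rewrite JE RintegralB//; exact: Ji.
    have nB := @le_Rint_norm _ _ _ mu D mD _ _ iB (@itg_norm _ _ _ mu D _ iB) (fun x _ => lexx _).
    rewrite distrC -E; apply: (le_trans nB).
    rewrite -lee_fin /Rintegral !fineK//; (exact: dle ||
      (apply: integrable_fin_num => //; exact: (@itg_norm _ _ _ mu D _ iB))).
  rewrite (_ : v psi - _ = (v psi - J n) + (J n - \int[mu]_(t in D) k t)); last by ring.
  by apply: le_trans (ler_normD _ _) _; move: h1 h2 d1 e1; lra.
have ih : mu.-integrable D (EFin \o h).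
  apply: eq_integrable (@itgZ _ _ _ mu D mD r^-1 _ ik) => // t _ /=.
  by rewrite mulKf// gt_eqF.
move: main; rewrite normr_le0 subr_eq0 /psi (Hm1_homog r nv (test_H10 tp)) /k RintegralZl//.
by move=> /eqP /(mulfI _); apply; rewrite gt_eqF.
Qed.

End DualBochner.

(** * From the equation in H^-1 to the scalar formulation *)

Section FinalReduction.
Context {R : realType}.
Local Notation mu := (@lebesgue_measure R).
Local Notation I01 := (`]0, 1[%classic : set R).

Let mI : measurable I01. Proof. exact: measurable_itv. Qed.

(** Values of the potential above its essential bound are replaced by 0, which yields a
    representative bounded at every point, as the kernel estimates require. *)
Lemma Lq01_oo_bounded (p : R -> R) : Lq01 +oo%E p -> measurable_fun I01 p /\
  exists (q : R -> R) (P : R), [/\ measurable_fun setT q, forall x, `|q x| <= P &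
    \forall x \ae mu, x \in `]0, 1[ -> p x = q x].
Proof.
move=> h; have := sub_Lfun_mfun h; rewrite inE/= => mp0.
have := sub_Lfun_finLfun h; rewrite inE/= /finite_norm unlock.
have mT0 : (0 < mu [set: R])%E.
  apply: (@lt_le_trans _ _ (mu I01)).
    by rewrite (@mu_itv_oo R 0 1 ler01) subr0 lte01.
  by apply: le_measure; rewrite ?inE.
rewrite mT0 => fe.
pose r := p \_ I01; pose M := ess_sup mu (abse \o (EFin \o r)).
have [K KM] : exists K : R, (M <= K%:E)%E.
  move: fe; rewrite -/M; case: M => [K| |] // _; first by exists K.
  by exists 0; exact: leNye.
have bnd : \forall x \ae mu, `|r x| <= K.
  by apply: aeS (@ess_sup_ge _ _ _ mu (abse \o (EFin \o r))) => x hx; rewrite -lee_fin (le_trans hx).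
have mr : measurable_fun setT r by exact: mp0.
split; first by apply/(measurable_restrictT p mI).
exists (fun x => if `|r x| <= K then r x else 0), `|K|; split.
- apply: measurable_fun_ifT => //; apply: measurable_fun_ler => //.
  exact: measurableT_comp.
- by move=> x; case: ifP => h'; rewrite ?normr0// (le_trans h')// ler_norm.
apply: aeS bnd => x hx xI; rewrite hx /r patchE mem_set//.
Qed.

(** [v] equals [u] on a measurable set of good times with full measure in ]0, T[ and is 0 elsewhere,
    so that integrability in [x] and vanishing on ]c, d[ hold at every time without exception. *)
Lemma u_side (T c d : R) (u : R -> R -> R) : 0 < T -> L2_bochner H1 T u ->
  (\forall t \ae mu, t \in `]0, T[ -> \forall x \ae mu, x \in `]c, d[ -> u t x = 0) ->
  exists (v : R -> R -> R) (M : R), [/\ 0 <= M /\ (forall t, mu.-integrable I01 (EFin \o v t)),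
    (forall f, bounded_meas f -> measurable_fun `]0, T[ (fun t => pairing (v t) f)),
    (forall f S, bounded_meas f -> 0 < S -> \int[mu]_(x in I01) (f x ^+ 2) <= S ^+ 2 ->
      (\int[mu]_(t in `]0%R, T[) `|pairing (v t) f|%:E <= (S * M)%:E)%E),
    (forall t, \forall x \ae mu, x \in `]c, d[ -> v t x = 0) &
    \forall t \ae mu, t \in `]0, T[ -> u t = v t /\ ncar H1 (u t)].
Proof.
move=> T0 [[ucar [r [vr cr]]] u2] u0.
have mD : measurable (`]0, T[%classic : set R) by exact: measurable_itv.
pose good t := [/\ ncar H1 (u t), nnorm H1 (u t - sfun_eval (r n) t) @[n --> \oo] --> 0%E &
  \forall x \ae mu, x \in `]c, d[ -> u t x = 0].
have : \forall t \ae mu, t \in `]0, T[ -> good t.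
  by apply: aeS (aeI ucar (aeI cr u0)) => t [h1 [h2 h3]] tT; split; [exact: h1|exact: h2|exact: h3].
move=> [N [mN N0 hN]].
pose G := `]0, T[%classic `\` N.
have mG : measurable G by exact: measurableD.
have Gg t : G t -> good t.
  by move=> [tT nN]; apply: contrapT => ng; apply: nN; apply: hN => /= h; apply: ng; exact: h.
pose v t := if t \in G then u t else (fun=> 0).
have vG t : t \in G -> v t = u t by rewrite /v => ->.
have aG : \forall t \ae mu, t \in `]0, T[ -> t \in G.
  exists N; split => // t /= h; apply: contrapT => nN; apply: h => tT.
  by rewrite inE; split.
have p0 f : pairing (fun=> 0) f = 0 :> R.
  rewrite /pairing (_ : (fun x => _) = (fun=> 0)); first by rewrite Rintegral_cst// mul0r.
  by apply/funext => x; rewrite mul0r.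
have mpair f : bounded_meas f -> measurable_fun setT (fun t => pairing (v t) f).
  move=> bf; have [mf [C fC]] := bf; have C0 : 0 <= C by apply: le_trans (fC 0).
  pose h n t := \1_G t * pairing (sfun_eval (r n) t) f.
  (* Pairing with a bounded function is continuous for the H^1 norm, so the pairing is a limit of
     pairings with simple functions, which are measurable. *)
  apply: (@measurable_fun_cvg _ _ _ setT h).
    move=> n; apply: measurable_funM; first exact: (bounded_meas_indic mG).1.
    exact: (measurable_sfun_eval (pairing^~ f) (vr n)).
  move=> t _; have [tG|tG] := boolP (t \in G); last first.
    rewrite /v (negbTE tG) p0; apply: cvg_near_cst; apply: nearW => n.
    by rewrite /h indicE (negbTE tG) mul0r.
  have [nu cu _] := Gg t (set_mem tG); rewrite vG//.
  have [S S0 fS] : exists2 S : R, 0 < S & sqnorm f <= S ^+ 2.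
    exists (Num.sqrt (sqnorm f) + 1); first by rewrite ltr_wpDl ?sqrtr_ge0.
    rewrite -[leLHS]sqr_sqrtr ?sqnorm_ge0// lerXn2r ?nnegrE ?sqrtr_ge0 ?addr_ge0 ?sqrtr_ge0//.
    by rewrite lerDl.
  have nr n : ncar H1 (sfun_eval (r n) t) by exact: (sfun_eval_ncar H1_0 (@H1_lin R)).
  have nd n : ncar H1 (u t - sfun_eval (r n) t).
    by have := H1_lin (-1) (nr n) nu; rewrite scaleN1r addrC.
  have /fine_cvgP[_ cu'] := cu.
  have bnd n : `|pairing (u t) f - h n t| <= fine (H1norm (u t - sfun_eval (r n) t)) * S.
    have -> : pairing (u t) f - h n t = pairing (u t - sfun_eval (r n) t) f.
      rewrite /h indicE tG mul1r /pairing -RintegralB//.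
      - by apply: eq_Rintegral => x _; rewrite -mulrBl.
      - by apply: pairing_bm_itg => //; apply: square_itg_itg; have [] := H1P nu.
      - by apply: pairing_bm_itg => //; apply: square_itg_itg; have [] := H1P (nr n).
    have := H1_pairing_le (nd n) bf S0 fS.
    have [s1 w1] := H1P (nd n); rewrite (H1normE (nd n) w1) -EFinM lee_fin.
    exact.
  apply/cvgrPdist_le => e e0; have eS : 0 < e / S by rewrite divr_gt0.
  move/cvgrPdist_le : cu' => /(_ _ eS); apply: filterS => n /=.
  rewrite sub0r normrN => hn; apply: le_trans (bnd n) _.
  by rewrite -ler_pdivlMr// (le_trans (ler_norm _)).
pose K := fine (\int[mu]_(t in `]0%R, T[) (nnorm H1 (u t) ^+ 2))%E.
have KE : (\int[mu]_(t in `]0%R, T[) (nnorm H1 (u t) ^+ 2) = K%:E)%E.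
  rewrite /K fineK// ge0_fin_numE//; apply: integral_ge0 => t _.
  by rewrite expe2; apply: mule_ge0; exact: sqrte_ge0.
have K0 : 0 <= K.
  apply: fine_ge0; apply: integral_ge0 => t _.
  by rewrite expe2; apply: mule_ge0; exact: sqrte_ge0.
exists v, (T + K); split.
- split; first by rewrite addr_ge0// ltW.
  move=> t; rewrite /v; case: ifPn => tG; last exact: (@itg0 _ _ _ mu I01).
  by have [nu _ _] := Gg t (set_mem tG); apply: square_itg_itg; have [] := H1P nu.
- by move=> f bf; apply: measurable_funTS; exact: mpair.
- move=> f S bf S0 fS; pose q t := (`|pairing (v t) f| / S) ^+ 2.
  have mq0 : measurable_fun setT (fun t => `|pairing (v t) f|) by apply: measurableT_comp => //; exact: mpair.
  have mq : measurable_fun `]0, T[ (EFin \o q).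
    apply/measurable_EFinP; apply: measurable_funTS; apply: measurable_funX.
    by apply: measurable_funM => //; exact: measurable_cst.
  have q0 t : 0 <= q t by exact: sqr_ge0.
  have qK : (\int[mu]_(t in `]0%R, T[) (q t)%:E <= K%:E)%E.
    have n0 t : `]0, T[%classic t -> (0 <= nnorm H1 (u t) ^+ 2)%E.
      by move=> _; rewrite expe2; apply: mule_ge0; exact: sqrte_ge0.
    have qE0 t : `]0, T[%classic t -> (0 <= (q t)%:E)%E by move=> _; rewrite lee_fin q0.
    rewrite -KE; apply: le_nnintegral_ae; [exact: mD|exact: qE0|exact: n0|].
    apply: aeS aG => t tG tT; have {}tG := tG tT; rewrite /q vG//.
    have [nu _ _] := Gg t (set_mem tG); have [s1 w1] := H1P nu.
    have := H1_pairing_le nu bf S0 fS; rewrite [nnorm H1 _](H1normE nu w1) (H1normE nu w1) -EFinM lee_fin.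
    set z := Num.sqrt _; have z0 : 0 <= z by exact: sqrtr_ge0.
    move=> hz.
    rewrite expe2 -EFinM lee_fin -expr2 lerXn2r ?nnegrE ?divr_ge0 ?(ltW S0)//.
    by rewrite ler_pdivrMr.
  (* From y <= 1 + y^2 with y the pairing divided by S: the first term integrates to T, the second
     to at most K, which explains the constant T + K. *)
  apply: (@le_trans _ _ (\int[mu]_(t in `]0%R, T[) (S%:E * (1 + (q t)%:E)))%E).
    have f0 t : `]0, T[%classic t -> (0 <= `|pairing (v t) f|%:E)%E.
      by move=> _; rewrite lee_fin normr_ge0.
    have g0 t : `]0, T[%classic t -> (0 <= S%:E * (1 + (q t)%:E))%E.
      by move=> _; rewrite -EFinD -EFinM lee_fin mulr_ge0 ?(ltW S0)// addr_ge0 ?q0.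
    apply: le_nnintegral_ae; [exact: mD|exact: f0|exact: g0|].
    apply: aeW => t _; rewrite -EFinD -EFinM lee_fin /q.
    rewrite mulrC -ler_pdivrMr//; move: (_ / S) => y.
    by have := sqr_ge0 (y - 1); have := sqr_ge0 y; rewrite !expr2; nra.
  rewrite ge0_integralZl_EFin//; last 3 first.
  + by move=> t _; rewrite -EFinD lee_fin addr_ge0 ?q0.
  + by apply: emeasurable_funD => //; exact: measurable_cst.
  + exact: ltW.
  rewrite EFinM; apply: lee_wpmul2l; first by rewrite lee_fin ltW.
  rewrite ge0_integralD//; last by move=> t _; rewrite lee_fin q0.
  have muT : mu `]0%R, T[%classic = T%:E by rewrite (mu_itv_oo (ltW T0)) subr0.
  rewrite EFinD; apply: leeD; last exact: qK.
  rewrite integral_cst// mul1e le_eqVlt; apply/orP; left; apply/eqP; exact: muT.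
- move=> t; rewrite /v; case: ifPn => tG; last exact: aeW.
  by have [] := Gg t (set_mem tG).
apply: aeS aG => t tG tT; have {}tG := tG tT; rewrite vG//; split => //.
by have [] := Gg t (set_mem tG).
Qed.

(** Two identities in H^-1, the equation and u - a = J^alpha g, are evaluated at a test function. A
    vanishing dual norm forces a vanishing value, evaluation commutes with the Bochner integral, and
    eliminating [g] gives a scalar integral equation. *)
Lemma equation_weak (alpha T : R) (p q a : R -> R) (P : R) (u v : R -> R -> R) :
  0 < alpha -> alpha < 1 -> 0 < T ->
  measurable_fun I01 p -> measurable_fun setT q -> (forall x, `|q x| <= P) ->
  (\forall x \ae mu, x \in `]0, 1[ -> p x = q x) -> Lq01 2%:E a ->
  Halpha Hm1 T alpha (fun t => toHm1 (u t - a)) ->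
  (\forall t \ae mu, t \in `]0, T[ ->
     nnorm Hm1 (dt_alpha Hm1 T alpha (fun s => toHm1 (u s - a)) t
                - dxx (u t) + toHm1 (p * u t)) = 0%E) ->
  (forall f, bounded_meas f -> measurable_fun `]0, T[ (fun t => pairing (v t) f)) ->
  (\forall t \ae mu, t \in `]0, T[ -> u t = v t /\ ncar H1 (u t)) ->
  forall phi, smooth phi -> csupp 0 1 phi ->
  \forall t \ae mu, t \in `]0, T[ -> pairing (v t) phi - pairing a phi =
    (Gamma alpha)^-1 * \int[mu]_(tau in `]0, t[) ((t - tau) `^ (alpha - 1) *
      (pairing (v tau) (derive1 (derive1 phi)) - pairing (v tau) (fun x => q x * phi x))).
Proof.
move=> a0 a1 T0 mp mq qP pq sa hua heq mv uv phi ps pc.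
have tp : test_fun01 phi by exact/test_fun01P.
have bphi := test_bm tp; have b2 := test_bm (test_derive (test_derive tp)).
have bq : bounded_meas q by split => //; exists P.
have mD : measurable (`]0, T[%classic : set R) by exact: measurable_itv.
set g := dt_alpha _ _ _ _ in heq.
(* [dt_alpha] selects an arbitrary preimage; membership in [Halpha] guarantees that the selected
   function is one. *)
have [[sg g2] gw] : is_RLint_preimage Hm1 T alpha (fun s => toHm1 (u s - a)) g.
  exact: (@xgetPex _ (fun=> 0) [set g | is_RLint_preimage Hm1 T alpha (fun s => toHm1 (u s - a)) g] hua).
have [C C0 hC] := Hm1_test_bound tp.
have z F : (forall r : R, F (r *: phi) = r * F phi) -> nnorm Hm1 F = 0%E -> F phi = 0.
  move=> hF F0; have := hC F hF; rewrite [Hm1norm F]F0 mule0 lee_fin normr_le0.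
  by move/eqP.
have hZ F (r : R) : ncar Hm1 F -> F (r *: phi) = r * F phi.
  by move=> nF; apply: Hm1_homog => //; exact: test_H10.
pose Q tau := pairing (v tau) (derive1 (derive1 phi)) - pairing (v tau) (fun x => q x * phi x).
have mQ : measurable_fun `]0, T[ Q.
  by apply: measurable_funB; apply: mv => //; exact: bounded_measM.
have gQ : \forall t \ae mu, t \in `]0, T[ -> g t phi = Q t.
  apply: aeS (aeI sg.1 (aeI heq uv)) => t [h1 [h2 h3]] tT.
  have ng := h1 tT; have {}h2 := h2 tT; have [uvt nu] := h3 tT.
  have [ndx dxE] := dxxP nu; have [su _] := H1P nu; have iu := square_itg_itg su.
  have pu f : bounded_meas f -> toHm1 (p * u t) f = pairing (u t) (fun x => q x * f x).
    move=> bf; apply: Rint_ae_eq => //.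
    - apply: measurable_funM; last exact: measurable_funTS bf.1.
      by apply: measurable_funM => //; exact: itg_meas iu.
    - exact: itg_meas (pairing_bm_itg iu (bounded_measM bq bf)).
    apply: aeS pq => x hx xI; rewrite -hx// mulrA; congr (_ * _); exact: mulrC.
  have hF (r : R) : (g t - dxx (u t) + toHm1 (p * u t)) (r *: phi) =
      r * (g t - dxx (u t) + toHm1 (p * u t)) phi.
    have ev psi : (g t - dxx (u t) + toHm1 (p * u t)) psi =
      g t psi - dxx (u t) psi + toHm1 (p * u t) psi by [].
    rewrite !ev (hZ _ r ng) (hZ _ r ndx) (pu _ (bounded_measZ r bphi)) (pu _ bphi).
    have -> : (fun x => q x * (r *: phi) x) = (fun x => r * (q x * phi x)).
      by apply/funext => x; exact: mulrCA.
    by rewrite (pairingZ r iu (bounded_measM bq bphi)); ring.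
  have := z _ hF h2; rewrite -[LHS]/(g t phi - dxx (u t) phi + toHm1 (p * u t) phi).
  by rewrite pu// dxE// /Q -uvt => h; move: h; lra.
(* The empty sequence encodes the simple function 0, so this is a measurable version of the norm of
   [g] itself. *)
have [N [mN N0 gN]] := measurable_norm Hm1_0 (@Hm1_lin R) (@Hm1norm_ge0 R)
  (fun F (nF : ncar Hm1 F) => nF.2) (@Hm1normD R) (@Hm1normZ R) sg
  (s := [::]) (fun c (h : c \in [::]) => False_ind _ (notF h)).
have gN' : \forall t \ae mu, t \in `]0, T[ -> nnorm Hm1 (g t) = (N t)%:E.
  by apply: aeS gN => t h tT; rewrite -h// /sfun_eval big_nil subr0.
have iN : mu.-integrable `]0, T[ (EFin \o N).
  have iN2 : mu.-integrable `]0, T[ (EFin \o (fun t => N t ^+ 2)).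
    apply/integrableP; split.
      by apply/measurable_EFinP; apply: measurable_funTS; exact: measurable_funX.
    apply: le_lt_trans g2; apply: le_nnintegral_ae => //.
    - by move=> t _; rewrite expe2; apply: mule_ge0; exact: Hm1norm_ge0.
    by apply: aeS gN' => t h tT; rewrite h//= ger0_norm ?sqr_ge0// expe2 -EFinM -expr2.
  have i1 : mu.-integrable `]0, T[ (EFin \o (fun=> 1 : R)).
    apply: (@fin_meas_itg _ _ _ mu _ mD _ 1).
    - by have := ltry (T - 0 : R); rewrite -(mu_itv_oo (ltW T0)).
    - exact: measurable_cst.
    - by move=> t _; rewrite normr1.
  apply: (@itg_le _ _ _ mu _ mD _ (fun t => 1 + N t ^+ 2)).
  - exact: measurable_funTS.
  - by move=> t _; rewrite ger0_norm//; have := sqr_ge0 (N t - 1); have := N0 t; rewrite !expr2; nra.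
  - exact: (@itgD _ _ _ mu _ mD).
(* Used here only for its last assertion: for almost every [t] the singular kernel times the norm of
   [g] is integrable on ]0, t[, which makes the Bochner integral exist. The value s = 1 is
   arbitrary. *)
have [zeta [_ _ zL]] := laplace_kernel a0 a1 T0 ltr01.
have [_ _ ikN] := zL N iN.
have ia := square_itg_itg ((Lq01_2P a).1 sa).
apply: aeS (aeI ikN (aeI gw uv)) => t [h1 [h2 h3]] tT.
have {}h1 := h1 tT; have {}h2 := h2 tT; have [uvt nu] := h3 tT.
have [su _] := H1P nu; have iu := square_itg_itg su.
have t0 : 0 < t by move: tT; rewrite in_itv/= => /andP[].
have sub : `]0, t[%classic `<=` `]0, T[%classic.
  by apply: subset_itvl; rewrite bnd_simp; move: tT; rewrite in_itv/= => /andP[_ /ltW].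
have mt : measurable (`]0, t[%classic : set R) by exact: measurable_itv.
have ft : (mu `]0%R, t[%classic < +oo)%E by rewrite (mu_itv_oo (ltW t0)) ltry.
pose kap tau := (t - tau) `^ (alpha - 1).
have mk : measurable_fun setT kap.
  have mpw : measurable_fun setT (fun x : R => x `^ (alpha - 1)) by exact: measurable_powR.
  have md : measurable_fun setT (fun z : R => t - z) by exact: measurable_funB.
  exact: (measurableT_comp mpw md).
have k0 tau : 0 <= kap tau by exact: powR_ge0.
have sgt : strongly_measurable Hm1 `]0, t[ g.
  have [gcar [r [vr cr]]] := sg; split; first by apply: aeS gcar => x h xt; apply: h; exact: sub.
  by exists r; split => //; apply: aeS cr => x h xt; apply: h; exact: sub.
have gNt : \forall x \ae mu, `]0, t[%classic x -> nnorm Hm1 (g x) = (N x)%:E.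
  by apply: aeS gN' => x h xt; apply: h; exact: sub.
have ex := bochner_exists mt ft mk k0 sgt mN N0 gNt h1.
pose w := bochner_integral Hm1 `]0, t[ (fun tau => (t - tau) `^ (alpha - 1) *: g tau).
have wP : is_bochner_integral Hm1 `]0, t[ (fun tau => kap tau *: g tau) w.
  exact: (@xgetPex _ 0 [set v | is_bochner_integral Hm1 `]0, t[ (fun tau => kap tau *: g tau) v] ex).
have mkQ : measurable_fun `]0, t[ (fun tau => kap tau * Q tau).
  apply: measurable_funM; first exact: measurable_funTS.
  exact: (measurable_funS mD sub mQ).
have kgQ : \forall x \ae mu, `]0, t[%classic x -> (kap x *: g x) phi = kap x * Q x.
  by apply: aeS gQ => x h xt; rewrite -h//; exact: sub.
have wE := bochner_eval mt ft wP tp mkQ kgQ.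
have tH f : bounded_meas f -> toHm1 (u t - a) f = pairing (u t) f - pairing a f.
  move=> bf; rewrite /pairing -RintegralB//; [|exact: pairing_bm_itg..].
  by apply: eq_Rintegral => x _; rewrite -mulrBl.
have hF (r : R) : (toHm1 (u t - a) - RLint Hm1 alpha g t) (r *: phi) =
    r * (toHm1 (u t - a) - RLint Hm1 alpha g t) phi.
  have ev psi : (toHm1 (u t - a) - RLint Hm1 alpha g t) psi =
    toHm1 (u t - a) psi - (Gamma alpha)^-1 * w psi by [].
  rewrite !ev !tH//; last exact: bounded_measZ.
  rewrite (hZ w r wP.1) (pairingZ r iu bphi) (pairingZ r ia bphi); ring.
have := z _ hF h2; rewrite -[LHS]/(toHm1 (u t - a) phi - (Gamma alpha)^-1 * w phi).
by rewrite tH// wE -uvt => /eqP; rewrite subr_eq0 => /eqP.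
Qed.

End FinalReduction.

Theorem corollary1p3 (R : realType) (alpha T c d : R)
  (p a : R -> R) (u : R -> R -> R)
  (halpha : 0 < alpha < 1) (hT : 0 < T)
  (hI : 0 <= c /\ c < d /\ d <= 1)
  (hp : Lq01 +oo%E p) (ha : Lq01 2%:E a)
  (hu : L2_bochner H1 T u)
  (hua : Halpha Hm1 T alpha (fun t => toHm1 (u t - a)))
  (heq : \forall t \ae (@lebesgue_measure R), t \in `]0, T[ ->
     nnorm Hm1 (dt_alpha Hm1 T alpha (fun s => toHm1 (u s - a)) t
                - dxx (u t) + toHm1 (p * u t)) = 0%E)
  (hu0 : \forall t \ae (@lebesgue_measure R), t \in `]0, T[ ->
     \forall x \ae (@lebesgue_measure R), x \in `]c, d[ -> u t x = 0) :
  \forall t \ae (@lebesgue_measure R), t \in `]0, T[ ->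
    \forall x \ae (@lebesgue_measure R), x \in `]0, 1[ -> u t x = 0.
Proof.
have /andP[a0 a1] := halpha; have [c0 [cd d1]] := hI.
have [mp [q [P [mq qP pq]]]] := Lq01_oo_bounded hp.
have [v [M [[M0 iv] mv vM v0 uv]]] := u_side hT hu hu0.
have ia := square_itg_itg ((Lq01_2P a).1 ha).
have eqn := equation_weak a0 a1 hT mp mq qP pq ha hua heq mv uv.
have vz := scalar_uniqueness a0 a1 hT c0 cd d1 M0 mq qP ia iv mv vM eqn v0.
apply: aeS (aeI uv vz) => t [h1 h2] tT; have [-> _] := h1 tT; exact: h2.
Qed.
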